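(* Let $\Lambda$ (''2D2'') be the pointed bipartite graph with one vertex at each of the depths $0,1,2$, two vertices at depth $3$, and one vertex at each of the depths $4,5,6$, in which the depth $0,1,2$ vertices form a path, the depth $2$ vertex is joined to both depth $3$ vertices, both depth $3$ vertices are joined to the depth $4$ vertex, and the depth $4,5,6$ vertices form a path (all edges simple, no other edges), and in which every even-depth vertex is self-dual. Let $\Lambda'$ be the pointed bipartite graph with one vertex at each of the depths $0,1,2$, forming a path, two vertices $a,b$ at depth $3$, four vertices $v_1,v_2,v_3,v_4$ at depth $4$, and one vertex $w$ at depth $5$, in which the depth $2$ vertex is joined to $a$ and $b$, $a$ is joined to $v_1,v_2$, $b$ is joined to $v_3,v_4$, and $w$ is joined to $v_1$ and $v_4$ (all edges simple, no other edges), and in which the vertices at depths $0$ and $2$ and the vertices $v_1,v_4$ are self-dual while $v_2,v_3$ are dual to each other. Then there is no subfactor planar algebra with principal graphs $(\Gamma_+,\Gamma_-)=(\Lambda,\Lambda')$, and there is no subfactor planar algebra with principal graphs $(\Gamma_+,\Gamma_-)=(\Lambda,\Lambda)$.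
   Context: A subfactor planar algebra is a shaded planar $*$-algebra $\mathcal{P}_\bullet=(\mathcal{P}_{n,\pm})_{n\ge 0}$ over $\mathbb{C}$ which is spherical, has finite-dimensional box spaces, has $\dim\mathcal{P}_{0,\pm}=1$, and whose trace inner product is positive definite. Its principal graphs $\Gamma_+$ and $\Gamma_-$ are the pointed bipartite graphs whose vertices are the equivalence classes of minimal projections in $\bigcup_n\mathcal{P}_{n,+}$, respectively $\bigcup_n\mathcal{P}_{n,-}$, with edges encoding the inclusions (adding one string on the right); the depth of a vertex is its distance from the base vertex (the class of the empty diagram). Rotation by $\pi$ induces a duality: an involution on the even-depth vertices of each of $\Gamma_+$ and $\Gamma_-$, and a depth-preserving bijection between the odd-depth vertices of $\Gamma_+$ and those of $\Gamma_-$. *)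

(* Defs.v *)
From mathcomp Require Import all_boot all_order all_algebra.
From mathcomp Require Import reals complex.
From mathcomp Require Import zify.

Set Implicit Arguments.
Unset Strict Implicit.
Unset Printing Implicit Defensive.

Import Order.TTheory GRing.Theory Num.Theory.

(* A colour (n, s) describes a disc with 2n marked boundary points; s is the  *)
(* shading of the region at the starred boundary interval (false = unshaded,  *)
(* the sign +; true = shaded, the sign -).  Marked points are numbered        *)
(* clockwise from the star.                                                   *)
(*                                                                            *)
(* A planar tangle is drawn in generic position with respect to the height    *)
(* function.  Every disc is drawn as a rectangle with all its marked points   *)
(* on its top edge (hence numbered from left to right), so that its starred   *)
(* interval consists of its other three sides.  Reading the picture from      *)
(* bottom to top, it is a sequence of elementary events, each recorded with   *)
(* the number of strands to its left: a local minimum of a string, a local    *)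
(* maximum of a string, or an input disc.  Every shaded planar tangle is      *)
(* isotopic to one in this position, and two tangles in this position are     *)
(* isotopic if and only if they are related by the moves below.               *)

Definition color := (nat * bool)%type.
Definition plus : bool := false.
Definition minus : bool := true.

Inductive event (I : Type) := Cup | Cap | Disc of I.
Arguments Cup {I}.
Arguments Cap {I}.

Definition word (I : Type) := seq (nat * event I).

Section Words.
Variables (I : finType) (c : I -> color).

Definition ins (e : event I) : nat := if e is Cap then 2 else 0.
Definition outs (e : event I) : nat :=
  match e with Cup => 2 | Cap => 0 | Disc i => (c i).1.*2 end.

(* The region with l strands to its left has shading s (+) odd l, where s is  *)
(* the shading of the leftmost region.                                        *)
Definition fits (s : bool) (k : nat) (x : nat * event I) : bool :=
  (x.1 + ins x.2 <= k) &&
  (if x.2 is Disc i then (c i).2 == s (+) odd x.1 else true).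

(* w leads from k strands at the bottom to k' strands at the top. *)
Fixpoint typed (s : bool) (k : nat) (w : word I) (k' : nat) : bool :=
  if w is x :: w' then fits s k x && typed s (k - ins x.2 + outs x.2) w' k'
  else k == k'.

Definition discs (w : word I) : seq I :=
  pmap (fun x => if x.2 is Disc i then Some i else None) w.

Definition is_tangle (c0 : color) (w : word I) : bool :=
  typed c0.2 0 w c0.1.*2 && [forall i, count_mem i (discs w) == 1].

Definition tangle (c0 : color) := {w : word I | is_tangle c0 w}.

Definition mk_tangle c0 w (h : is_tangle c0 w) : tangle c0 := exist _ w h.

Definition cups (l m : nat) : word I := [seq (l + j, Cup) | j <- iota 0 m].
(* m nested maxima joining the m strands left of position l to the m strands  *)
(* right of it *)
Definition caps (l m : nat) : word I := [seq (l - j.+1, Cap) | j <- iota 0 m].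

(* Planar isotopy of diagrams in generic position: straightening a string,    *)
(* exchanging the heights of two horizontally separated events, and turning   *)
(* an input disc by 2 pi.                                                     *)
Inductive move : word I -> word I -> Prop :=
| move_zigzagl l : move [:: (l, Cup); (l.+1, Cap)] [::]
| move_zigzagr l : move [:: (l.+1, Cup); (l, Cap)] [::]
| move_exchange l d e f :
    move [:: (l, e); (l + outs e + d, f)] [:: (l + ins e + d, f); (l, e)]
| move_turn l i : let m := (c i).1.*2 in
    move [:: (l, Disc i)] (cups l m ++ (l + m, Disc i) :: caps (l + m) m).

Inductive isotopic (c0 : color) : tangle c0 -> tangle c0 -> Prop :=
| isotopic_refl T : isotopic T T
| isotopic_sym T T' : isotopic T T' -> isotopic T' T
| isotopic_trans T T' T'' :
    isotopic T T' -> isotopic T' T'' -> isotopic T T''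
| isotopic_move T T' u v w w' : move w w' ->
    val T = u ++ w ++ v -> val T' = u ++ w' ++ v -> isotopic T T'.

(* Reflection in a vertical line; k is the number of strands at the bottom. *)
Fixpoint mirror (k : nat) (w : word I) : word I :=
  if w is (l, e) :: w' then
    (k - l - ins e, e) :: mirror (k - ins e + outs e) w'
  else [::].

End Words.

Definition map_word (I J : Type) (f : I -> J) (w : word I) : word J :=
  [seq (x.1, match x.2 with Cup => Cup | Cap => Cap | Disc i => Disc (f i) end)
    | x <- w].

Definition shift_word (I : Type) (l : nat) (w : word I) : word I :=
  [seq (l + x.1, x.2) | x <- w].

(* Insertion of the diagrams t i into the input discs of w. *)
Definition subst_word (I : finType) (J : I -> finType)
    (w : word I) (t : forall i, word (J i)) : word {i : I & J i} :=
  flatten [seq match x.2 with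
               | Cup => [:: (x.1, Cup)]
               | Cap => [:: (x.1, Cap)]
               | Disc i => shift_word x.1 (map_word (Tagged J) (t i))
               end | x <- w].

Lemma typed_cat (I : finType) (c : I -> color) s k w1 k1 w2 k2 :
  typed c s k w1 k1 -> typed c s k1 w2 k2 -> typed c s k (w1 ++ w2) k2.
Proof.
elim: w1 k => [|x w1 IH] k /=; first by move/eqP->.
by case/andP=> -> h1 h2; exact: IH.
Qed.

Lemma typed_shift (I J : finType) (c : I -> color) (d : J -> color)
    (f : J -> I) s s' k w k' l r :
  (forall j, c (f j) = d j) -> s' = s (+) odd l ->
  typed d s' k w k' ->
  typed c s (l + k + r) (shift_word l (map_word f w)) (l + k' + r).
Proof.
move=> cf ->; elim: w k => [|[p e] w IH] k /=; first by move/eqP->.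
case/andP=> /andP[/= hp hs] /IH h; apply/andP; split.
  case: e hp hs {h} => [||j] //=; rewrite /fits /= ?cf; try lia.
apply: etrans h; congr typed.
by case: e hp {hs} => [||j] //=; rewrite ?cf; lia.
Qed.

Lemma discs_cat (I : finType) (w1 w2 : word I) :
  discs (w1 ++ w2) = discs w1 ++ discs w2.
Proof. by rewrite /discs pmap_cat. Qed.

Lemma discs_shift (I : finType) l (w : word I) :
  discs (shift_word l w) = discs w.
Proof. by elim: w => [|[p [||i]] w IH] //=; rewrite IH. Qed.

Lemma discs_map (I J : finType) (f : I -> J) (w : word I) :
  discs (map_word f w) = map f (discs w).
Proof. by elim: w => [|[p [||i]] w IH] //=; rewrite IH. Qed.

Lemma subst_wordP (I : finType) (c : I -> color) (c0 : color)
    (J : I -> finType) (d : forall i, J i -> color)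
    (T : tangle c c0) (T' : forall i, tangle (d i) (c i)) :
  is_tangle (fun p : {i : I & J i} => d (tag p) (tagged p)) c0
    (subst_word (val T) (fun i => val (T' i))).
Proof.
case: T => w /= /andP[tw /forallP ow]; apply/andP; split.
  move: tw {ow}; elim: w 0 => [|[l e] w IH] k //=.
  rewrite /fits /= => /andP[/andP[lk hs] /IH h].
  case: e lk hs h => [||i] /= lk hs h; rewrite /fits /=.
  - by rewrite andbT lk h.
  - by rewrite andbT lk h.
  - apply: typed_cat h; rewrite addn0 in lk; rewrite subn0.
    have /andP[tT _] := valP (T' i).
    have := @typed_shift _ _ (fun p : {i : I & J i} => d (tag p) (tagged p))
      _ (Tagged J) c0.2 (c i).2 0 _ _ l (k - l) (fun _ => erefl)
      (eqP hs) tT.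
    by rewrite addn0 subnKC // addnAC subnKC.
apply/forallP=> -[i j].
have dE : discs (subst_word w (fun i => val (T' i))) =
          flatten [seq map (Tagged J) (discs (val (T' i))) | i <- discs w].
  elim: w {tw ow} => [|[l [||i']] w IH] //=.
  by rewrite /subst_word /= discs_cat discs_shift discs_map -IH.
rewrite dE count_flatten -map_comp.
have hc i' : (count_mem (Tagged J j) \o
    (fun i => map (Tagged J) (discs (val (T' i))))) i' = (i' == i) :> nat.
  rewrite /= count_map; case: eqVneq => [->|ne].
    have /andP[_ /forallP/(_ j)/eqP h] := valP (T' i).
    by apply: etrans h; apply: eq_count => j'; rewrite /= eq_Tagged.
  apply/eqP; rewrite -[X in _ == X]/0 -leqn0 leqNgt -has_count.
  apply/hasPn=> j' _ /=; apply: contra ne => /eqP e.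
  by have /= -> := congr1 tag e.
rewrite (eq_map hc) sumn_count /=; exact: ow.
Qed.

Definition subst_tangle (I : finType) (c : I -> color) (c0 : color)
    (J : I -> finType) (d : forall i, J i -> color)
    (T : tangle c c0) (T' : forall i, tangle (d i) (c i)) :
    tangle (fun p : {i : I & J i} => d (tag p) (tagged p)) c0 :=
  mk_tangle (subst_wordP T T').

Lemma mirrorP (I : finType) (c : I -> color) (c0 : color) (T : tangle c c0) :
  is_tangle c c0 (mirror c 0 (val T)).
Proof.
case: T => w /= /andP[tw ow]; apply/andP; split.
  have: ~~ odd 0 by [].
  elim: w 0 tw {ow} => [|[l e] w IH] k //=.
  case/andP; rewrite /fits /= => /andP[lk hs] h ek.
  rewrite {}IH ?andbT //; last first.
    by case: e lk {hs h} => [||i] /= lk; rewrite ?oddD ?odd_double; lia.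
  apply/andP; split; first lia.
  case: e lk hs h => [||i] //= lk /eqP-> _.
  by rewrite subn0 oddB ?(negPf ek) //; lia.
suff -> : discs (mirror c 0 w) = discs w by [].
by elim: w 0 {tw ow} => [|[l [||i]] w IH] k //=; rewrite IH.
Qed.

Definition mirror_tangle (I : finType) (c : I -> color) (c0 : color)
    (T : tangle c c0) : tangle c c0 := mk_tangle (mirrorP T).

Lemma typed_cups (I : finType) (c : I -> color) s l r m :
  typed c s (l + r) (cups I l m) (l + m.*2 + r).
Proof.
have h j k : k = l + j.*2 + r ->
    typed c s k [seq (l + i, Cup) | i <- iota j m] (k + m.*2).
  elim: m j k => [|m IH] j k -> /=; first by rewrite addn0.
  rewrite /fits /= andbT; apply/andP; split; first lia.
  have -> : l + j.*2 + r + m.+1.*2 = l + j.+1.*2 + r + m.*2 by lia.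
  by apply: etrans (IH j.+1 _ erefl); congr typed; lia.
have -> : l + m.*2 + r = l + r + m.*2 by lia.
by apply: h; lia.
Qed.

Lemma typed_caps (I : finType) (c : I -> color) s l r m :
  typed c s (l + m.*2 + r) (caps I (l + m) m) (l + r).
Proof.
rewrite /caps.
have h j m' : j + m' = m ->
    typed c s (l + m'.*2 + r) [seq (l + m - i.+1, Cap) | i <- iota j m'] (l + r).
  elim: m' j => [|m' IH] j jm /=; first by rewrite double0 addn0.
  rewrite /fits /= andbT; apply/andP; split; first lia.
  by apply: etrans (IH j.+1 _); [congr typed; lia|lia].
by apply: h.
Qed.

Lemma discs_cups (I : finType) l m : discs (cups I l m) = [::].
Proof. by rewrite /cups; elim: (iota 0 m) => //= j s ->. Qed.

Lemma discs_caps (I : finType) l m : discs (caps I l m) = [::].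
Proof. by rewrite /caps; elim: (iota 0 m) => //= j s ->. Qed.

Lemma is_tangle_unit (c : unit -> color) (c0 : color) w :
  typed c c0.2 0 w c0.1.*2 -> discs w = [:: tt] -> is_tangle c c0 w.
Proof. by rewrite /is_tangle => -> ->; apply/forallP=> -[]. Qed.

Section BasicTangles.
Variables (n : nat) (s : bool).

Definition empty_word : word void := [::].
Lemma empty_wordP (c : void -> color) : is_tangle c (0, s) empty_word.
Proof. by apply/andP; split=> //; apply/forallP=> -[]. Qed.
Definition empty_tangle : tangle (fun i : void => match i with end) (0, s) :=
  mk_tangle (empty_wordP _).

Definition id_word : word unit := [:: (0, Disc tt)].
Lemma id_wordP : is_tangle (fun _ : unit => (n, s)) (n, s) id_word.
Proof. by apply: is_tangle_unit => //=; rewrite /fits /= addbF !eqxx. Qed.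
Definition id_tangle : tangle (fun _ : unit => (n, s)) (n, s) :=
  mk_tangle id_wordP.

(* The n marked points 1, ..., n of a disc of colour (n, s) form its top edge *)
(* and n+1, ..., 2n, from right to left, its bottom edge, when it is drawn in *)
(* the usual way with n strings above, n below and the star on the left.      *)

Definition right_string_word : word unit := [:: (0, Disc tt); (n, Cup)].
Lemma right_string_wordP :
  is_tangle (fun _ : unit => (n, s)) (n.+1, s) right_string_word.
Proof.
apply: is_tangle_unit => //=.
by rewrite /fits /= addbF !eqxx /=; apply/andP; split; lia.
Qed.
Definition right_string_tangle : tangle (fun _ : unit => (n, s)) (n.+1, s) :=
  mk_tangle right_string_wordP.

Definition right_closure_word : word unit := (0, Disc tt) :: caps _ n n.
Lemma right_closure_wordP :
  is_tangle (fun _ : unit => (n, s)) (0, s) right_closure_word.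
Proof.
apply: is_tangle_unit => /=; last by rewrite discs_caps.
rewrite /fits /= addbF eqxx /=.
by have := typed_caps (fun _ : unit => (n, s)) s 0 0 n; rewrite addn0.
Qed.
Definition right_closure_tangle : tangle (fun _ : unit => (n, s)) (0, s) :=
  mk_tangle right_closure_wordP.

Definition left_closure_word : word unit :=
  [:: (0, Cup); (1, Disc tt); (0, Cap); (0, Cap)].
Lemma left_closure_wordP :
  is_tangle (fun _ : unit => (1, s)) (0, ~~ s) left_closure_word.
Proof. by apply: is_tangle_unit => //=; rewrite /fits /= addbT negbK eqxx. Qed.
Definition left_closure_tangle : tangle (fun _ : unit => (1, s)) (0, ~~ s) :=
  mk_tangle left_closure_wordP.

Definition rotation_word : word unit := cups _ 0 n ++ (n, Disc tt) :: caps _ n n.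
Lemma rotation_wordP :
  ~~ odd n -> is_tangle (fun _ : unit => (n, s)) (n, s) rotation_word.
Proof.
move=> en; apply: is_tangle_unit; last first.
  by rewrite discs_cat /= discs_cups discs_caps.
apply: typed_cat (typed_cups _ _ 0 0 _) _ => /=.
rewrite /fits /= (negPf en) addbF eqxx andbT; apply/andP; split; first lia.
have := typed_caps (fun _ : unit => (n, s)) s 0 n.*2 n.
by rewrite !add0n addn0 subn0.
Qed.
Definition rotation_tangle (en : ~~ odd n) :
    tangle (fun _ : unit => (n, s)) (n, s) :=
  mk_tangle (rotation_wordP en).

End BasicTangles.

(* A disc of colour (a, s) with a.*2 = m + k represents a morphism from k     *)
(* strings to m strings: its points 1, ..., m are on top, and m+1, ..., m+k,  *)
(* from right to left, at the bottom.  Below, true is the upper and false the *)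
(* lower disc of a vertical composition.                                      *)
Section Composition.
Variables (m k n a b r : nat) (s : bool).

Definition comp_colors (i : bool) : color := if i then (a, s) else (b, s).
Definition comp_word : word bool :=
  [:: (0, Disc true), (a.*2, Disc false) & caps _ a.*2 k].
Lemma comp_wordP :
  a.*2 = m + k -> b.*2 = k + n -> r.*2 = m + n ->
  is_tangle comp_colors (r, s) comp_word.
Proof.
move=> ha hb hr; apply/andP; split; last first.
  by rewrite /= discs_caps; apply/forallP=> -[].
rewrite /= /fits /= addbF eqxx odd_double addbF eqxx /= !subn0 add0n addn0 leqnn.
have := typed_caps comp_colors s m n k.
by rewrite -!ha hr; congr typed; lia.
Qed.
Definition comp_tangle (ha : a.*2 = m + k) (hb : b.*2 = k + n)
    (hr : r.*2 = m + n) : tangle comp_colors (r, s) :=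
  mk_tangle (comp_wordP ha hb hr).

End Composition.

Local Open Scope ring_scope.

(* Box spaces are vectTypes, hence finite-dimensional. *)
Record planar_star_algebra (R : realType) := PlanarStarAlgebra {
  box : color -> vectType R[i];
  act : forall (I : finType) (c : I -> color) (c0 : color),
    tangle c c0 -> (forall i, box (c i)) -> box c0;
  star : forall c : color, box c -> box c;
  act_multilinear : forall (I : finType) (c : I -> color) (c0 : color)
    (T : tangle c c0) (x : forall i, box (c i)) (i : I) (z : R[i])
    (u v : box (c i)),
    act T (dfwith x (z *: u + v)) =
    z *: act T (dfwith x u) + act T (dfwith x v);
  act_isotopic : forall (I : finType) (c : I -> color) (c0 : color)
    (T T' : tangle c c0) (x : forall i, box (c i)),
    isotopic T T' -> act T x = act T' x;
  act_relabel : forall (I J : finType) (f : J -> I) (c : I -> color)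
    (c0 : color) (T : tangle c c0) (T' : tangle (fun j => c (f j)) c0)
    (x : forall i, box (c i)),
    bijective f -> map_word f (val T') = val T ->
    act T' (fun j => x (f j)) = act T x;
  act_id : forall (n : nat) (s : bool) (x : unit -> box (n, s)),
    act (id_tangle n s) x = x tt;
  act_subst : forall (I : finType) (c : I -> color) (c0 : color)
    (J : I -> finType) (d : forall i, J i -> color)
    (T : tangle c c0) (T' : forall i, tangle (d i) (c i))
    (x : forall p : {i : I & J i}, box (d (tag p) (tagged p))),
    act (subst_tangle T T') x =
    act T (fun i => act (T' i) (fun j => x (Tagged J j)));
  star_antilinear : forall (c : color) (z : R[i]) (u v : box c),
    star (z *: u + v) = z^* *: star u + star v;
  starK : forall (c : color) (u : box c), star (star u) = u;
  act_mirror : forall (I : finType) (c : I -> color) (c0 : color)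
    (T : tangle c c0) (x : forall i, box (c i)),
    act (mirror_tangle T) (fun i => star (x i)) = star (act T x)
}.

Section Operations.
Variables (R : realType) (P : planar_star_algebra R).

Definition empty_diagram (s : bool) : box P (0, s) :=
  act (empty_tangle s) (fun i : void => match i with end).

Definition add_right_string n s (x : box P (n, s)) : box P (n.+1, s) :=
  act (right_string_tangle n s) (fun=> x).

Definition right_closure n s (x : box P (n, s)) : box P (0, s) :=
  act (right_closure_tangle n s) (fun=> x).

Definition left_closure s (x : box P (1, s)) : box P (0, ~~ s) :=
  act (left_closure_tangle s) (fun=> x).

Definition rotate_pi n s (en : ~~ odd n) (x : box P (n, s)) : box P (n, s) :=
  act (rotation_tangle s en) (fun=> x).

Definition compose m k n a b r s (ha : a.*2 = (m + k)%N)
    (hb : b.*2 = (k + n)%N) (hr : r.*2 = (m + n)%N) (x : box P (a, s)) (y : box P (b, s)) : box P (r, s) :=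
  act (comp_tangle s ha hb hr)
    (fun i => if i as i return box P (comp_colors a b s i) then x else y).

Definition mul n s (x y : box P (n, s)) : box P (n, s) :=
  compose (esym (addnn n)) (esym (addnn n)) (esym (addnn n)) x y.

(* The coefficient of the empty diagram; meaningful when dim P_(0,s) = 1. *)
Definition empty_coef s (x : box P (0, s)) : R[i] :=
  coord [tuple empty_diagram s] ord0 x.

Definition trace n s (x : box P (n, s)) : R[i] := empty_coef (right_closure x).

Definition left_trace s (x : box P (1, s)) : R[i] :=
  empty_coef (left_closure x).

(* Invariance of closed diagrams under isotopy on the sphere reduces to       *)
(* passing one string over the point at infinity, i.e., to 1-boxes.           *)
Record is_subfactor_planar_algebra : Prop := IsSubfactorPlanarAlgebra {
  dim_box0 : forall s, dim (box P (0, s)) = 1%N;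
  spherical : forall s (x : box P (1, s)), left_trace x = trace x;
  trace_positive : forall n s (x : box P (n, s)),
    x != 0 -> 0 < trace (mul (star x) x)
}.

Definition is_projection n s (p : box P (n, s)) : Prop :=
  mul p p = p /\ star p = p.

Definition is_minimal_projection n s (p : box P (n, s)) : Prop :=
  [/\ is_projection p, p != 0
    & forall q : box P (n, s), is_projection q -> mul p q = q ->
        q = 0 \/ q = p].

Definition equivalent n m s (p : box P (n, s)) (q : box P (m, s)) : Prop :=
  exists (a : nat) (h : a.*2 = (m + n)%N) (h' : a.*2 = (n + m)%N)
    (v : box P (a, s)),
    compose h h' (esym (addnn m)) v (star v) = q /\
    compose h' h (esym (addnn n)) (star v) v = p.

(* dim { q x (p (x) 1) | x a morphism from n+1 strings to m strings } *)
Definition edge_multiplicity n m s (p : box P (n, s)) (q : box P (m, s)) : nat :=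
  let a := (m + n.+1)./2%N in
  match a.*2 =P (m + n.+1)%N with
  | ReflectT h =>
      let f (x : box P (a, s)) : box P (a, s) :=
        compose (esym (addnn m)) h h q
          (compose h (esym (addnn n.+1)) h x (add_right_string p)) in
      \dim <<[seq f x | x <- vbasis {:box P (a, s)}]>>%VS
  | ReflectF _ => 0%N
  end.

Record minimal_projection (s : bool) := MinimalProjection {
  level : nat;
  proj : box P (level, s);
  projP : is_minimal_projection proj
}.

End Operations.

(* gdual is the duality of the even-depth vertices; its values at odd-depth   *)
(* vertices are irrelevant.                                                   *)
Record pointed_graph := PointedGraph {
  vert : finType;
  base : vert;
  edges : vert -> vert -> nat;
  gdual : vert -> vert
}.

(* phi induces an isomorphism from the principal graph, whose vertices are    *)
(* the equivalence classes of minimal projections, to G.  The classes at even *)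
(* depth are those of the projections in even levels.                         *)
Definition has_principal_graph (R : realType) (P : planar_star_algebra R)
    (s : bool) (G : pointed_graph) : Prop :=
  exists phi : minimal_projection P s -> vert G,
    [/\ forall v, exists p, phi p = v,
        forall p q, phi p = phi q <-> equivalent (proj p) (proj q),
        forall p, phi p = base G <-> equivalent (proj p) (empty_diagram P s),
        forall p q, edges (phi p) (phi q) = edge_multiplicity (proj p) (proj q)
      & forall p q (ep : ~~ odd (level p)),
          equivalent (rotate_pi ep (proj p)) (proj q) -> phi q = gdual (phi p)].

Definition has_principal_graphs (R : realType) (P : planar_star_algebra R)
    (G G' : pointed_graph) : Prop :=
  has_principal_graph P plus G /\ has_principal_graph P minus G'.

Definition simple_edges n (es : seq (nat * nat)) (u v : 'I_n) : nat :=
  ((u : nat, v : nat) \in es) || ((v : nat, u : nat) \in es).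

(* Depths of the vertices 0, ..., 7: 0, 1, 2, 3, 3, 4, 5, 6. *)
Definition Lambda : pointed_graph := {|
  vert := 'I_8;
  base := ord0;
  edges := simple_edges [:: (0, 1); (1, 2); (2, 3); (2, 4); (3, 5); (4, 5);
                            (5, 6); (6, 7)]%N;
  gdual := id
|}.

(* Depths of the vertices 0, ..., 9: 0, 1, 2, 3, 3, 4, 4, 4, 4, 5; the        *)
(* vertices 3, 4 are a, b, then 5, 6, 7, 8 are v_1, v_2, v_3, v_4 and 9 is w. *)
Definition Lambda' : pointed_graph := {|
  vert := 'I_10;
  base := ord0;
  edges := simple_edges [:: (0, 1); (1, 2); (2, 3); (2, 4); (3, 5); (3, 6);
                            (4, 7); (4, 8); (9, 5); (9, 8)]%N;
  gdual := fun v => if v == 6 :> nat then inord 7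
                    else if v == 7 :> nat then inord 6 else v
|}.

(* Main.v *)
From HB Require Import structures.
From mathcomp Require Import all_boot all_order all_algebra.
From mathcomp Require Import falgebra boolp reals complex.
From mathcomp Require Import zify ring.
Require Import Defs.

(* Write delta^2 for the index, d = delta^2 - 1 = [3] and D = [4].  Comparing *)
(* dimensions along either graph gives delta^4 = 6 delta^2 - 4.  For each     *)
(* shading the Jones-Wenzl projection f3 is the sum of the two minimal        *)
(* projections p, q of depth 3, of equal trace, and S = p - q is uncappable,  *)
(* so the one-click rotation sends S to sigma S for the other shading, with   *)
(* |sigma| = 1 and sigma^6 = 1.  In the 4-box space let u be S with a string  *)
(* on its right, v be S of the other shading with a string on its left, and G *)
(* be the Jones-Wenzl projection minus the trace d projection proportional to *)
(* u E3 u = v E1 v.  Planar isotopy determines G u v up to u v and            *)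
(* Temperley-Lieb terms; in particular tr (G u v) = - (sigma + sigma^-1).     *)
(*   If the graph is Lambda', then G = m5 + m6 + m7 + m8 is a sum of minimal  *)
(* projections with G u = m5 + m6 - m7 - m8, and rotation by pi, which sends  *)
(* u to sigma^-3 v, exchanges m6 and m7 and fixes m5 and m8.  Hence           *)
(* tr (G u v) sigma^-3 = dim m5 - dim m6 - dim m7 + dim m8 = 2, which no      *)
(* sixth root of unity satisfies.                                             *)
(*   If both graphs are Lambda, then (G + G u) / 2 and (G - G u) / 2 are      *)
(* minimal, so G u v + v G u is a multiple of G.  This makes rotation by one  *)
(* click explicit on z = 2 u E3 u / kappa - G and w = [G u, G v] / 2; as z is *)
(* fixed by rotation by pi, sphericality yields a polynomial equation between *)
(* sigma and d which has no solution.                                         *)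

(** Up to depth 3 the two graphs look alike. Multiplicity-freeness makes a minimal projection with
    an added string the sum of one minimal projection per neighbouring vertex
    ([iota_decomposition]), so the dimensions form a positive eigenvector of the graph with
    eigenvalue delta ([class_dimensions]), and all numbers needed follow by elimination. At level 3
    this gives p, q and S = p - q ([side_exists]). A click of S is again uncappable and traceless,
    hence a multiple of S ([rl_S]). Sphericality makes the click unitary and the half turn fixes S *
    S, which leaves a sixth root of unity sigma ([sigma_exists]).

    The contradiction arises at level 4, where the same products are described twice. Isotopy slides
    S through three cup-caps ([slide_rr]), which computes G u v and its trace ([gap_uv],
    [tr_gap_uv]). The graph says how G splits into minimal projections. With Lambda', duality tells
    how the half turn permutes the four summands of G, so a trace equals 2 that isotopy computes
    from sigma ([no_Lambda_Lambda'], [sigma_sum_neq2]). With Lambda on both sides, G is the sum of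
    two minimal projections, so the commutant of G u in the corner of G is two-dimensional
    ([gap_commutant]). This forces the anticommutator of G u and G v to be a scalar ([anticomm]) and
    makes the click of z explicit ([zvec_rotation]). The fourth power of the click fixes z, and the
    resulting equation between sigma and d is refuted by [rotation_numeric].

    All isotopies are carried out on operators. A tangle acts as a composite of elementary layers
    ([act_run]), the moves become [exchange], [zigl], [zigr] and [turn], and [bx_run] unfolds a box
    given by a diagram inside a larger picture. *)

Set Implicit Arguments.
Unset Strict Implicit.
Unset Printing Implicit Defensive.

Import Order.TTheory GRing.Theory Num.Theory.
Local Open Scope ring_scope.

(** * Diagrams acting on states *)

Section Partial.
Variables (R : realType) (P : planar_star_algebra R).

Lemma act_eq0 (I : finType) (c : I -> color) c0 (T : tangle c c0)
    (x : forall i, box P (c i)) (i : I) : x i = 0 -> act T x = 0.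
Proof.
move=> xi0; have -> : x = dfwith x ((- x i + x i) : box P (c i)).
  apply: functional_extensionality_dep => j.
  by case: dfwithP => //; rewrite xi0 addr0 oppr0.
by rewrite -scaleN1r act_multilinear scaleN1r addNr.
Qed.

(** Extending the action by 0 to words that are not tangles lets words be handled without proofs of
    typing. Since the two sides of a law are often ill-typed together, several laws then hold
    unconditionally. *)
Definition pact (I : finType) (c : I -> color) c0 (w : word I)
    (x : forall i, box P (c i)) : box P c0 :=
  match @idP (is_tangle c c0 w) with
  | ReflectT h => act (mk_tangle h) x
  | ReflectF _ => 0
  end.

Lemma pactE (I : finType) (c : I -> color) c0 (w : word I)
    (h : is_tangle c c0 w) (x : forall i, box P (c i)) :
  pact c0 w x = act (mk_tangle h) x.
Proof.
rewrite /pact; case: {-}_ / idP => [h'|//].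
by rewrite (bool_irrelevance h h').
Qed.

Lemma pact0 (I : finType) (c : I -> color) c0 (w : word I)
    (x : forall i, box P (c i)) :
  ~~ is_tangle c c0 w -> pact c0 w x = 0.
Proof. by rewrite /pact; case: {-}_ / idP => [h'|//]; rewrite h'. Qed.

Lemma pact_linear (I : finType) (c : I -> color) c0 (w : word I)
    (x : forall i, box P (c i)) (i : I) :
  linear (fun u : box P (c i) => pact c0 w (dfwith x u) : box P c0).
Proof.
move=> z u v; rewrite /pact; case: {-}_ / idP => [h|_].
  by rewrite act_multilinear.
by rewrite scaler0 addr0.
Qed.

Lemma pact_eq0 (I : finType) (c : I -> color) c0 (w : word I)
    (x : forall i, box P (c i)) (i : I) : x i = 0 -> pact c0 w x = 0.
Proof.
move=> xi0; rewrite /pact; case: {-}_ / idP => [h|//].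
exact: act_eq0 xi0.
Qed.

Lemma pact_relabel (I J : finType) (f : J -> I) (c : I -> color) c0
    (w : word I) (w' : word J) (x : forall i, box P (c i)) :
  bijective f -> map_word f w' = w ->
  pact c0 w' (fun j => x (f j)) = pact c0 w x.
Proof.
move=> bf ew; have e : is_tangle (fun j => c (f j)) c0 w' = is_tangle c c0 w.
  have [g fK gK] := bf; congr andb; last first.
    rewrite -ew discs_map; apply/forallP/forallP => h i.
      rewrite -(gK i) count_map -(eqP (h (g i))); apply/eqP/eq_count => j /=.
      by rewrite (can_eq fK).
    rewrite -(eqP (h (f i))) count_map; apply/eqP/eq_count => j /=.
    by rewrite (can_eq fK).
  rewrite -ew; elim: w' {ew} 0%N => [|[l e] w' IH] k //=.
  by rewrite IH; case: e => [||i].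
have [h|h] := boolP (is_tangle c c0 w); last by rewrite !pact0 ?e.
have h' := h; rewrite -e in h'; rewrite !pactE; exact: act_relabel.
Qed.

Lemma actE (I : finType) (c : I -> color) c0 (T : tangle c c0)
    (x : forall i, box P (c i)) : act T x = pact c0 (val T) x.
Proof. by case: T => w h; rewrite (pactE h). Qed.

(** Boxes whose colours agree only propositionally are compared as pairs of a colour and a box,
    which avoids transports. *)
Lemma pact_relabel_eq (I J : finType) (f : J -> I) (c : I -> color)
    (c' : J -> color) c0 (w : word I) (w' : word J)
    (x : forall i, box P (c i)) (x' : forall j, box P (c' j)) :
  bijective f -> map_word f w' = w ->
  (forall j, existT (fun t => box P t : Type) (c' j) (x' j) =
             existT _ (c (f j)) (x (f j))) ->
  pact c0 w' x' = pact c0 w x.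
Proof.
move=> bf ew ex.
pose z j : {t : color & box P t : Type} := existT _ (c' j) (x' j).
have -> : pact c0 w' x' = pact c0 w' (fun j => projT2 (z j)) by [].
have -> : z = fun j => existT _ (c (f j)) (x (f j)).
  exact: functional_extensionality_dep.
exact: pact_relabel.
Qed.

Lemma pact_isotopic (I : finType) (c : I -> color) c0 (u v w w' : word I)
    (x : forall i, box P (c i)) :
  move c w w' -> is_tangle c c0 (u ++ w ++ v) -> is_tangle c c0 (u ++ w' ++ v) ->
  pact c0 (u ++ w ++ v) x = pact c0 (u ++ w' ++ v) x.
Proof.
move=> m h h'; rewrite !pactE; apply: act_isotopic.
exact: (@isotopic_move _ _ _ (mk_tangle h) (mk_tangle h') u v w w' m erefl erefl).
Qed.

End Partial.

Local Open Scope nat_scope.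

(** * Layers as operators on states, and words as composites of layers *)

Section Operators.
Variables (R : realType) (P : planar_star_algebra R) (s : bool).

(* A state is a family of elements, one for each number of strands; diagrams *)
(* act on states by stacking, so that composition needs no type casts.       *)
Definition state := forall n, box P (n, s).

Definition cup (l : nat) (f : state) : state := fun n =>
  pact (c := fun _ : unit => (n.-1, s)) (n, s)
    [:: (0, Disc tt); (l, Cup)] (fun=> f n.-1).

Definition cap (l : nat) (f : state) : state := fun n =>
  pact (c := fun _ : unit => (n.+1, s)) (n, s)
    [:: (0, Disc tt); (l, Cap)] (fun=> f n.+1).

Definition two_colors (m : nat) (c : color) (b : bool) : color :=
  if b then (m, s) else c.
Definition two_boxes (m : nat) (c : color) (v : box P (m, s)) (x : box P c)
    (b : bool) : box P (two_colors m c b) :=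
  match b with true => v | false => x end.

(** For [n < c.1] the truncated subtraction yields a strand count that does not fit, and the value
    is 0. *)
Definition bx (l : nat) (c : color) (x : box P c) (f : state) : state := fun n =>
  pact (n, s) [:: (0, Disc true); (l, Disc false)]
    (two_boxes (f (n - c.1)) x).

Section Run.
Variables (J : finType) (d : J -> color) (y : forall j, box P (d j)).

Definition ap (e : nat * event J) (f : state) : state :=
  match e.2 with
  | Cup => cup e.1 f | Cap => cap e.1 f | Disc j => bx e.1 (y j) f
  end.

Definition run (w : word J) (f : state) : state := foldl (fun g e => ap e g) f w.

(** Half the number of strands below an event that leaves [n.*2] strands above it; [back] reads a
    whole word in this way from top to bottom. *)
Definition bk (e : nat * event J) (n : nat) : nat :=
  match e.2 with Cup => n.-1 | Cap => n.+1 | Disc j => n - (d j).1 end.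
Definition back (w : word J) (n : nat) : nat := foldr bk n w.

Lemma run_cat w1 w2 f : run (w1 ++ w2) f = run w2 (run w1 f).
Proof. by rewrite /run foldl_cat. Qed.
Lemma run_rcons w e f : run (rcons w e) f = ap e (run w f).
Proof. by rewrite /run foldl_rcons. Qed.
Lemma back_rcons w e n : back (rcons w e) n = back w (bk e n).
Proof. by rewrite /back foldr_rcons. Qed.

End Run.

Definition sum_colors (K J : Type) (d0 : K -> color) (d : J -> color)
    (i : K + J) : color :=
  match i with inl k => d0 k | inr j => d j end.
Definition sum_boxes (K J : Type) (d0 : K -> color) (d : J -> color)
    (z : forall k, box P (d0 k)) (y : forall j, box P (d j)) (i : K + J) :
    box P (sum_colors d0 d i) :=
  match i with inl k => z k | inr j => y j end.

Definition out (J : finType) (d : J -> color) (k : nat) (w : word J) : nat :=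
  foldl (fun k e => k - ins e.2 + outs d e.2)%N k w.

Lemma typed_out (J : finType) (d : J -> color) k w k' :
  typed d s k w k' -> k' = out d k w.
Proof. by elim: w k => [|e w IH] k /=; [move/eqP | case/andP=> _ /IH]. Qed.

Lemma typed_catE (J : finType) (d : J -> color) k w1 w2 k' :
  typed d s k (w1 ++ w2) k' =
  typed d s k w1 (out d k w1) && typed d s (out d k w1) w2 k'.
Proof.
by elim: w1 k => [|e w1 IH] k /=; rewrite ?eqxx // IH andbA.
Qed.

Lemma typed_rcons (J : finType) (d : J -> color) k w e n :
  typed d s k (rcons w e) n.*2 =
  typed d s k w (bk d e n).*2 && typed d s (bk d e n).*2 [:: e] n.*2.
Proof.
rewrite -cats1 typed_catE; apply/andP/andP => [[tw te]|[tw te]].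
  suff -> : (bk d e n).*2 = out d k w by [].
  move: te => /= /andP[+ /eqP]; rewrite /fits /bk.
  by case: e.2 => [||j] /= /andP[]; lia.
by have <- := typed_out tw.
Qed.

Lemma count_rcons_disc (J : finType) (w : word J) e j :
  count_mem j (discs (rcons w e)) =
  (count_mem j (discs w) + (if e.2 is Disc i then i == j else false))%N.
Proof.
rewrite -cats1 discs_cat count_cat /=; case: e.2 => [||i] //=.
by rewrite addn0.
Qed.

Lemma run_map (J K : finType) (g : K -> J) (d : J -> color)
    (y : forall j, box P (d j)) (w : word K) f :
  run y (map_word g w) f = run (fun k => y (g k)) w f.
Proof. by elim: w f => [|[l [||i]] w IH] f //=; rewrite IH. Qed.

Lemma back_map (J K : finType) (g : K -> J) (d : J -> color) (w : word K) n :
  back d (map_word g w) n = back (fun k => d (g k)) w n.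
Proof. by elim: w n => [|[l [||i]] w IH] n //=; rewrite IH. Qed.

Lemma map_word_comp (I J K : Type) (g : J -> K) (h : I -> J) (w : word I) :
  map_word g (map_word h w) = map_word (fun i => g (h i)) w.
Proof. by elim: w => [|[l [||i]] w IH] //=; rewrite IH. Qed.

Lemma map_word_cat (I J : Type) (g : I -> J) (w1 w2 : word I) :
  map_word g (w1 ++ w2) = map_word g w1 ++ map_word g w2.
Proof. exact: map_cat. Qed.

Lemma map_word_rcons (I J : Type) (g : I -> J) (w : word I) e :
  map_word g (rcons w e) =
  rcons (map_word g w)
    (e.1, match e.2 with Cup => Cup | Cap => Cap | Disc i => Disc (g i) end).
Proof. by rewrite /map_word map_rcons. Qed.

Lemma shift_word0 (I : Type) (w : word I) : shift_word 0 w = w.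
Proof. by elim: w => [|[l e] w IH] //=; rewrite -[RHS]/((0 + l, e) :: w) -{2}IH. Qed.

(** After the topmost disc has been removed, the rest of the word is regarded as a word in the other
    discs only, so that each disc still occurs exactly once. The induction in [run_pact] depends on
    this. *)
Lemma subword_lift (J : finType) (A : pred J) (w : word J) :
  all A (discs w) -> exists w' : word {j | A j}, map_word val w' = w.
Proof.
elim: w => [|[l [||i]] w IH] /=; first by exists [::].
- by move=> /IH[w' <-]; exists ((l, Cup) :: w').
- by move=> /IH[w' <-]; exists ((l, Cap) :: w').
- by move=> /andP[Ai /IH[w' <-]]; exists ((l, Disc (exist _ i Ai)) :: w').
Qed.

Definition cupcap (b : bool) (I : Type) : event I := if b then Cup else Cap.

(** This is [act_subst] for the outer diagram with one cup or cap. If the inner word or the outer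
    event is ill-typed, both sides are 0. *)
Lemma pact_subst1 (K : finType) (d : K -> color) (y : forall k, box P (d k))
    (w : word K) b (l n : nat) :
  let m := if b then n.-1 else n.+1 in
  pact (c := fun _ : unit => (m, s)) (n, s)
    [:: (0, Disc tt); (l, cupcap b unit)] (fun=> pact (m, s) w y) =
  pact (n, s) (rcons w (l, cupcap b K)) y.
Proof.
move=> m; set U := [:: _; _]; set w' := rcons _ _.
have mE : m = bk d (l, cupcap b K) n by rewrite /m; case: b {m U w'}.
have e : is_tangle d (n, s) w' =
    is_tangle d (m, s) w && is_tangle (fun _ : unit => (m, s)) (n, s) U.
  have -> : is_tangle (fun _ : unit => (m, s)) (n, s) U =
      typed d s m.*2 [:: (l, cupcap b K)] n.*2.
    rewrite /is_tangle; have -> : [forall i, count_mem i (discs U) == 1%N].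
      by apply/forallP => -[]; rewrite /U; case: (b).
    by rewrite andbT /= /fits /= addbF eqxx add0n; case: (b).
  rewrite /is_tangle typed_rcons -mE [LHS]andbAC; congr (_ && _ && _).
  by apply: eq_forallb => i; rewrite count_rcons_disc; case: (b); rewrite addn0.
have [/andP[h1 h2]|] := boolP (is_tangle d (m, s) w &&
  is_tangle (fun _ : unit => (m, s)) (n, s) U).
  rewrite (pactE h1) (pactE h2); have h : is_tangle d (n, s) w' by rewrite e h1.
  rewrite (pactE h).
  have := @act_subst _ P unit (fun=> (m, s)) (n, s) (fun=> K) (fun=> d)
    (mk_tangle h2) (fun=> mk_tangle h1) (fun p => y (tagged p)).
  move=> <- /=; symmetry.
  pose f (k : K) : {i : unit & K} := existT _ tt k.
  apply: (@act_relabel _ P _ _ f _ _ _ (mk_tangle h) (fun p => y (tagged p))).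
    by exists (fun p : {i : unit & K} => tagged p) => // -[[] k].
  rewrite /= /subst_word /= shift_word0 map_word_rcons -cats1 /=.
  by case: (b).
rewrite negb_and => /orP[h|h]; last first.
  by rewrite pact0 // pact0 // e negb_and h orbT.
rewrite [RHS]pact0; last by rewrite e negb_and h.
by apply: (@pact_eq0 _ _ _ _ _ _ _ tt); rewrite pact0.
Qed.

(** The box [x] is substituted as an identity tangle, which [act_id] removes again; its disc becomes
    the new index [None]. *)
Lemma pact_subst2 (K : finType) (d : K -> color) (y : forall k, box P (d k))
    (w : word K) (c : color) (x : box P c) (l n : nat) :
  let m := n - c.1 in
  pact (n, s) [:: (0, Disc true); (l, Disc false)]
    (two_boxes (pact (m, s) w y) x) =
  pact (c := fun o => if o is Some k then d k else c) (n, s)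
    (rcons (map_word Some w) (l, Disc None))
    (fun o => match o with Some k => y k | None => x end).
Proof.
case: c x => a t x m; set U := [:: _; _]; set w' := rcons _ _.
set d' := (fun o : option K => _).
have e : is_tangle d' (n, s) w' =
    is_tangle d (m, s) w && is_tangle (two_colors m (a, t)) (n, s) U.
  have -> : is_tangle (two_colors m (a, t)) (n, s) U =
      typed d' s m.*2 [:: (l, Disc None)] n.*2.
    rewrite /is_tangle; have -> : [forall i, count_mem i (discs U) == 1%N].
      by apply/forallP => -[].
    by rewrite andbT /= /fits /= addbF eqxx add0n.
  rewrite /is_tangle typed_rcons [LHS]andbAC; congr (_ && _ && _).
    by elim: (w) 0 => [|[k [||i]] v IH] q //=; rewrite IH.
  apply/forallP/forallP => h i.
    have := h (Some i); rewrite count_rcons_disc addn0 discs_map count_map.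
    by congr (_ == _); apply: eq_count => j.
  rewrite count_rcons_disc discs_map count_map; case: i => [i|] /=.
    by rewrite addn0; have := h i; congr (_ == _); apply: eq_count => j.
  by rewrite (eq_count (a2 := pred0)) ?count_pred0.
have [/andP[h1 h2]|] := boolP (is_tangle d (m, s) w &&
  is_tangle (two_colors m (a, t)) (n, s) U); last first.
  rewrite negb_and => /orP[h|h]; last first.
    by rewrite pact0 // pact0 // e negb_and h orbT.
  rewrite [RHS]pact0; last by rewrite e negb_and h.
  by apply: (@pact_eq0 _ _ _ _ _ _ _ true); rewrite /= pact0.
rewrite (pactE h1) (pactE h2); have h : is_tangle d' (n, s) w' by rewrite e h1.
rewrite (pactE h).
pose J (b : bool) : finType := if b then K else unit.
pose dJ (b : bool) : J b -> color :=
  match b with true => d | false => fun=> (a, t) end.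
pose T' (b : bool) : tangle (dJ b) (two_colors m (a, t) b) :=
  match b with true => mk_tangle h1 | false => id_tangle a t end.
pose x' (p : {b : bool & J b}) : box P (dJ (tag p) (tagged p)) :=
  match p with existT true k => y k | existT false _ => x end.
have := @act_subst _ P bool _ (n, s) J dJ (mk_tangle h2) T' x'.
have -> : (fun i => act (T' i) (fun j => x' (Tagged J j))) =
    two_boxes (act (mk_tangle h1) y) x.
  apply: functional_extensionality_dep => -[] //=.
  exact: (act_id (fun=> x)).
move=> <- /=; symmetry.
pose f (o : option K) : {b : bool & J b} :=
  if o is Some k then existT J true k else existT J false tt.
pose g (p : {b : bool & J b}) : option K :=
  match p with existT true k => Some k | existT false _ => None end.
have fK : cancel f g by case.
have gK : cancel g f by case=> -[] //= -[].
rewrite -(pactE h) actE.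
apply: (@pact_relabel_eq _ _ _ _ f); first by exists g.
  rewrite -[RHS]/(shift_word 0 (map_word (fun k => existT J true k) w) ++
    [:: (l + 0, Disc (existT J false tt))]).
  by rewrite /w' map_word_rcons map_word_comp shift_word0 cats1 addn0.
by case.
Qed.

Lemma discs_subword (J : finType) (A : pred J) (w : word {j | A j}) j :
  count_mem j (discs w) = count_mem (val j) (discs (map_word val w)).
Proof.
by rewrite discs_map count_map; apply: eq_count => k /=; rewrite (inj_eq val_inj).
Qed.

(** Induction on the number of events, taking off the topmost one: each layer is one substitution,
    so a run is the action of a single word. The boxes [z] depend on the number of strands because a
    state has a value at each of them. *)
Lemma run_pact (K : finType) (u : word K) (d0 : nat -> K -> color)
    (z : forall k i, box P (d0 k i)) (J : finType) (d : J -> color)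
    (y : forall j, box P (d j)) (w : word J) n :
  (forall j, count_mem j (discs w) = 1) ->
  run y w (fun k => pact (k, s) u (z k)) n =
  pact (n, s) (map_word inl u ++ map_word inr w)
    (sum_boxes (z (back d w n)) y).
Proof.
move: {2}(size w) (erefl (size w)) => m; elim: m J d y w n => [|m IH] J d y w n.
  case: w => // _ h /=; rewrite cats0.
  have f0 (j : J) : False by have := h j.
  apply: (@pact_relabel_eq _ _ _ _ inl) => //.
  pose g (i : K + J) : K := match i with inl k => k | inr j => False_rect K (f0 j) end.
  by exists g => [k|[k|j]] //; case: (f0 j).
case/lastP: w => [|w [l e]] //; rewrite size_rcons => -[sw] h.
rewrite run_rcons back_rcons map_word_rcons -rcons_cat.
case: e h => [||j0] h.
- rewrite /ap /= /cup IH //; last first.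
    by move=> j; have := h j; rewrite count_rcons_disc addn0.
  exact: (@pact_subst1 _ _ _ _ true).
- rewrite /ap /= /cap IH //; last first.
    by move=> j; have := h j; rewrite count_rcons_disc addn0.
  exact: (@pact_subst1 _ _ _ _ false).
have h0 j : count_mem j (discs w) = (j != j0).
  by have := h j; rewrite count_rcons_disc /= eq_sym; case: eqP => //=; lia.
have [|w1 ew] := @subword_lift _ (fun j => j != j0) w.
  apply/allP => j; rewrite -has_pred1 has_count h0.
  by case: (j != j0).
rewrite /ap /= /bx -ew run_map back_map IH; last first.
- by move=> [j hj]; rewrite discs_subword ew h0 hj.
- by rewrite -sw -ew size_map.
rewrite pact_subst2.
pose g (o : option (K + {j | j != j0})) : K + J :=
  match o with
  | None => inr j0 | Some (inl k) => inl k | Some (inr j) => inr (val j)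
  end.
apply: (@pact_relabel_eq _ _ _ _ g).
- pose g' (o : K + J) : option (K + {j | j != j0}) :=
    match o with inl k => Some (inl k) | inr j => omap inr (insub j) end.
  exists g'; first by move=> [[k|j]|] //=; rewrite /g' /= ?valK // insubF ?eqxx.
  by move=> [k|j] //=; case: insubP => [u' _ <-|/negPn/eqP->].
- by rewrite map_word_rcons /= map_word_comp map_word_cat !map_word_comp.
- by move=> [[k|j]|].
Qed.

Definition vac : state := fun n =>
  pact (c := fun i : void => match i with end) (n, s) [::]
    (fun i => match i with end).

Lemma pact_run (J : finType) (d : J -> color) (y : forall j, box P (d j))
    (w : word J) n :
  (forall j, count_mem j (discs w) = 1) -> pact (n, s) w y = run y w vac n.
Proof.
move=> h.
rewrite /vac (@run_pact void [::] (fun _ i => match i with end)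
  (fun _ i => match i with end)) //=.
apply: (@pact_relabel_eq _ _ _ _ inr) => //.
pose g (i : void + J) : J := match i with inl k => match k with end | inr j => j end.
by exists g => [k|[[]|j]].
Qed.

Lemma act_run (J : finType) (d : J -> color) n (T : tangle d (n, s))
    (y : forall j, box P (d j)) : act T y = run y (val T) vac n.
Proof.
rewrite actE pact_run // => j.
by have /andP[_ /forallP/(_ j)/eqP] := valP T.
Qed.

(* In a word acting on an arbitrary state, the state becomes the disc inl tt. *)
Lemma run_state (J : finType) (d : J -> color) (y : forall j, box P (d j))
    (w : word J) (f : state) n :
  (forall j, count_mem j (discs w) = 1) ->
  run y w f n =
  pact (n, s) ((0, Disc (inl tt)) :: map_word inr w)
    (sum_boxes (fun _ : unit => f (back d w n)) y).
Proof.
move=> h.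
have e : f = fun k => pact (c := fun _ : unit => (k, s)) (k, s)
    [:: (0, Disc tt)] (fun=> f k).
  apply: functional_extensionality_dep => k.
  by rewrite -[LHS](act_id (fun=> f k)) actE.
rewrite {1}e.
exact: (@run_pact unit [:: (0, Disc tt)] (fun k _ => (k, s)) (fun k _ => f k)).
Qed.

Lemma typed_state (K J : finType) (i : K) k (d : J -> color) (w : word J) k' :
  typed (sum_colors (fun _ : K => (k, s)) d) s 0
    ((0, Disc (inl i)) :: map_word inr w) k' = typed d s k.*2 w k'.
Proof.
rewrite /= /fits /= addbF eqxx /= subn0 add0n.
by elim: w (k.*2) => [|[l e] w IH] m //=; rewrite IH; case: e => [||j].
Qed.

Lemma typed_back (J : finType) (d : J -> color) k w n :
  typed d s k w n.*2 -> k = (back d w n).*2.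
Proof.
elim/last_ind: w n => [|w e IH] n /=; first by move/eqP.
by rewrite back_rcons typed_rcons => /andP[/IH].
Qed.

(** By [run_state] the state is one more disc at the bottom of both words, untouched by the move.
    The move is required for every [k] because the colour of that disc varies. *)
Lemma run_isotopic (J : finType) (d : J -> color) (y : forall j, box P (d j))
    (w w' : word J) (f : state) k n :
  (forall j, count_mem j (discs w) = 1) ->
  (forall j, count_mem j (discs w') = 1) ->
  (forall k, move (sum_colors (fun _ : unit => (k, s)) d)
     (map_word inr w) (map_word inr w')) ->
  typed d s k w n.*2 -> typed d s k w' n.*2 ->
  run y w f n = run y w' f n.
Proof.
move=> h h' m t t'; rewrite !run_state //.
have e : back d w n = back d w' n by move: (typed_back t) (typed_back t'); lia.
rewrite -e; set c := sum_boxes _ _.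
have H (v : word J) : (forall j, count_mem j (discs v) = 1) ->
    typed d s k v n.*2 -> is_tangle (sum_colors (fun _ : unit => (back d w n, s)) d)
      (n, s) ((0, Disc (inl tt)) :: map_word inr v).
  move=> hv tv; rewrite /is_tangle typed_state -(typed_back t) tv /=.
  apply/forallP => -[[]|j] /=; rewrite discs_map count_map.
    by rewrite (eq_count (a2 := pred0)) ?count_pred0.
  by rewrite add0n -(hv j); apply/eqP; apply: eq_count => i.
have := @pact_isotopic _ P _ _ (n, s) [:: (0, Disc (inl tt))] [::] _ _ c (m _).
by rewrite !cats0 /=; apply; apply: H.
Qed.

Lemma run0 (J : finType) (d : J -> color) (y : forall j, box P (d j))
    (w : word J) (f : state) n :
  (forall j, count_mem j (discs w) = 1) ->
  ~~ typed d s (back d w n).*2 w n.*2 -> run y w f n = 0%R.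
Proof.
move=> h t; rewrite run_state // pact0 //; apply: contra t => /andP[+ _].
by rewrite typed_state.
Qed.

Variant layer := LCup | LCap | LBox (c : color) of box P c.

Definition lay (e : layer) (l : nat) (f : state) : state :=
  match e with LCup => cup l f | LCap => cap l f | LBox c x => bx l x f end.
Definition lin (e : layer) : nat := if e is LCap then 2 else 0.
Definition lout (e : layer) : nat :=
  match e with LCup => 2 | LCap => 0 | @LBox c _ => c.1.*2 end.

Definition lay_index (e : layer) : finType := if e is LBox _ _ then unit else void.
Definition lay_event (e : layer) : event (lay_index e) :=
  match e with LCup => Cup | LCap => Cap | LBox c x => Disc tt end.
Definition lay_color (e : layer) : lay_index e -> color :=
  match e with
  | LCup | LCap => fun i => match i with end
  | @LBox c _ => fun=> c
  end.
Definition lay_box (e : layer) : forall i : lay_index e, box P (lay_color i) :=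
  match e with
  | LCup | LCap => fun i => match i with end
  | @LBox c x => fun=> x
  end.

(** No typing hypothesis is needed: the two words are well-typed for the same numbers of strands,
    and elsewhere both sides are 0. *)
Lemma exchange (e e' : layer) (l d : nat) (f : state) :
  lay e' (l + lout e + d) (lay e l f) = lay e l (lay e' (l + lin e + d) f).
Proof.
pose c := sum_colors (@lay_color e) (@lay_color e').
pose y : forall i, box P (c i) := sum_boxes (@lay_box e) (@lay_box e').
pose E : event (lay_index e + lay_index e') :=
  match lay_event e with Cup => Cup | Cap => Cap | Disc i => Disc (inl i) end.
pose E' : event (lay_index e + lay_index e') :=
  match lay_event e' with Cup => Cup | Cap => Cap | Disc i => Disc (inr i) end.
pose w := [:: (l, E); (l + lout e + d, E')].
pose w' := [:: (l + lin e + d, E'); (l, E)].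
have -> : lay e' (l + lout e + d) (lay e l f) = run y w f.
  rewrite /w /run /= /ap /= /E /E' /y /c.
  by case: (e) => [||c0 x0]; case: (e').
have -> : lay e l (lay e' (l + lin e + d) f) = run y w' f.
  rewrite /w' /run /= /ap /= /E /E' /y /c.
  by case: (e) => [||c0 x0]; case: (e').
have oE : outs c E = lout e by rewrite /c /E; case: (e).
have iE : ins E = lin e by rewrite /E; case: (e).
have hw j : count_mem j (discs w) = 1.
  rewrite /w /E /E'; case: j; case: (e) => [||? ?]; case: (e') => [||? ?] //=; by case.
have hw' j : count_mem j (discs w') = 1.
  rewrite /w' /E /E'; case: j; case: (e) => [||? ?]; case: (e') => [||? ?] //=; by case.
(* Every layer changes the number of strands by an even number, so the shading condition on a disc
   is not affected by the exchange. *)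
have t k n : typed c s k w n.*2 = typed c s k w' n.*2.
  rewrite /= /fits /= oE iE.
  have oE' : ~~ odd (outs c E').
    by rewrite /c /E'; case: (e') => [||c1 x1] //=; rewrite odd_double.
  have li : ~~ odd (lin e) by case: (e).
  have lo : ~~ odd (lout e) by case: (e) => [||c1 x1] //=; rewrite odd_double.
  rewrite !oddD (negPf li) (negPf lo) !addbF.
  set A := (match E with Disc i => _ | _ => _ end).
  set B := (match E' with Disc i => _ | _ => _ end).
  have : ins E' <= 2 by case: (E').
  by case: A; case: B; lia.
apply: functional_extensionality_dep => n.
have m k : move (sum_colors (fun _ : unit => (k, s)) c)
    (map_word inr w) (map_word inr w').
  set c' := sum_colors _ _.
  pose M (g : event (lay_index e + lay_index e')) : event (unit + (lay_index e + lay_index e')) :=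
    match g with Cup => Cup | Cap => Cap | Disc i => Disc (inr i) end.
  have := @move_exchange _ c' l d (M E) (M E').
  have -> : outs c' (M E) = outs c E by rewrite /M; case: (E).
  have -> : ins (M E) = ins E by rewrite /M; case: (E).
  by rewrite oE iE.
have [h|h] := boolP (typed c s (back c w n).*2 w n.*2).
  by apply: (run_isotopic _ _ hw hw' m h); rewrite -t.
have [h'|h'] := boolP (typed c s (back c w' n).*2 w' n.*2).
  by apply: (run_isotopic _ _ hw hw' m _ h'); rewrite t.
by rewrite !run0.
Qed.

Lemma zigzagl l (f : state) n : l < n.*2 -> cap l.+1 (cup l f) n = f n.
Proof.
move=> h; pose c (i : void) : color := match i with end.
pose y (i : void) : box P (c i) := match i with end.
have := @run_isotopic void c y [:: (l, Cup); (l.+1, Cap)] [::] f n.*2 n.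
apply => //=; try by case.
- by move=> k; exact: move_zigzagl.
- by rewrite /fits /=; lia.
Qed.

Lemma zigzagr l (f : state) n : l < n.*2 -> cap l (cup l.+1 f) n = f n.
Proof.
move=> h; pose c (i : void) : color := match i with end.
pose y (i : void) : box P (c i) := match i with end.
have := @run_isotopic void c y [:: (l.+1, Cup); (l, Cap)] [::] f n.*2 n.
apply => //=; try by case.
- by move=> k; exact: move_zigzagr.
- by rewrite /fits /=; lia.
Qed.

(** The nested minima are created from the outermost to the innermost; [ncap] removes strands from
    the innermost maximum outwards. *)
Fixpoint ncup (l m : nat) (f : state) : state :=
  if m is m'.+1 then ncup l.+1 m' (cup l f) else f.
Fixpoint ncap (l m : nat) (f : state) : state :=
  if m is m'.+1 then ncap l.-1 m' (cap l.-1 f) else f.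

Lemma run_cups (J : finType) (d : J -> color) (y : forall j, box P (d j)) l m f :
  run y (cups J l m) f = ncup l m f.
Proof.
elim: m l f => [|m IH] l f //=; rewrite -IH /cups /= /ap /= addn0; congr run.
rewrite -[1]addn0 iotaDl -map_comp; apply: eq_map => j /=.
by congr (_, _); lia.
Qed.

Lemma run_caps (J : finType) (d : J -> color) (y : forall j, box P (d j)) l m f :
  run y (caps J l m) f = ncap l m f.
Proof.
elim: m l f => [|m IH] l f //=; rewrite -IH /caps /= /ap /= subn1; congr run.
rewrite -[1]addn0 iotaDl -map_comp; apply: eq_map => j /=.
by congr (_, _); lia.
Qed.

(** The move by 2 pi, for operators. The trace property [pairingC] and the involutivity [rotpiK] of
    the half turn come from it. *)
Lemma turn a t l (x : box P (a, t)) (f : state) n :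
  a <= n -> l <= (n - a).*2 -> t = s (+) odd l ->
  bx l x f n =
  ncap (l + a.*2) a.*2 (bx (l + a.*2) x (ncup l a.*2 f)) n.
Proof.
move=> an ln et.
pose w' := cups unit l a.*2 ++ (l + a.*2, Disc tt) :: caps unit (l + a.*2) a.*2.
have -> : ncap (l + a.*2) a.*2 (bx (l + a.*2) x (ncup l a.*2 f)) =
    run (fun _ : unit => x) w' f.
  by rewrite run_cat run_cups /= run_caps.
have := @run_isotopic unit (fun=> (a, t)) (fun=> x) [:: (l, Disc tt)] w' f
  (n - a).*2 n.
apply => //=.
- by case; rewrite discs_cat /= discs_cups discs_caps.
- move=> k; rewrite /w' map_word_cat /=.
  have := @move_turn (unit + unit)%type (sum_colors (fun _ : unit => (k, s)) (fun _ : unit => (a, t)))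
    l (inr tt).
  have e1 (I K : finType) (g : I -> K) p q : map_word g (cups I p q) = cups K p q.
    by rewrite /cups /map_word -map_comp; apply: eq_map.
  have e2 (I K : finType) (g : I -> K) p q : map_word g (caps I p q) = caps K p q.
    by rewrite /caps /map_word -map_comp; apply: eq_map.
  by rewrite e1 e2.
- by rewrite /fits /= et eqxx; lia.
rewrite /w'; have := typed_cups (fun _ : unit => (a, t)) s l ((n - a).*2 - l) a.*2.
rewrite subnKC // => h; apply: typed_cat h _ => /=.
rewrite /fits /= oddD odd_double addbF et eqxx andbT; apply/andP; split; first lia.
have := typed_caps (fun _ : unit => (a, t)) s l (a.*2 + ((n - a).*2 - l)) a.*2.
rewrite et; congr typed; lia.
Qed.

End Operators.

(** * Calculus of states: degrees, linearity and the isotopy rules *)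

Section Calculus.
Variables (R : realType) (P : planar_star_algebra R).

Section OneShading.
Variable s : bool.
Implicit Types (f g : state P s) (k l m n p q a b : nat) (c : color).

(* f lives on k.*2 strands. *)
Definition dg k f := forall n, n != k -> f n = 0%R.

Definition lincomb (z : R[i]) f g : state P s := fun n => (z *: f n + g n)%R.

Lemma state_ext f g : (forall n, f n = g n) -> f = g.
Proof. exact: functional_extensionality_dep. Qed.

Lemma pact_lincomb (I : finType) (d : I -> color) c w
    (x x1 x2 : forall i, box P (d i)) (i : I) (z : R[i]) :
  x i = (z *: x1 i + x2 i)%R ->
  (forall j, j != i -> x1 j = x j) -> (forall j, j != i -> x2 j = x j) ->
  pact c w x = (z *: pact c w x1 + pact c w x2)%R.
Proof.
move=> e h1 h2; have := @pact_linear _ P I d c w x i z (x1 i) (x2 i).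
rewrite -e; congr (_ = _ *: _ + _)%R; congr pact;
  apply: functional_extensionality_dep => j;
  by case: dfwithP => [|k ki] //; rewrite eq_sym in ki; rewrite ?h1 ?h2.
Qed.

Lemma cup_lincomb l z f g : cup l (lincomb z f g) = lincomb z (cup l f) (cup l g).
Proof. by apply: state_ext => n; apply: (@pact_lincomb _ _ _ _ _ _ _ tt) => // -[]. Qed.

Lemma cap_lincomb l z f g : cap l (lincomb z f g) = lincomb z (cap l f) (cap l g).
Proof. by apply: state_ext => n; apply: (@pact_lincomb _ _ _ _ _ _ _ tt) => // -[]. Qed.

Lemma bx_lincomb l c (x : box P c) z f g :
  bx l x (lincomb z f g) = lincomb z (bx l x f) (bx l x g).
Proof. by apply: state_ext => n; apply: (@pact_lincomb _ _ _ _ _ _ _ true) => // -[]. Qed.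

Lemma bx_linear l c z (x y : box P c) f :
  bx l (z *: x + y)%R f = lincomb z (bx l x f) (bx l y f).
Proof. by apply: state_ext => n; apply: (@pact_lincomb _ _ _ _ _ _ _ false) => // -[]. Qed.

Lemma ncap_lincomb l m z f g :
  ncap l m (lincomb z f g) = lincomb z (ncap l m f) (ncap l m g).
Proof. by elim: m l f g => //= m IH l f g; rewrite cap_lincomb IH. Qed.

Lemma dg_run (J : finType) (d : J -> color) (y : forall j, box P (d j))
    (w : word J) f k m :
  (forall j, count_mem j (discs w) = 1) -> typed d s k.*2 w m.*2 -> dg k f ->
  dg m (run y w f).
Proof.
move=> h t df n nm.
have [t'|t'] := boolP (typed d s (back d w n).*2 w n.*2); last exact: run0.
rewrite run_state //; apply: (@pact_eq0 _ _ _ _ _ _ _ (inl tt)) => /=.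
apply: df; apply: contra nm => /eqP e; move: (typed_out t') (typed_out t).
by rewrite e => <- /double_inj ->.
Qed.

Lemma dg_cup k l f : dg k f -> dg k.+1 (cup l f).
Proof.
move=> df n nk; case: n nk => [|n] nk.
  rewrite /cup pact0 //; apply/negP => /andP[/= + _].
  by case/and3P => _ _; lia.
by apply: (@pact_eq0 _ _ _ _ _ _ _ tt); apply: df; rewrite -eqSS.
Qed.

Lemma dg_cap k l f : dg k f -> dg k.-1 (cap l f).
Proof.
move=> df n nk; apply: (@pact_eq0 _ _ _ _ _ _ _ tt); apply: df.
by apply: contra nk => /eqP <-.
Qed.

Lemma dg_bx k l c (x : box P c) f : dg k f -> dg (c.1 + k) (bx l x f).
Proof.
move=> df n nk; have [le|lt] := leqP c.1 n.
  by apply: (@pact_eq0 _ _ _ _ _ _ _ true); apply: df; lia.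
rewrite /bx pact0 //; apply/negP => /andP[/= + _].
by case/and3P => _ _; lia.
Qed.

Lemma dg_vac : dg 0 (@vac _ P s).
Proof.
move=> n n0; rewrite /vac pact0 //; apply/negP => /andP[/= + _].
by rewrite eq_sym double_eq0 (negPf n0).
Qed.

Lemma dg_eq k f g : dg k f -> dg k g -> f k = g k -> f = g.
Proof.
move=> df dg' e; apply: state_ext => n; case: (eqVneq n k) => [->//|nk].
by rewrite df // dg'.
Qed.

Lemma dg_ncup k l m f : dg k f -> dg (m + k) (ncup l m f).
Proof.
elim: m k l f => //= m IH k l f /(dg_cup l)/(IH _ l.+1).
by rewrite addnS.
Qed.

Lemma dg_ncap k l m f : dg k f -> dg (k - m) (ncap l m f).
Proof.
elim: m k l f => [|m IH] k l f; first by rewrite subn0.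
by move=> /(dg_cap l.-1)/(IH _ l.-1); rewrite -subn1 -subnDA.
Qed.

Lemma zigl k l f : dg k f -> l < k.*2 -> cap l.+1 (cup l f) = f.
Proof.
move=> df lk; apply: (@dg_eq k) => //; last exact: zigzagl.
exact: (dg_cap l.+1 (dg_cup l df)).
Qed.

Lemma zigr k l f : dg k f -> l < k.*2 -> cap l (cup l.+1 f) = f.
Proof.
move=> df lk; apply: (@dg_eq k) => //; last exact: zigzagr.
exact: (dg_cap l (dg_cup l.+1 df)).
Qed.

Lemma cup_cup l p f : l <= p -> cup p.+2 (cup l f) = cup l (cup p f).
Proof.
move=> lp; have := exchange (LCup P) (LCup P) l (p - l) f.
by rewrite /= addn0 subnKC // (_ : l + 2 + (p - l) = p.+2) //; lia. 
Qed.

Lemma cap_cup l p f : l <= p -> cap p.+2 (cup l f) = cup l (cap p f).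
Proof.
move=> lp; have := exchange (LCup P) (LCap P) l (p - l) f.
by rewrite /= addn0 subnKC // (_ : l + 2 + (p - l) = p.+2) //; lia.
Qed.

Lemma cup_cap l p f : l <= p -> cup p (cap l f) = cap l (cup p.+2 f).
Proof.
move=> lp; have := exchange (LCap P) (LCup P) l (p - l) f.
by rewrite /= addn0 subnKC // (_ : l + 2 + (p - l) = p.+2) //; lia.
Qed.

Lemma cap_cap l p f : l <= p -> cap p (cap l f) = cap l (cap p.+2 f).
Proof.
move=> lp; have := exchange (LCap P) (LCap P) l (p - l) f.
by rewrite /= addn0 subnKC // (_ : l + 2 + (p - l) = p.+2) //; lia.
Qed.

Lemma bx_cap l p c (x : box P c) f : l <= p -> bx p x (cap l f) = cap l (bx p.+2 x f).
Proof.
move=> lp; have := exchange (LCap P) (LBox x) l (p - l) f.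
by rewrite /= addn0 subnKC // (_ : l + 2 + (p - l) = p.+2) //; lia.
Qed.

Lemma cup_bx l p c (x : box P c) f :
  l <= p -> cup (p + c.1.*2) (bx l x f) = bx l x (cup p f).
Proof.
move=> lp; have := exchange (LBox x) (LCup P) l (p - l) f.
by rewrite /= addn0 addnAC subnKC.
Qed.

Lemma cap_bx l p c (x : box P c) f :
  l <= p -> cap (p + c.1.*2) (bx l x f) = bx l x (cap p f).
Proof.
move=> lp; have := exchange (LBox x) (LCap P) l (p - l) f.
by rewrite /= addn0 addnAC subnKC.
Qed.

Lemma bx_bx l p c (x : box P c) c' (x' : box P c') f :
  l <= p -> bx (p + c.1.*2) x' (bx l x f) = bx l x (bx p x' f).
Proof.
move=> lp; have := exchange (LBox x) (LBox x') l (p - l) f.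
by rewrite /= addn0 addnAC subnKC.
Qed.

(** A layer to the right of nested maxima is pulled below them, where the [m.*2] strands that they
    absorb are still present and shift its position. *)
Lemma lay_ncap (e : layer P) l m p f :
  l <= p + m -> m <= l -> lay e p (ncap l m f) = ncap l m (lay e (p + m.*2) f).
Proof.
elim: m l f => [|m IH] l f /=; first by rewrite addn0.
move=> h1 h2; rewrite IH; try lia.
congr ncap; have := exchange (LCap P) e l.-1 (p + m.*2 - l.-1) f.
rewrite /= addn0 (_ : l.-1 + (p + m.*2 - l.-1) = p + m.*2); last lia.
by rewrite (_ : l.-1 + 2 + (p + m.*2 - l.-1) = p + m.+1.*2); last lia.
Qed.

Lemma ncap_lay (e : layer P) l m p f :
  p + lin e + m <= l -> ncap (l - lin e + lout e) m (lay e p f) =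
  lay e p (ncap l m f).
Proof.
elim: m l f => [|m IH] l f //= h.
have -> : (l - lin e + lout e).-1 = l.-1 - lin e + lout e by lia.
have -> : cap (l.-1 - lin e + lout e) (lay e p f) = lay e p (cap l.-1 f).
  have := exchange e (LCap P) p (l.-1 - p - lin e) f; rewrite /=.
  rewrite (_ : p + lout e + _ = l.-1 - lin e + lout e); last lia.
  by rewrite (_ : p + lin e + _ = l.-1); last lia.
by rewrite IH //; lia.
Qed.

Lemma lay_ncup (e : layer P) l m p f :
  l <= p -> lay e (p + m.*2) (ncup l m f) = ncup l m (lay e p f).
Proof.
elim: m l p f => [|m IH] l p f h /=; first by rewrite addn0.
have := exchange (LCup P) e l (p - l) f; rewrite /= addn0 subnKC // => e1.
rewrite doubleS; have -> : p + m.*2.+2 = p.+2 + m.*2 by lia.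
rewrite IH; last lia.
by congr ncup; rewrite -e1; congr lay; lia.
Qed.

Lemma ncup_lay (e : layer P) l m p f :
  p + lin e <= l -> ncup (l - lin e + lout e) m (lay e p f) =
  lay e p (ncup l m f).
Proof.
elim: m l f => [|m IH] l f //= h.
have -> : cup (l - lin e + lout e) (lay e p f) = lay e p (cup l f).
  have := exchange e (LCup P) p (l - p - lin e) f; rewrite /=.
  rewrite (_ : p + lout e + _ = l - lin e + lout e); last lia.
  by rewrite (_ : p + lin e + _ = l); last lia.
have -> : (l - lin e + lout e).+1 = l.+1 - lin e + lout e by lia.
by rewrite IH //; lia.
Qed.

Lemma ncupS l m f : ncup l m.+1 f = cup (l + m) (ncup l m f).
Proof.
elim: m l f => [|m IH] l f; first by rewrite addn0.
by rewrite [LHS]/= -[ncup _ _ _]/(ncup l.+1 m.+1 _) IH /= addSnnS.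
Qed.

Lemma nzigl k l m f : dg k f -> l + m <= k.*2 ->
  ncap (l + m.*2) m (ncup l m f) = f.
Proof.
elim: m l => [|m IH] l df h //=.
have -> : (l + m.+1.*2).-1 = l.+1 + m.*2 by lia.
have -> : cap (l.+1 + m.*2) (ncup l.+1 m (cup l f)) = ncup l.+1 m f.
  have := lay_ncup (LCap P) m (cup l f) (leqnn l.+1) => /= ->.
  by rewrite (zigl df) //; lia.
by rewrite IH //; lia.
Qed.

Lemma nzigr k l m f : dg k f -> m <= l -> l <= k.*2 ->
  ncap l m (ncup l m f) = f.
Proof.
elim: m l => [|m IH] l df h1 h2 //=.
have -> : cap l.-1 (ncup l.+1 m (cup l f)) = ncup l.-1 m f.
  have := @ncup_lay (LCap P) l.+1 m l.-1 (cup l f); rewrite /= => <-; last lia.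
  have -> : l.+1 - 2 + 0 = l.-1 by lia.
  congr ncup; case: l h1 h2 => // l h1 h2; rewrite /= (zigr df) //; lia.
by rewrite IH //; lia.
Qed.

End OneShading.

Lemma map_word_id (J : Type) (w : word J) : map_word id w = w.
Proof. by elim: w => [|[l [||j]] w IH] //=; rewrite IH. Qed.

(** A box that is the value of a diagram may be replaced by this diagram, shifted into place. It is
    a substitution with the identity tangle in the disc of the state, and it unfolds products,
    traces and rotations in arbitrary positions. *)
Lemma bx_run (s t : bool) (J : finType) (d : J -> color)
    (y : forall j, box P (d j)) (w : word J) (a k l : nat) (f : state P s) :
  t = s (+) odd l -> l <= k.*2 -> dg k f ->
  (forall j, count_mem j (discs w) = 1) -> typed d t 0 w a.*2 ->
  bx l (run y w (vac P t) a) f = run y (shift_word l w) f.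
Proof.
move=> et lk df h tw.
have h' j : count_mem j (discs (shift_word l w)) = 1 by rewrite discs_shift.
have tw' : typed d s k.*2 (shift_word l w) (a + k).*2.
  have := @typed_shift _ _ d d id s t 0 w a.*2 l (k.*2 - l) (fun=> erefl) et tw.
  by rewrite map_word_id; congr typed; lia.
apply: (@dg_eq _ (a + k)); [exact: (@dg_bx _ _ _ (a, t))|exact: dg_run tw' df|].
rewrite /bx -(@pact_run _ _ t _ _ y w a h) run_state // -(double_inj (typed_back tw')) /= addKn.
have hw : is_tangle d (a, t) w.
  by rewrite /is_tangle tw; apply/forallP => j; apply/eqP.
pose c2 := two_colors s k (a, t).
have hU : is_tangle c2 (a + k, s) [:: (0, Disc true); (l, Disc false)].
  apply/andP; split; last by apply/forallP => -[].
  by rewrite /= /fits /= addbF et !eqxx !andbT; lia.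
pose K (b : bool) : finType :=
  match b return finType with true => unit | false => J end.
pose dK (b : bool) : K b -> color :=
  match b with true => fun=> (k, s) | false => d end.
pose T' (b : bool) : tangle (@dK b) (c2 b) :=
  match b with true => id_tangle k s | false => mk_tangle hw end.
pose x' (p : {b : bool & K b}) : box P (dK (tag p) (tagged p)) :=
  match p with existT true _ => f k | existT false j => y j end.
have e := @act_subst _ P bool _ (a + k, s) K dK (mk_tangle hU) T' x'.
have e' : (fun i => act (T' i) (fun j => x' (Tagged K j))) =
    two_boxes (f k) (pact (a, t) w y).
  apply: functional_extensionality_dep => -[] /=.
    exact: (act_id (fun=> f k)).
  by rewrite (pactE hw).
rewrite e' [RHS]actE /= in e.
rewrite -e actE; apply/esym.
pose g (p : unit + J) : {b : bool & K b} :=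
  match p with inl _ => existT K true tt | inr j => existT K false j end.
apply: (@pact_relabel_eq _ _ _ _ g).
- exists (fun p : {b : bool & K b} => match p return (unit + J)%type with
    existT true _ => inl tt | existT false j => inr j end).
    by case=> [[]|].
  by case=> -[] // [].
- rewrite -[RHS]/((0, Disc (existT K true tt)) ::
    shift_word l (map_word (fun j => existT K false j) w) ++ [::]).
  rewrite cats0 /= map_word_comp; congr cons.
  by rewrite /map_word /shift_word -!map_comp.
- by case=> [[]|].
Qed.

End Calculus.

(** * Composition and trace *)

Section Boxes.
Variables (R : realType) (P : planar_star_algebra R).
Implicit Types (s t : bool) (k l m n p q a b : nat).

Lemma ncapS s l m (f : state P s) : ncap l m.+1 f = cap (l - m.+1) (ncap l m f).
Proof.
elim: m l f => [|m IH] l f; first by rewrite subn1.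
by rewrite [LHS]/= -[ncap _ m _]/(ncap l.-1 m.+1 _) IH /=; congr cap; lia.
Qed.

Lemma ncap_add s l m k (f : state P s) :
  ncap (l - k) m (ncap l k f) = ncap l (k + m) f.
Proof.
elim: k l f => [|k IH] l f; first by rewrite subn0.
by rewrite addSn /= -IH; congr ncap; lia.
Qed.

Lemma ncup_add s l m k (f : state P s) :
  ncup (l + k) m (ncup l k f) = ncup l (k + m) f.
Proof.
elim: k l f => [|k IH] l f; first by rewrite addn0.
by rewrite addSn /= -IH addSnnS.
Qed.

Lemma ncap_ncap s l m q n (f : state P s) :
  l + n <= q + m -> m <= l ->
  ncap q n (ncap l m f) = ncap l m (ncap (q + m.*2) n f).
Proof.
elim: n q f => [|n IH] q f //= h1 h2.
have := @lay_ncap _ P s (LCap P) l m q.-1 f; rewrite /= => ->; [|lia|lia].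
rewrite IH; [|lia|lia].
have [q0|q0] := posnP q; last by do 2!congr ncap; [lia|congr cap; lia].
have m0 : m = 0 by lia.
by rewrite m0 /= !addn0 q0.
Qed.

Lemma bx_ncap s l m p c (x : box P c) (f : state P s) :
  l <= p + m -> m <= l -> bx p x (ncap l m f) = ncap l m (bx (p + m.*2) x f).
Proof. exact: (lay_ncap (LBox x)). Qed.

Lemma ncap_bx s l m p c (x : box P c) (f : state P s) :
  p + m <= l -> ncap (l + c.1.*2) m (bx p x f) = bx p x (ncap l m f).
Proof.
by have := @ncap_lay _ P s (LBox x) l m p f; rewrite /= subn0 addn0.
Qed.

Lemma bx_ncup s l m p c (x : box P c) (f : state P s) :
  l <= p -> bx (p + m.*2) x (ncup l m f) = ncup l m (bx p x f).
Proof. exact: (lay_ncup (LBox x)). Qed.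

Lemma run_shift_caps s (J : finType) (d : J -> color) (y : forall j, box P (d j))
    l q m (f : state P s) :
  m <= q -> run y (shift_word l (caps J q m)) f = ncap (l + q) m f.
Proof.
move=> mq; rewrite -(run_caps y); congr run.
rewrite /caps /shift_word -map_comp; apply/eq_in_map => j.
by rewrite mem_iota add0n /= => jm; congr (_, _); lia.
Qed.

Lemma run_shift_cups s (J : finType) (d : J -> color) (y : forall j, box P (d j))
    l q m (f : state P s) :
  run y (shift_word l (cups J q m)) f = ncup (l + q) m f.
Proof.
rewrite -(run_cups y); congr run.
by rewrite /cups /shift_word -map_comp; apply: eq_map => j /=; rewrite addnA.
Qed.

Lemma shift_word_cat (J : Type) l (w1 w2 : word J) :
  shift_word l (w1 ++ w2) = shift_word l w1 ++ shift_word l w2.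
Proof. exact: map_cat. Qed.

Lemma bx_vac n s (x : box P (n, s)) : bx 0 x (vac P s) n = x.
Proof.
have := act_run (id_tangle n s) (fun _ : unit => x).
by rewrite (act_id (fun=> x)).
Qed.

Lemma box_inj n s (x y : box P (n, s)) :
  bx 0 x (vac P s) = bx 0 y (vac P s) -> x = y.
Proof. by move=> e; rewrite -(bx_vac x) e bx_vac. Qed.

Lemma dg_bx_vac n s (x : box P (n, s)) : dg n (bx 0 x (vac P s)).
Proof. by have := dg_bx 0 x (@dg_vac _ P s); rewrite addn0. Qed.

Section Compose.
Variables (m k n a b r : nat) (s : bool).
Hypotheses (ha : a.*2 = m + k) (hb : b.*2 = k + n) (hr : r.*2 = m + n).

Lemma bx_compose t K l (x : box P (a, s)) (y : box P (b, s)) (f : state P t) :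
  s = t (+) odd l -> dg K f -> l <= K.*2 ->
  bx l (compose ha hb hr x y) f =
  ncap (l + a.*2) k (bx (l + a.*2) y (bx l x f)).
Proof.
move=> es df lK; rewrite /compose act_run (bx_run _ es lK df); last 2 first.
- by case; rewrite /= discs_caps.
- by have /andP[] := @comp_wordP m k n a b r s ha hb hr.
rewrite /comp_word /= /ap /= addn0 -/(shift_word l (caps bool a.*2 k)).
by rewrite run_shift_caps //; lia.
Qed.

End Compose.

(* x as a morphism from the k strands at position l to a.*2 - k strands. *)
Definition mor t l k a s (x : box P (a, s)) (f : state P t) : state P t :=
  ncap (l + a.*2) k (bx l x f).

Lemma dg_mor t l k a s (x : box P (a, s)) (f : state P t) K :
  dg K f -> dg (a + K - k) (mor l k x f).
Proof. by move=> df; apply: dg_ncap; apply: (@dg_bx _ _ _ _ _ (a, s)). Qed.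

(** Functoriality of the action on states; associativity is this statement applied to the vacuum. *)
Lemma mor_compose m k n a b r s (ha : a.*2 = m + k) (hb : b.*2 = k + n)
    (hr : r.*2 = m + n) t l K (x : box P (a, s)) (y : box P (b, s))
    (f : state P t) :
  s = t (+) odd l -> dg K f -> l <= K.*2 ->
  mor l n (compose ha hb hr x y) f = mor l k x (mor l n y f).
Proof.
move=> es df lK; rewrite /mor (bx_compose _ _ _ _ _ es df lK).
rewrite -(@ncap_bx _ (l + b.*2) n l (a, s)) /=; last lia.
rewrite -(@bx_bx _ _ _ l l (a, s)) //=.
rewrite ncap_ncap; [|lia|lia].
by congr ncap; congr ncap; lia.
Qed.

Lemma bx_compose_vac m k n a b r s (ha : a.*2 = m + k) (hb : b.*2 = k + n)
    (hr : r.*2 = m + n) (x : box P (a, s)) (y : box P (b, s)) :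
  bx 0 (compose ha hb hr x y) (vac P s) = mor 0 k x (bx 0 y (vac P s)).
Proof.
rewrite (bx_compose ha hb hr _ _ _ (@dg_vac _ P s)) ?addbF //.
by rewrite /mor -(@bx_bx _ _ _ 0 0 (a, s)).
Qed.

Lemma compose_assoc m k l n a b c ab bc r s (ha : a.*2 = m + k)
    (hb : b.*2 = k + l) (hc : c.*2 = l + n) (hab : ab.*2 = m + l)
    (hbc : bc.*2 = k + n) (hr : r.*2 = m + n)
    (x : box P (a, s)) (y : box P (b, s)) (z : box P (c, s)) :
  compose hab hc hr (compose ha hb hab x y) z =
  compose ha hbc hr x (compose hb hc hbc y z).
Proof.
apply: box_inj; rewrite !bx_compose_vac.
by rewrite (mor_compose ha hb hab _ _ _ (dg_bx_vac z)) ?addbF.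
Qed.

Definition ev0 s (f : state P s) : R[i] := empty_coef (f 0).

(** All points of the two boxes are joined in nested fashion. The value does not depend on how the
    points are divided into top and bottom, so the traces of all compositions of [x] and [y] reduce
    to it. *)
Definition pairing a b s (x : box P (a, s)) (y : box P (b, s)) : R[i] :=
  ev0 (ncap a.*2 a.*2 (bx a.*2 y (bx 0 x (vac P s)))).

Lemma traceE n s (x : box P (n, s)) :
  trace x = ev0 (ncap n n (bx 0 x (vac P s))).
Proof. by rewrite /trace /right_closure act_run /= run_caps. Qed.

Lemma trace_compose m k a b s (ha : a.*2 = m + k) (hb : b.*2 = k + m)
    (hr : m.*2 = m + m) (x : box P (a, s)) (y : box P (b, s)) :
  trace (compose ha hb hr x y) = pairing x y.
Proof.
rewrite traceE bx_compose_vac /mor add0n.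
rewrite -(@bx_bx _ _ _ 0 0 (a, s)) //= add0n.
have e := @ncap_add s a.*2 m k (bx a.*2 y (bx 0 x (vac P s))).
have e1 : a.*2 - k = m by lia.
have e2 : k + m = a.*2 by lia.
by rewrite e1 e2 in e; rewrite e.
Qed.

(** A turn of [x] by 2 pi carries it to the other side of [y]; the strings left behind then
    straighten. *)
Lemma pairingC a b s (x : box P (a, s)) (y : box P (b, s)) :
  a = b -> pairing x y = pairing y x.
Proof.
move=> e; subst b; rewrite /pairing.
have {1}-> : bx 0 x (vac P s) =
    ncap a.*2 a.*2 (bx a.*2 x (ncup 0 a.*2 (vac P s))).
  apply: (@dg_eq _ _ _ a); first exact: dg_bx_vac.
    have /(dg_bx a.*2 x) := dg_ncup 0 (m := a.*2) (@dg_vac _ P s).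
    by move=> /(dg_ncap a.*2 (m := a.*2)) /=; congr dg; lia.
  by rewrite (turn (s := s)) ?addbF.
rewrite bx_ncap; [|lia|lia]; rewrite ncap_ncap; [|lia|lia].
have -> : a.*2 + a.*2.*2 = (a.*2 + a.*2) + (a, s).1.*2 by rewrite /=; lia.
rewrite bx_bx; last lia.
have -> : a.*2 + a.*2 + (a, s).1.*2 = a.*2.*2 + (a, s).1.*2 by rewrite /=; lia.
rewrite ncap_bx; last lia.
have -> : a.*2 + a.*2 = 0 + a.*2.*2 by lia.
rewrite bx_ncup // -[a.*2.*2]add0n (nzigl (k := a)); last 2 first.
- exact: dg_bx_vac.
- by rewrite add0n.
by [].
Qed.

End Boxes.

(** * Star, strings on the sides, rotations *)

Section Stars.
Variables (R : realType) (P : planar_star_algebra R).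
Implicit Types (s t : bool) (k l m n p q a b : nat).

Lemma mirror_caps (I : finType) (c : I -> color) k l m :
  m <= l -> l + m <= k -> mirror c k (caps I l m) = caps I (k - l) m.
Proof.
rewrite /caps => h1 h2.
suff h j0 k' : j0 + m <= l -> l - j0 + m <= k' ->
    mirror c k' [seq (l - j.+1, Cap) | j <- iota j0 m] =
    [seq (k' - (l - j0) - (j - j0).+1, Cap) | j <- iota j0 m].
  by rewrite h ?subn0 //; apply: eq_map => j; rewrite subn0.
elim: m j0 k' {h1 h2} => [|m IH] j0 k' h1 h2 //=.
rewrite IH; [|lia|lia].
congr cons; first by congr (_, _); lia.
by apply/eq_in_map => j; rewrite mem_iota => hj; congr (_, _); lia.
Qed.

Lemma mirror_cups (I : finType) (c : I -> color) k l m :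
  l <= k -> mirror c k (cups I l m) = cups I (k - l) m.
Proof.
rewrite /cups => h.
suff H j0 k' : k' = k + j0.*2 ->
    mirror c k' [seq (l + j, Cup) | j <- iota j0 m] =
    [seq (k - l + j, Cup) | j <- iota j0 m].
  by apply: H; rewrite addn0.
elim: m j0 k' => [|m IH] j0 k' e //=; rewrite (IH j0.+1); last lia.
by congr cons; congr (_, _); lia.
Qed.

Lemma star_act_run (I : finType) (c : I -> color) n s (T : tangle c (n, s))
    (x : forall i, box P (c i)) :
  star (act T x) = run (fun i => star (x i)) (mirror c 0 (val T)) (vac P s) n.
Proof. by rewrite -act_mirror act_run. Qed.

(** Reflection in a vertical line exchanges the two discs and sends the nested maxima between them
    to nested maxima. *)
Lemma star_compose m k n a b r s (ha : a.*2 = m + k) (hb : b.*2 = k + n)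
    (hr : r.*2 = m + n) (ha' : a.*2 = k + m) (hb' : b.*2 = n + k)
    (hr' : r.*2 = n + m) (x : box P (a, s)) (y : box P (b, s)) :
  star (compose ha hb hr x y) = compose hb' ha' hr' (star y) (star x).
Proof.
apply: box_inj; apply: (@dg_eq _ _ _ r); [exact: dg_bx_vac|exact: dg_bx_vac|].
rewrite bx_vac bx_compose_vac /compose star_act_run /comp_tangle /=.
rewrite !subn0 !add0n subnn mirror_caps; [|lia|lia].
rewrite /run /= -/(run _ _ _) run_caps /mor add0n /ap /=.
by rewrite addKn.
Qed.

Lemma star_linear c (z : R[i]) (x y : box P c) :
  star (z *: x + y)%R = (z^* *: star x + star y)%R.
Proof. exact: star_antilinear. Qed.

Definition idn n s : box P (n, s) := ncup 0 n (vac P s) n.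
Definition jones (n i : nat) (s : bool) : box P (n, s) := cup i (cap i (ncup 0 n (vac P s))) n.
(* lam adds a string on the left; rotl and rotr rotate by one click, in       *)
(* opposite directions, and rotpi by half a turn (it is rotate_pi for even n). *)
(* The shading t of the argument is left free: it has to be ~~ s, and         *)
(* s (+) odd n for rotpi.                                                     *)
Definition lam n t s (x : box P (n, t)) : box P (n.+1, s) :=
  bx 1 x (cup 0 (vac P s)) n.+1.
Definition rotl n t s (x : box P (n, t)) : box P (n, s) :=
  cap n.*2 (bx 1 x (cup 0 (vac P s))) n.
Definition rotr n t s (x : box P (n, t)) : box P (n, s) :=
  cap 0 (bx 1 x (cup 0 (vac P s))) n.
Definition rotpi n t s (x : box P (n, t)) : box P (n, s) :=
  ncap n n (bx n x (ncup 0 n (vac P s))) n.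

Notation c0 := (fun i : void => match i with end : color).
Notation y0 := (fun i : void => match i with end : box P (c0 i)).

Lemma vacE s : vac P s 0 = empty_diagram P s.
Proof. by rewrite /empty_diagram actE. Qed.

Section Values.
Variables (s t : bool) (k l : nat) (f : state P t).
Hypotheses (es : s = t (+) odd l) (df : dg k f) (lk : l <= k.*2).

(** This lemma and its companions in the section are the instances of [bx_run] for the named
    elements. *)
Lemma bx_idn n : bx l (idn n s) f = ncup l n f.
Proof.
have := @bx_run _ P t s void c0 y0 (cups _ 0 n) n k l f es lk df.
rewrite run_cups run_shift_cups addn0; apply; first by case.
by have := typed_cups c0 s 0 0 n; rewrite !addn0 add0n.
Qed.

Lemma bx_empty : bx l (empty_diagram P s) f = f.
Proof.
rewrite -vacE.
have := @bx_run _ P t s void c0 y0 [::] 0 k l f es lk df.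
by apply => //; case.
Qed.

Lemma bx_jones n i : i.+1 < n ->
  bx l (jones n i s) f = cup (l + i) (cap (l + i) (ncup l n f)).
Proof.
move=> hi.
have := @bx_run _ P t s void c0 y0 (cups _ 0 n ++ [:: (i, Cap); (i, Cup)])
  n k l f es lk df.
rewrite shift_word_cat !run_cat run_cups run_shift_cups addn0 => -> //.
apply: typed_cat (typed_cups _ _ 0 0 _) _ => /=.
by rewrite /fits /= !andbT; lia.
Qed.

Lemma bx_iota n (x : box P (n, s)) :
  bx l (add_right_string x) f = cup (l + n) (bx l x f).
Proof.
rewrite /add_right_string act_run (bx_run _ es lk df).
- by rewrite /run /= /ap /= addn0.
- by case.
by have /andP[] := right_string_wordP n s.
Qed.

Lemma bx_lam n u (x : box P (n, u)) :
  u = ~~ s -> bx l (lam s x) f = bx l.+1 x (cup l f).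
Proof.
move=> eu; have := @bx_run _ P t s unit (fun=> (n, u)) (fun=> x)
  [:: (0, Cup); (1, Disc tt)] n.+1 k l f es lk df.
rewrite /run /= /ap /= (addn0 l) (addn1 l) => -> //.
by rewrite /fits /= eu addbT eqxx /=; lia.
Qed.

Lemma bx_rotl n u (x : box P (n, u)) :
  u = ~~ s -> bx l (rotl s x) f = cap (l + n.*2) (bx l.+1 x (cup l f)).
Proof.
move=> eu; have := @bx_run _ P t s unit (fun=> (n, u)) (fun=> x)
  [:: (0, Cup); (1, Disc tt); (n.*2, Cap)] n k l f es lk df.
rewrite /run /= /ap /= (addn0 l) (addn1 l) => -> //.
by rewrite /fits /= eu addbT eqxx /=; lia.
Qed.

Lemma bx_rotr n u (x : box P (n, u)) :
  u = ~~ s -> bx l (rotr s x) f = cap l (bx l.+1 x (cup l f)).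
Proof.
move=> eu; have := @bx_run _ P t s unit (fun=> (n, u)) (fun=> x)
  [:: (0, Cup); (1, Disc tt); (0, Cap)] n k l f es lk df.
rewrite /run /= /ap /= (addn0 l) (addn1 l) => -> //.
by rewrite /fits /= eu addbT eqxx /=; lia.
Qed.

Lemma bx_rotpi n u (x : box P (n, u)) :
  u = s (+) odd n ->
  bx l (rotpi s x) f = ncap (l + n) n (bx (l + n) x (ncup l n f)).
Proof.
move=> eu.
have := @bx_run _ P t s unit (fun=> (n, u)) (fun=> x)
  (cups _ 0 n ++ (n, Disc tt) :: caps _ n n) n k l f es lk df.
rewrite shift_word_cat !run_cat run_shift_cups addn0 /= run_cups.
rewrite -/(shift_word l (caps unit n n)) run_shift_caps // run_caps.
rewrite /ap /= => -> //; first by case; rewrite discs_cat /= discs_cups discs_caps.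
apply: typed_cat (typed_cups _ _ 0 0 _) _ => /=.
rewrite /fits /= eu eqxx andbT; apply/andP; split; first lia.
have := typed_caps (fun _ : unit => (n, s (+) odd n)) s 0 n.*2 n.
by rewrite !add0n addn0 subn0.
Qed.

End Values.

End Stars.

(** * Boxes as endomorphisms of strands *)

Section Endo.
Variables (R : realType) (P : planar_star_algebra R).
Implicit Types (s t : bool) (k l m n p q a b : nat).

Lemma dg_end t l n s (x : box P (n, s)) (f : state P t) k :
  dg k f -> dg k (mor l n x f).
Proof. by move=> /(@dg_mor _ P t l n n s x); rewrite addKn. Qed.

Lemma mul_vac n s (x y : box P (n, s)) :
  bx 0 (mul x y) (vac P s) = mor 0 n x (bx 0 y (vac P s)).
Proof. exact: bx_compose_vac. Qed.

Section Values.
Variables (s t : bool) (k l : nat) (f : state P t).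
Hypotheses (es : s = t (+) odd l) (df : dg k f).

Lemma mor_mul n (x y : box P (n, s)) :
  l <= k.*2 -> mor l n (mul x y) f = mor l n x (mor l n y f).
Proof. by move=> lk; apply: mor_compose es df lk. Qed.

Lemma mor_idn n : l + n <= k.*2 -> mor l n (idn P n s) f = f.
Proof.
move=> lk; rewrite /mor (bx_idn es df); last lia.
exact: nzigl df lk.
Qed.

Lemma mor_iota n (x : box P (n, s)) :
  l + n < k.*2 -> mor l n.+1 (add_right_string x) f = mor l n x f.
Proof.
move=> lk; rewrite /mor (bx_iota es df); last lia.
rewrite ncapS; have -> : l + n.+1.*2 = l + n.*2 - 0 + 2 by lia.
have := @ncap_lay _ P t (LCup P) (l + n.*2) n (l + n) (bx l x f) => /= ->; last lia.
have -> : l + n.*2 - 0 + 2 - n.+1 = (l + n).+1 by lia.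
by rewrite (zigl (dg_end l x df)).
Qed.

Lemma mor_lam n u (x : box P (n, u)) :
  u = ~~ s -> l < k.*2 -> mor l n.+1 (lam s x) f = mor l.+1 n x f.
Proof.
move=> eu lk; rewrite /mor (bx_lam es df) //; last lia.
rewrite /=; have -> : (l + n.+1.*2).-1 = l.+1 + (n, u).1.*2 by rewrite /=; lia.
by rewrite cap_bx // (zigl df).
Qed.

(** As an operator, the click bends the first input of [x] up on its left and its last output down
    on its right; [mor_rotr] does the opposite. *)
Lemma mor_rotl n u (x : box P (n, u)) :
  u = ~~ s -> l <= k.*2 -> mor l n (rotl s x) f = cap (l + n) (mor l.+1 n x (cup l f)).
Proof.
move=> eu lk; rewrite /mor (bx_rotl es df) //.
have -> : l + n = l.+1 + n.*2 - n.+1 by lia.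
by rewrite -ncapS.
Qed.

Lemma mor_rotr n u (x : box P (n, u)) :
  u = ~~ s -> 0 < n -> l + n <= k.*2 ->
  mor l n (rotr s x) f = cap l (mor l.+1 n x (cup (l + n) f)).
Proof.
case: n x => // n x eu _ lk; rewrite /mor (bx_rotr es df) //; last lia.
have := @ncap_lay _ P t (LCap P) (l + n.+1.*2).+2 n.+1 l (bx l.+1 x (cup l f)).
rewrite /= subn2 addn0 => -> //; last lia.
congr cap.
have -> : (l + n.+1.*2).+1 = l.+1 + (n.+1, u).1.*2 by rewrite /=; lia.
rewrite cap_bx // (zigl df); last lia.
rewrite -[RHS]/(ncap (l.+1 + n.+1.*2) n.+1 (bx l.+1 x (cup (l + n.+1) f))).
rewrite ncapS.
have -> : l + n.+1 = l.+1 + n by lia.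
rewrite -(@cup_bx _ _ _ _ _ (n.+1, u)); last lia.
have := @lay_ncap _ P t (LCup P) (l.+1 + n.+1.*2) n (l + n.+3) (bx l.+1 x f).
rewrite /=; have -> : l + n.+3 + n.*2 = l.+1 + n + n.+1.*2 by lia.
move=> <-; [|lia|lia].
have -> : l.+1 + n.+1.*2 - n.+1 = l + n.+2 by lia.
rewrite (addnS l n.+2) (@zigr _ _ _ k.+1) //; last lia.
have := dg_ncap (l.+1 + n.+1.*2) (m := n) (dg_bx l.+1 x df).
by rewrite /=; congr dg; lia.
Qed.

Lemma mor_jones n i : i.+1 < n -> l + n <= k.*2 ->
  mor l n (jones P n i s) f = cup (l + i) (cap (l + i) f).
Proof.
move=> hi lk; rewrite /mor (bx_jones es df) //; last lia.
have := @ncap_lay _ P t (LCup P) (l + n.*2 - 2) n (l + i)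
  (cap (l + i) (ncup l n f)).
rewrite /= subn0 subnK; last lia.
move=> ->; last lia.
have := @ncap_lay _ P t (LCap P) (l + n.*2) n (l + i) (ncup l n f).
rewrite /= addn0 => ->; last lia.
by rewrite (nzigl df).
Qed.

End Values.

Lemma lay_mor t (e : layer P) l n s (x : box P (n, s)) (f : state P t) p :
  l + n <= p -> lay e p (mor l n x f) = mor l n x (lay e p f).
Proof.
move=> h; rewrite /mor lay_ncap; [|lia|lia]; congr ncap.
have := exchange (LBox x) e l (p - l) f; rewrite /= addn0.
by rewrite (_ : l + n.*2 + (p - l) = p + n.*2) ?subnKC //; lia.
Qed.

Lemma mor_lay t (e : layer P) l n s (x : box P (n, s)) (f : state P t) p :
  p + lin e <= l ->
  mor (l - lin e + lout e) n x (lay e p f) = lay e p (mor l n x f).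
Proof.
move=> h; rewrite /mor.
have -> : bx (l - lin e + lout e) x (lay e p f) = lay e p (bx l x f).
  have := exchange e (LBox x) p (l - lin e - p) f; rewrite /=.
  rewrite (_ : p + lout e + _ = l - lin e + lout e); last lia.
  by rewrite (_ : p + lin e + _ = l); last lia.
rewrite -(@ncap_lay _ _ _ e (l + n.*2)); last lia.
by congr ncap; lia.
Qed.

Lemma mor_cup t l n s (x : box P (n, s)) (f : state P t) p :
  p <= l -> mor l.+2 n x (cup p f) = cup p (mor l n x f).
Proof.
by move=> h; have := @mor_lay t (LCup P) l n s x f p; rewrite /= addn0 subn0 addn2; apply.
Qed.

Lemma cup_mor t l n s (x : box P (n, s)) (f : state P t) p :
  l + n <= p -> cup p (mor l n x f) = mor l n x (cup p f).
Proof. exact: (lay_mor (LCup P)). Qed.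

Lemma cap_mor t l n s (x : box P (n, s)) (f : state P t) p :
  l + n <= p -> cap p (mor l n x f) = mor l n x (cap p f).
Proof. exact: (lay_mor (LCap P)). Qed.

Lemma ncap_mor t l n s (x : box P (n, s)) (f : state P t) q m :
  l + n + m <= q -> ncap q m (mor l n x f) = mor l n x (ncap q m f).
Proof.
by elim: m q f => [|m IH] q f //= h; rewrite cap_mor ?IH //; lia.
Qed.

Lemma mor_mor t l n s (x : box P (n, s)) p m s' (y : box P (m, s'))
    (f : state P t) :
  l + n <= p -> mor p m y (mor l n x f) = mor l n x (mor p m y f).
Proof.
move=> h; rewrite -[LHS]/(ncap (p + m.*2) m (lay (LBox y) p (mor l n x f))).
by rewrite lay_mor //= ncap_mor //; lia.
Qed.

Lemma mul1x n s (x : box P (n, s)) : mul (idn P n s) x = x.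
Proof.
apply: box_inj; rewrite mul_vac (mor_idn _ (dg_bx_vac x)) ?addbF //; lia.
Qed.

Lemma mulx1 n s (x : box P (n, s)) : mul x (idn P n s) = x.
Proof.
apply: box_inj; rewrite mul_vac (bx_idn _ (@dg_vac _ P s)) ?addbF //.
have := @ncup_lay _ P s (LBox x) 0 n 0 (vac P s) isT; rewrite /= add0n /mor => <-.
by rewrite add0n (@nzigr _ _ _ n) //; [exact: dg_bx_vac|lia].
Qed.

(** Multiplication by the identity diagram recovers a box, so a box is determined by its operator.
    Relations between boxes are then proved by moving layers. *)
Lemma mor_inj n s (x y : box P (n, s)) :
  (forall f : state P s, dg n f -> mor 0 n x f = mor 0 n y f) -> x = y.
Proof.
move=> h; rewrite -(mulx1 x) -(mulx1 y); apply: box_inj; rewrite !mul_vac.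
by apply: h; exact: dg_bx_vac.
Qed.

End Endo.

Lemma es0 s : s = s (+) odd 0.
Proof. by rewrite addbF. Qed.

(** * Relations in the box algebras: star, added strings, Temperley-Lieb, trace *)

Section Relations.
Variables (R : realType) (P : planar_star_algebra R).
Implicit Types (s t u : bool) (k l m n p q a b : nat).

Lemma star_run (I : finType) (c : I -> color) n s (w : word I)
    (y : forall i, box P (c i)) :
  is_tangle c (n, s) w ->
  star (run y w (vac P s) n) =
  run (fun i => star (y i)) (mirror c 0 w) (vac P s) n.
Proof. by move=> h; rewrite -(act_run (mk_tangle h)) star_act_run. Qed.

Lemma star_run1 n s m u (w : word unit) (x : box P (m, u)) :
  typed (fun _ : unit => (m, u)) s 0 w n.*2 -> discs w = [:: tt] ->
  star (run (fun _ : unit => x) w (vac P s) n) =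
  run (fun _ : unit => star x) (mirror (fun=> (m, u)) 0 w) (vac P s) n.
Proof. by move=> h1 h2; apply: star_run; apply: is_tangle_unit. Qed.

Lemma star_iota n s (x : box P (n, s)) :
  star (add_right_string x) = add_right_string (star x).
Proof.
rewrite /add_right_string star_act_run act_run /=.
by rewrite !subn0 add0n (_ : n.*2 - n = n) //; lia.
Qed.

Lemma star_lam n u s (x : box P (n, u)) :
  u = ~~ s -> star (lam s x) = lam s (star x).
Proof.
move=> eu.
have := @star_run1 n.+1 s n u [:: (0, Cup); (1, Disc tt)] x.
by apply => //; rewrite /= /fits /= eu addbT eqxx /=; lia.
Qed.

Lemma star_rotl n u s (x : box P (n, u)) :
  u = ~~ s -> star (rotl s x) = rotr s (star x).
Proof.
move=> eu.
have := @star_run1 n s n u [:: (0, Cup); (1, Disc tt); (n.*2, Cap)] x.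
move=> -> //; last by rewrite /= /fits /= eu addbT eqxx /=; lia.
by rewrite /run /= /ap /= /rotr (_ : 0 - 0 + 2 - 0 + n.*2 - n.*2 - 2 = 0) //; lia.
Qed.

Lemma star_rotr n u s (x : box P (n, u)) :
  u = ~~ s -> star (rotr s x) = rotl s (star x).
Proof. by move=> eu; rewrite -[x]starK -star_rotl // !starK. Qed.

Lemma star_idn n s : star (idn P n s) = idn P n s.
Proof.
pose c (i : void) : color := match i with end.
pose y (i : void) : box P (c i) := match i with end.
have h : is_tangle c (n, s) (cups _ 0 n).
  apply/andP; split; last by apply/forallP => -[].
  by have := typed_cups c s 0 0 n; rewrite !addn0 add0n.
have := star_run y h; rewrite mirror_cups // subn0 run_cups.
by rewrite run_cups.
Qed.

Lemma star_mul n s (x y : box P (n, s)) : star (mul x y) = mul (star y) (star x).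
Proof. exact: star_compose. Qed.

Lemma iota_mul n s (x y : box P (n, s)) :
  add_right_string (mul x y) = mul (add_right_string x) (add_right_string y).
Proof.
apply: mor_inj => f df; have es := es0 s.
rewrite (mor_mul es df) // (mor_iota es df); last lia.
rewrite (mor_iota es (dg_end 0 _ df)); last lia.
by rewrite (mor_iota es df) ?(mor_mul es df) //; lia.
Qed.

Lemma iota_idn n s : add_right_string (idn P n s) = idn P n.+1 s.
Proof.
apply: mor_inj => f df; have es := es0 s.
by rewrite (mor_iota es df) ?(mor_idn es df) //; lia.
Qed.

Lemma lam_mul n u s (x y : box P (n, u)) : u = ~~ s ->
  lam s (mul x y) = mul (lam s x) (lam s y).
Proof.
move=> eu; apply: mor_inj => f df; have es := es0 s.
have et : u = s (+) odd 1 by rewrite addbT.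
rewrite (mor_mul es df) // (mor_lam es df) //.
rewrite (mor_lam es (dg_end 0 _ df)) // (mor_lam es df) //.
by rewrite (mor_mul et df) //; lia.
Qed.

Lemma lam_idn n u s : u = ~~ s -> lam s (idn P n u) = idn P n.+1 s.
Proof.
move=> eu; apply: mor_inj => f df; have es := es0 s.
rewrite (mor_lam es df) // (mor_idn es df) //; last lia.
by apply: (mor_idn _ df); rewrite ?addbT //; lia.
Qed.

Lemma iota_linear n s z (x y : box P (n, s)) :
  add_right_string (z *: x + y)%R =
  (z *: add_right_string x + add_right_string y)%R.
Proof.
rewrite /add_right_string !act_run /= /run /= /ap /= bx_linear cup_lincomb.
by [].
Qed.

Lemma lam_linear n u s z (x y : box P (n, u)) :
  lam s (z *: x + y)%R = (z *: lam s x + lam s y)%R.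
Proof. by rewrite /lam bx_linear. Qed.

Lemma rotl_linear n u s z (x y : box P (n, u)) :
  rotl s (z *: x + y)%R = (z *: rotl s x + rotl s y)%R.
Proof. by rewrite /rotl bx_linear cap_lincomb. Qed.

Lemma rotr_linear n u s z (x y : box P (n, u)) :
  rotr s (z *: x + y)%R = (z *: rotr s x + rotr s y)%R.
Proof. by rewrite /rotr bx_linear cap_lincomb. Qed.

Lemma rotpi_linear n u s z (x y : box P (n, u)) :
  rotpi s (z *: x + y)%R = (z *: rotpi s x + rotpi s y)%R.
Proof. by rewrite /rotpi bx_linear ncap_lincomb. Qed.

Lemma mul_linearl n s z (x x' y : box P (n, s)) :
  mul (z *: x + x')%R y = (z *: mul x y + mul x' y)%R.
Proof.
by rewrite -[LHS]bx_vac mul_vac /mor bx_linear ncap_lincomb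
  -[mul x y]bx_vac -[mul x' y]bx_vac !mul_vac.
Qed.

Lemma mul_linearr n s z (x y y' : box P (n, s)) :
  mul x (z *: y + y')%R = (z *: mul x y + mul x y')%R.
Proof.
by rewrite -[LHS]bx_vac mul_vac bx_linear /mor bx_lincomb ncap_lincomb
  -[mul x y]bx_vac -[mul x y']bx_vac !mul_vac.
Qed.

Lemma mulA n s (x y z : box P (n, s)) : mul x (mul y z) = mul (mul x y) z.
Proof. by symmetry; apply: compose_assoc. Qed.

Lemma rotrK n u s (x : box P (n.+1, s)) :
  u = ~~ s -> rotl s (rotr u x) = x.
Proof.
move=> eu; apply: mor_inj => f df; have es := es0 s.
rewrite (mor_rotl es df) // (mor_rotr _ (dg_cup 0 df)) ?eu ?negbK ?addbT //; last lia.
rewrite add1n cup_cup // mor_cup // (zigl (dg_end 0 x (dg_cup n df))) //.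
by rewrite cap_mor // (zigl df) //; lia.
Qed.

Lemma rotlK n u s (x : box P (n.+1, s)) :
  u = ~~ s -> rotr s (rotl u x) = x.
Proof.
move=> eu; rewrite -[RHS]starK -(rotrK (star x) eu) star_rotl //.
by rewrite star_rotr ?starK // eu negbK.
Qed.

Lemma iota_jones n i s : i.+1 < n ->
  add_right_string (jones P n i s) = jones P n.+1 i s.
Proof.
move=> hi; apply: mor_inj => f df; have es := es0 s.
rewrite (mor_iota es df); last lia.
by rewrite !(mor_jones es df) //; lia.
Qed.

Lemma lam_jones n i u s : u = ~~ s -> i.+1 < n ->
  lam s (jones P n i u) = jones P n.+1 i.+1 s.
Proof.
move=> eu hi; apply: mor_inj => f df; have es := es0 s.
have et : u = s (+) odd 1 by rewrite addbT.
rewrite (mor_lam es df) // (mor_jones et df) ?(mor_jones es df) //; lia.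
Qed.

(** All cup-caps arise from the one in the 2-box space by adding strings on the right and on the
    left, operations compatible with the star. *)
Lemma star_jones n i s : i.+1 < n -> star (jones P n i s) = jones P n i s.
Proof.
elim: n i s => // n IH i s hi; have [hn|hn] := ltnP i.+1 n.
  by rewrite -iota_jones // star_iota IH.
case: i hi hn => [|i] hi hn; last first.
  by rewrite -(@lam_jones _ _ (~~ s)) // star_lam // IH.
have {IH hi hn}-> : n = 1 by lia.
pose c (i : void) : color := match i with end.
pose y (i : void) : box P (c i) := match i with end.
have e : jones P 2 0 s = cup 0 (cup 0 (vac P s)) 2.
  by rewrite /jones /= (zigr (dg_cup 0 (@dg_vac _ P s))).
have h : is_tangle c (2, s) [:: (0, Cup); (0, Cup)].
  by apply/andP; split => //; apply/forallP => -[].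
have := star_run y h; rewrite /run /= /ap /= -e => ->.
by rewrite e -[RHS]/(cup 0 (cup 0 (vac P s)) 2) -(@cup_cup _ P s 0 0 (vac P s) isT).
Qed.

Lemma mor0_jones n i s (f : state P s) : i.+1 < n -> dg n f ->
  mor 0 n (jones P n i s) f = cup i (cap i f).
Proof. by move=> hi df; rewrite (mor_jones _ df) ?addbF //; lia. Qed.

Lemma mor0_mul n s (x y : box P (n, s)) (f : state P s) : dg n f ->
  mor 0 n (mul x y) f = mor 0 n x (mor 0 n y f).
Proof. by move=> df; rewrite (mor_mul _ df) ?addbF. Qed.

Lemma dg_cupcap n i j s (f : state P s) : dg n.+1 f -> dg n.+1 (cup i (cap j f)).
Proof. by move=> /(dg_cap j)/(dg_cup i). Qed.

Lemma jones_braid n i s : i.+2 < n ->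
  mul (jones P n i s) (mul (jones P n i.+1 s) (jones P n i s)) = jones P n i s.
Proof.
case: n => // n hi; apply: mor_inj => f df; have dc := dg_cap i df.
have d1 : dg n.+1 (cup i (cap i f)) by exact: dg_cupcap.
have d2 : dg n.+1 (cup i.+1 (cap i.+1 (cup i (cap i f)))) by exact: dg_cupcap.
rewrite !mor0_mul // (mor0_jones _ df) ?(mor0_jones _ d1) ?(mor0_jones _ d2);
  [|lia..].
rewrite (zigr (dg_cap _ d1)); last by rewrite /=; lia.
by rewrite (zigl dc) //=; lia.
Qed.

Lemma jones_braid' n i s : i.+2 < n ->
  mul (jones P n i.+1 s) (mul (jones P n i s) (jones P n i.+1 s)) =
  jones P n i.+1 s.
Proof.
case: n => // n hi; apply: mor_inj => f df; have dc := dg_cap i.+1 df.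
have d1 : dg n.+1 (cup i.+1 (cap i.+1 f)) by exact: dg_cupcap.
have d2 : dg n.+1 (cup i (cap i (cup i.+1 (cap i.+1 f)))) by exact: dg_cupcap.
rewrite !mor0_mul // (mor0_jones _ df) ?(mor0_jones _ d1) ?(mor0_jones _ d2);
  [|lia..].
rewrite (zigl (dg_cap _ d1)); last by rewrite /=; lia.
by rewrite (zigr dc) //=; lia.
Qed.

Lemma jones_far n i j s : i.+1 < j -> j.+1 < n ->
  mul (jones P n i s) (jones P n j s) = mul (jones P n j s) (jones P n i s).
Proof.
case: n => // n hi hj; apply: mor_inj => f df.
have d1 : dg n.+1 (cup i (cap i f)) by exact: dg_cupcap.
have d2 : dg n.+1 (cup j (cap j f)) by exact: dg_cupcap.
rewrite !mor0_mul // !(mor0_jones _ df) ?(mor0_jones _ d1) ?(mor0_jones _ d2);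
  [|lia..].
case: j hi hj {d2} => [|[|j]] // hi hj.
by rewrite -cup_cap // -cap_cap // cap_cup // cup_cup.
Qed.

Definition scal s (z : R[i]) (f : state P s) : state P s := fun n => (z *: f n)%R.

Lemma scalE s z (f : state P s) : scal z f = lincomb z f (fun=> 0%R).
Proof. by apply: state_ext => n; rewrite /lincomb addr0. Qed.

Lemma cup_scal s l z (f : state P s) : cup l (scal z f) = scal z (cup l f).
Proof.
rewrite !scalE cup_lincomb; congr lincomb.
by apply: state_ext => n; apply: (@pact_eq0 _ _ _ _ _ _ _ tt).
Qed.

Lemma cap_scal s l z (f : state P s) : cap l (scal z f) = scal z (cap l f).
Proof.
rewrite !scalE cap_lincomb; congr lincomb.
by apply: state_ext => n; apply: (@pact_eq0 _ _ _ _ _ _ _ tt).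
Qed.

Lemma bx_scal s l c (x : box P c) z (f : state P s) :
  bx l (z *: x)%R f = scal z (bx l x f).
Proof.
have := bx_linear l z x 0%R f; rewrite addr0 => ->; rewrite scalE.
by congr lincomb; apply: state_ext => n; apply: (@pact_eq0 _ _ _ _ _ _ _ false).
Qed.

Lemma ncap_scal s l m z (f : state P s) : ncap l m (scal z f) = scal z (ncap l m f).
Proof. by elim: m l f => //= m IH l f; rewrite cap_scal IH. Qed.

Lemma mor_scal s t l k a z (x : box P (a, s)) (f : state P t) :
  mor l k (z *: x)%R f = scal z (mor l k x f).
Proof. by rewrite /mor bx_scal ncap_scal. Qed.

Section Subfactor.
Hypothesis HP : is_subfactor_planar_algebra P.

(** Inserting the empty diagram changes nothing, so if it were 0 every 0-box would be 0. *)
Lemma empty_diagram_neq0 s : empty_diagram P s != 0%R.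
Proof.
apply/negP => /eqP e0.
suff z0 (x : box P (0, s)) : x = 0%R.
  have := dim_box0 HP s; rewrite -dimvf; have -> : fullv = 0%VS :> {vspace box P (0, s)}.
    by apply/eqP; rewrite -subv0; apply/subvP => x _; rewrite (z0 x) mem0v.
  by rewrite dimv0.
rewrite -(bx_vac x).
have <- := @bx_empty _ P s s 0 0 _ (es0 s) (dg_bx_vac x) isT.
by apply: (@pact_eq0 _ _ _ _ _ _ _ false).
Qed.

Lemma box0E s (x : box P (0, s)) : x = (empty_coef x *: empty_diagram P s)%R.
Proof.
have b : basis_of fullv [tuple empty_diagram P s].
  by rewrite basisEfree /= seq1_free empty_diagram_neq0 subvf dimvf (dim_box0 HP).
have := coord_basis b (memvf x).
by rewrite big_ord1.
Qed.

Lemma empty_coef_linear s z (x y : box P (0, s)) :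
  empty_coef (z *: x + y)%R = (z * empty_coef x + empty_coef y)%R.
Proof. by rewrite /empty_coef linearP. Qed.

Lemma empty_coef_empty s : empty_coef (empty_diagram P s) = 1%R.
Proof.
have e := box0E (empty_diagram P s); apply/eqP; rewrite -subr_eq0.
have := empty_diagram_neq0 s; apply: contraNT => h.
suff : ((empty_coef (empty_diagram P s) - 1) *: empty_diagram P s = 0)%R.
  by move/eqP; rewrite scaler_eq0 (negPf h).
by rewrite scalerBl scale1r -e subrr.
Qed.

Definition loop s : R[i] := trace (idn P 1 s).

(** Sphericality for the identity 1-box: closed on the left, it is a loop in a region of the other
    shading. *)
Lemma loopC s : loop (~~ s) = loop s.
Proof.
rewrite {2}/loop -(spherical HP) /left_trace /left_closure act_run.
rewrite /loop traceE (bx_idn (es0 (~~ s)) (@dg_vac _ P (~~ s))) //=.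
rewrite /run /= /ap /= -/(idn P 1 s) /ev0 /=.
rewrite (bx_idn _ (dg_cup 0 (@dg_vac _ P (~~ s)))) ?addbT ?negbK //=.
by rewrite (zigr (dg_cup 0 (@dg_vac _ P (~~ s)))).
Qed.

Lemma loopE s : loop s = loop false.
Proof. by case: s => //; rewrite -(loopC false). Qed.

Lemma cap_cup_same s k l (f : state P s) : dg k f -> l <= k.*2 ->
  cap l (cup l f) = scal (loop false) f.
Proof.
move=> df lk; set t := s (+) odd l.
have e : cap 0 (cup 0 (vac P t)) 0 = (loop t *: empty_diagram P t)%R.
  rewrite [LHS]box0E /loop traceE /ev0.
  by rewrite (bx_idn (es0 t) (@dg_vac _ P t)).
have := @bx_run _ P s t void _ (fun i => match i with end) [:: (0, Cup); (0, Cap)]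
  0 k l f erefl lk df.
rewrite /run /= /ap /= (addn0 l) => <- //.
rewrite e bx_scal (bx_empty _ df) // loopE //.
Qed.

Lemma jones_sq n i s : i.+1 < n ->
  mul (jones P n i s) (jones P n i s) = (loop false *: jones P n i s)%R.
Proof.
case: n => // n hi; apply: mor_inj => f df.
have d1 : dg n.+1 (cup i (cap i f)) by exact: dg_cupcap.
rewrite mor_scal mor0_mul // (mor0_jones _ df) ?(mor0_jones _ d1) //.
rewrite (cap_cup_same (dg_cap i df)) ?cup_scal //=; lia.
Qed.

Lemma ev0_scal s z (f : state P s) : ev0 (scal z f) = (z * ev0 f)%R.
Proof.
by rewrite /ev0 /scal /empty_coef linearZ.
Qed.

Lemma trace_linear n s z (x y : box P (n, s)) :
  trace (z *: x + y)%R = (z * trace x + trace y)%R.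
Proof. by rewrite !traceE bx_linear ncap_lincomb /ev0 empty_coef_linear. Qed.

Lemma trace_mulC n s (x y : box P (n, s)) : trace (mul x y) = trace (mul y x).
Proof. by rewrite !trace_compose pairingC. Qed.

Lemma trace_iota n s (x : box P (n, s)) :
  trace (add_right_string x) = (loop false * trace x)%R.
Proof.
rewrite !traceE (bx_iota (es0 s) (@dg_vac _ P s)) //= add0n.
by rewrite (cap_cup_same (dg_bx_vac x)) ?ncap_scal ?ev0_scal //; lia.
Qed.

Lemma trace_idn n s : trace (idn P n s) = (loop false ^+ n)%R.
Proof.
elim: n => [|n IH]; last by rewrite -iota_idn trace_iota IH exprS.
rewrite traceE (bx_idn (es0 s) (@dg_vac _ P s)) //=.
by rewrite /ev0 vacE empty_coef_empty.
Qed.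

(** The Markov property of the trace: the last string straightens. *)
Lemma trace_jones_iota n s (x : box P (n.+1, s)) :
  trace (mul (jones P n.+2 n s) (add_right_string x)) = trace x.
Proof.
rewrite !traceE mul_vac mor0_jones //; last first.
  by rewrite (bx_iota (es0 s) (@dg_vac _ P s)) //; exact: (dg_cup _ (dg_bx_vac x)).
rewrite (bx_iota (es0 s) (@dg_vac _ P s)) //= add0n.
rewrite (zigr (dg_bx_vac x)); last lia.
by rewrite (zigl (dg_bx_vac x)); last lia.
Qed.

End Subfactor.

End Relations.

(** * The one-click rotation and the half turn *)

Section Rotations.
Variables (R : realType) (P : planar_star_algebra R).
Implicit Types (s t u : bool) (k l m n p q a b : nat).

(** [z] stands for the product of all cup-caps in increasing order. It is kept abstract because this
    product depends on [n]. *)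
Lemma rotl_iota n u s (x : box P (n.+1, u)) (z : box P (n.+2, s)) :
  u = ~~ s ->
  (forall f : state P s, dg n.+2 f -> mor 0 n.+2 z f = cup 0 (cap n f)) ->
  rotl s (add_right_string x) = mul (lam s x) z.
Proof.
move=> eu hz; apply: mor_inj => f df; have es := es0 s.
have et : u = s (+) odd 1 by rewrite addbT.
rewrite mor0_mul // (mor_rotl es df) // (mor_lam es (dg_end 0 z df)) //.
rewrite (mor_iota et (dg_cup 0 df)); last lia.
by rewrite hz // cap_mor ?cap_cup.
Qed.

(** The middle cup-cap cuts the picture in two: the click moves the extra string of [x] from its
    right to its left and is otherwise absorbed by [y]. *)
Lemma rotl_sandwich n u s (x y : box P (n.+1, u)) : u = ~~ s ->
  rotl s (mul (add_right_string x)
            (mul (jones P n.+2 n u) (add_right_string y))) =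
  mul (lam s x) (add_right_string (rotl s y)).
Proof.
move=> eu; apply: mor_inj => f df; have es := es0 s.
have et : u = s (+) odd 1 by rewrite addbT.
have dc := dg_cup 0 df; rewrite mor0_mul // (mor_rotl es df) //.
rewrite (mor_mul et dc) // (mor_mul et dc) //.
rewrite (mor_iota et dc); last lia.
have dy := dg_end 1 y dc.
rewrite (mor_jones et dy) //; last lia.
have d3 : dg n.+3 (cup (1 + n) (cap (1 + n) (mor 1 n.+1 y (cup 0 f)))).
  exact: (dg_cup _ (dg_cap _ dy)).
rewrite (mor_iota et d3); last lia.
rewrite cap_mor ?add1n // (zigl (dg_cap _ dy)) /=; last lia.
rewrite (mor_lam es (dg_end 0 _ df)) // (mor_iota es df); last lia.
by rewrite (mor_rotl es df) // add0n.
Qed.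

(** Pulling straight the string that runs around [x] turns [x] by one click. With S in place of [x]
    this is the relation [lf_slide]. *)
Lemma jones3_lam u s (x : box P (3, u)) : u = ~~ s ->
  mul (jones P 4 2 s) (mul (jones P 4 1 s) (mul (jones P 4 0 s) (lam s x))) =
  mul (jones P 4 2 s) (add_right_string (rotr s x)).
Proof.
move=> eu; apply: mor_inj => f df; have es := es0 s.
rewrite !mor0_mul // (mor_lam es df) // (mor_iota es df) //.
rewrite (mor_rotr es df) //.
have d1 := dg_end 1 x df.
have d2 : dg 4 (cup 0 (cap 0 (mor 1 3 x f))) by exact: dg_cupcap.
have d3 : dg 4 (cup 1 (cap 1 (cup 0 (cap 0 (mor 1 3 x f))))) by exact: dg_cupcap.
have d4 : dg 4 (cap 0 (mor 1 3 x (cup (0 + 3) f))).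
  exact: (dg_cap 0 (dg_end 1 x (dg_cup 3 df))).
rewrite (mor0_jones _ d1) // (mor0_jones _ d2) // (mor0_jones _ d3) //.
rewrite (mor0_jones _ d4) // (zigl (dg_cap 0 d1)) //.
rewrite (zigl (dg_cap 0 d1)) // add0n; congr cup.
by rewrite cap_cap // (@cap_mor _ _ _ 1 3 _ _ _ 4) // (zigl df).
Qed.

Lemma state_dg n s (f : state P s) : dg n f -> bx 0 (f n) (vac P s) = f.
Proof.
by move=> df; apply: (@dg_eq _ _ _ n) => //; [exact: dg_bx_vac|rewrite bx_vac].
Qed.

Section Spherical.
Hypothesis HP : is_subfactor_planar_algebra P.

(** All strings between the two boxes but one are closed, which leaves the 1-box [W]. By
    sphericality its last string may be closed on the left instead of the right, and there it undoes
    both clicks. Writing [N.*2] as [M.+1] avoids predecessors. *)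
Lemma trace_rot_aux N M u s (x y : box P (N, u)) : u = ~~ s -> N.*2 = M.+1 ->
  rotr u (rotl s x) = x ->
  trace (mul (rotl s x) (rotr s y)) = trace (mul x y).
Proof.
move=> eu eM rx; have eu' : s = ~~ u by rewrite eu negbK.
rewrite !trace_compose /pairing.
set a := rotl s x in rx *; set b := rotr s y.
pose c2 (i : bool) : color := (N, s).
pose y2 (i : bool) : box P (c2 i) := if i then a else b.
pose w := [:: (0, Disc true), (N.*2, Disc false) & caps bool N.*2 M].
pose W : box P (1, s) := run y2 w (vac P s) 1.
have hw j : count_mem j (discs w) = 1 by case: j; rewrite /= discs_caps.
have tw : typed c2 s 0 w 1.*2.
  have := typed_caps c2 s 1 1 M; rewrite /= /fits /= !addbF odd_double !addbF !eqxx /=.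
  move=> h; apply/andP; split; first lia.
  by rewrite !eM; move: h; congr typed; lia.
have eW : W = ncap N.*2 M (bx N.*2 b (bx 0 a (vac P s))) 1.
  by rewrite /W /w /run /= -/(run _ _ _) run_caps.
set F := bx N.*2 b (bx 0 a (vac P s)) in eW *.
have dF : dg 1 (ncap N.*2 M F).
  have := dg_ncap N.*2 (m := M) (dg_bx N.*2 b (dg_bx_vac a)).
  by rewrite /= (_ : N + N - M = 1) //; lia.
have -> : ev0 (ncap N.*2 N.*2 F) = trace W.
  rewrite traceE eW (state_dg dF) /= {2}eM ncapS.
  by rewrite (_ : N.*2 - M.+1 = 0) //; lia.
rewrite -(spherical HP) /left_trace /left_closure act_run.
rewrite /run [foldl _ _ _]/= /ap /=.
have dc := dg_cup 0 (@dg_vac _ P (~~ s)).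
have es : s = ~~ s (+) odd 1 by rewrite addbT negbK.
rewrite /W (bx_run y2 es _ dc hw tw) // -eu /w.
rewrite /run /= -/(run _ _ _) -/(shift_word 1 (caps bool N.*2 M)).
rewrite run_shift_caps; last lia.
rewrite /ap /=.
have e1 := @ncap_lay _ P u (LCap P) (1 + N.*2) M 0.
rewrite /= in e1; rewrite -e1; last lia.
rewrite (_ : 1 + N.*2 = M.+2); last lia.
rewrite addn0 subn2 /= -bx_cap // -(bx_rotr (es0 u) (@dg_vac _ P u)) // rx.
set h := bx 0 x _; have dh : dg N h by exact: dg_bx_vac.
have oM : odd M by have := odd_double N; rewrite eM /= => /negbFE.
rewrite (bx_rotr _ dh) ?oM ?addbT -?eu' //; last lia.
have := @lay_ncap _ P u (LCap P) M M 0; rewrite /= => ->; [|lia|lia].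
rewrite cap_cap; last lia.
rewrite (_ : (0 + M.*2).+2 = M.+1 + (N, u).1.*2); last by rewrite /=; lia.
by rewrite cap_bx // (zigl dh) ?eM //; lia.
Qed.

Lemma trace_rot n u s (x y : box P (n.+1, u)) : u = ~~ s ->
  trace (mul (rotl s x) (rotr s y)) = trace (mul x y).
Proof.
move=> eu; apply: (@trace_rot_aux _ n.*2.+1) => //.
by apply: rotlK; rewrite eu negbK.
Qed.

End Spherical.

Lemma ncup_ncap s l m p k (f : state P s) : l <= p + m -> m <= l ->
  ncup p k (ncap l m f) = ncap l m (ncup (p + m.*2) k f).
Proof.
elim: k p f => [|k IH] p f h1 h2 //=.
have := @lay_ncap _ P s (LCup P) l m p; rewrite /= => -> //.
by rewrite IH // addSn // ltnW.
Qed.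

Lemma ncup_mor t l n s (x : box P (n, s)) (f : state P t) p m :
  l + n <= p -> ncup p m (mor l n x f) = mor l n x (ncup p m f).
Proof.
by elim: m p f => [|m IH] p f //= h; rewrite cup_mor ?IH //; lia.
Qed.

Section HalfTurn.
Variables (n : nat) (t s : bool).
Hypothesis et : t = s (+) odd n.

Lemma bx_rotpi_left (x : box P (n, t)) (f : state P s) k :
  dg k f -> n <= k.*2 ->
  mor 0 n (rotpi s x) f = ncap n n (bx n x f).
Proof.
move=> df nk; rewrite /mor (bx_rotpi (es0 s) df) // !add0n.
rewrite ncap_ncap; [|lia|lia]; congr ncap.
rewrite (_ : n.*2 + n.*2 = n.*2 + (n, t).1.*2) // ncap_bx; last lia.
by rewrite -[n.*2]add0n (nzigl df).
Qed.

Lemma mor_rotpi (x : box P (n, t)) (f : state P s) k :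
  dg k f -> n <= k.*2 ->
  mor 0 n (rotpi s x) f = ncap n n (mor n n x (ncup n n f)).
Proof.
move=> df nk; rewrite (bx_rotpi_left _ df) // /mor.
rewrite -(@ncap_ncap _ _ _ n n n n); [|lia|lia].
have := @ncup_lay _ P s (LBox x) n n n f; rewrite /= subn0 addn0 => <- //.
rewrite -(@ncup_ncap _ n n n n); [|lia|lia].
by rewrite (nzigr (dg_ncap n (dg_bx n x df))) //=; lia.
Qed.

(** Sliding a box along nested maxima from their right legs to their left legs turns it by pi. *)
Lemma ncap_rotpi (x : box P (n, t)) (g : state P s) k :
  dg k g -> n.*2 <= k.*2 ->
  ncap n n (mor 0 n (rotpi s x) g) = ncap n n (mor n n x g).
Proof.
move=> dg' nk; rewrite (mor_rotpi _ dg'); last lia.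
rewrite ncap_ncap; [|lia|lia]; rewrite ncap_mor; last lia.
by rewrite (nzigl dg') //; lia.
Qed.

Lemma rotpi_mul (x y : box P (n, t)) :
  rotpi s (mul x y) = mul (rotpi s y) (rotpi s x).
Proof.
apply: mor_inj => f df; rewrite mor0_mul // (mor_rotpi _ df); last lia.
have dn : dg n.*2 (ncup n n f) by have := dg_ncup n (m := n) df; rewrite addnn.
rewrite (mor_mul et dn); last lia.
rewrite -(ncap_rotpi _ (dg_end n y dn)); last lia.
rewrite -mor_mor // -ncup_mor //.
by rewrite (mor_rotpi _ (dg_end 0 _ df)) //; lia.
Qed.

Lemma rotpi_idn : rotpi s (idn P n t) = idn P n s.
Proof.
apply: mor_inj => f df; rewrite (mor_rotpi _ df); last lia.
have dn : dg n.*2 (ncup n n f) by have := dg_ncup n (m := n) df; rewrite addnn.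
rewrite (mor_idn et dn); last lia.
by rewrite (nzigr df) ?(mor_idn (es0 s) df) //; lia.
Qed.

End HalfTurn.

Lemma rotpi_iota n t s u (x : box P (n, t)) :
  t = s (+) odd n.+1 -> u = ~~ s ->
  rotpi s (add_right_string x) = lam s (rotpi u x).
Proof.
move=> et eu; apply: box_inj; have d0 := @dg_vac _ P s.
rewrite (bx_rotpi (es0 s) d0) // (bx_lam (es0 s) d0) // !add0n.
have d1 := dg_ncup 0 (m := n.+1) d0.
rewrite (bx_iota et d1) //; last lia.
rewrite ncapS subnn.
have := @lay_ncap _ P s (LCup P) n.+1 n 1 (bx n.+1 x (ncup 0 n.+1 (vac P s))).
rewrite /= add1n (_ : 1 + n.*2 = n.+1 + n); last lia.
move=> <- //; rewrite (zigr (k := n.+1)) //; last first.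
  have := dg_ncap n.+1 (m := n) (dg_bx n.+1 x d1).
  by rewrite /= (_ : n + (n.+1 + 0) - n = n.+1) //; lia.
have et' : t = u (+) odd n by rewrite et eu /=; case: (s); case: (odd n).
have d2 := dg_cup 0 d0.
by rewrite (bx_rotpi _ d2) ?eu ?addbT // -eu.
Qed.

Lemma rotpi_lam n t s u (x : box P (n, u)) :
  t = s (+) odd n.+1 -> u = ~~ t ->
  rotpi s (lam t x) = add_right_string (rotpi s x).
Proof.
move=> et eu; apply: box_inj; have d0 := @dg_vac _ P s.
have eu' : u = s (+) odd n by rewrite eu et /=; case: (s); case: (odd n).
rewrite (bx_rotpi (es0 s) d0) // (bx_iota (es0 s) d0) // !add0n.
rewrite (bx_rotpi (es0 s) d0) // !add0n.
have d1 := dg_ncup 0 (m := n.+1) d0.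
rewrite (bx_lam et d1) //; last lia.
rewrite ncupS add0n -[ncap n.+1 n.+1 _]/(ncap n n (cap n (bx n.+2 x
  (cup n.+1 (cup n (ncup 0 n (vac P s))))))).
have d2 := dg_ncup 0 (m := n) d0.
rewrite -(@bx_cap _ _ _ n) // (zigr (dg_cup n d2)) //; last lia.
rewrite -(@cup_bx _ _ _ _ _ (n, u)) //=.
by have := @lay_ncap _ P s (LCup P) n n n; rewrite /= => <- //; lia.
Qed.

(** Two half turns make a full turn, which [turn] removes. *)
Lemma rotpiK n s (x : box P (n, s)) : ~~ odd n -> rotpi s (rotpi s x) = x.
Proof.
move=> en; apply: box_inj; have d0 := @dg_vac _ P s.
have es : s = s (+) odd n by rewrite (negPf en) addbF.
rewrite (bx_rotpi (es0 s) d0) // !add0n.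
have d1 := dg_ncup 0 (m := n) d0.
rewrite (bx_rotpi es d1) //; last lia.
rewrite -[X in ncup X n]add0n ncup_add.
have := @ncap_add _ P s (n + n) n n; rewrite addnK => ->.
apply: (@dg_eq _ _ _ n); last first.
- by rewrite (turn (s := s)) ?addbF //= !add0n addnn.
- exact: dg_bx_vac.
have := dg_ncap (n + n) (m := n + n) (dg_bx (n + n) x (dg_ncup 0 (m := n + n) d0)).
by rewrite /= (_ : n + (n + n + 0) - (n + n) = n) //; lia.
Qed.

Lemma rotpi3 s u (x : box P (3, u)) : u = ~~ s ->
  rotpi s x = rotr s (rotr u (rotr s x)).
Proof.
move=> eu; apply: box_inj; have d0 := @dg_vac _ P s.
have d1 := dg_cup 0 d0; have d2 := dg_cup 1 d1.
rewrite (bx_rotpi (es0 s) d0) ?addbT // !add0n.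
rewrite (bx_rotr (es0 s) d0) // (bx_rotr _ d1) ?addbT ?eu ?negbK //.
by rewrite (bx_rotr _ d2) ?addbF.
Qed.

Lemma rotpi4 s u (x : box P (4, s)) : u = ~~ s ->
  rotpi s x = rotr s (rotr u (rotr s (rotr u x))).
Proof.
move=> eu; apply: box_inj; have d0 := @dg_vac _ P s.
have d1 := dg_cup 0 d0; have d2 := dg_cup 1 d1; have d3 := dg_cup 2 d2.
rewrite (bx_rotpi (es0 s) d0) ?addbF // !add0n.
rewrite (bx_rotr (es0 s) d0) // (bx_rotr _ d1) ?addbT ?eu ?negbK //.
by rewrite (bx_rotr _ d2) ?addbF // (bx_rotr _ d3) ?addbT ?negbK.
Qed.

End Rotations.

Local Open Scope ring_scope.

(** * A reflexive tactic for identities between linear combinations *)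

Section LinearExpressions.
Variables (C : pzRingType) (A : lmodType C).

Inductive lexp :=
  | LAtom of nat | LAdd of lexp & lexp | LOpp of lexp | LScale of C & lexp | LZero.

Fixpoint leval (l : seq A) (e : lexp) : A :=
  match e with
  | LAtom n => nth 0 l n
  | LAdd a b => leval l a + leval l b
  | LOpp a => - leval l a
  | LScale c a => c *: leval l a
  | LZero => 0
  end.

Fixpoint lcoef (e : lexp) (i : nat) : C :=
  match e with
  | LAtom n => if n == i then 1 else 0
  | LAdd a b => lcoef a i + lcoef b i
  | LOpp a => - lcoef a i
  | LScale c a => c * lcoef a i
  | LZero => 0
  end.

Fixpoint same_coefs (e e' : lexp) (n : nat) : Prop :=
  match n with
  | 0 => True
  | n.+1 => lcoef e n = lcoef e' n /\ same_coefs e e' n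
  end.

Lemma leval_sum l e : leval l e = \sum_(i < size l) lcoef e i *: nth 0 l i.
Proof.
elim: e => [n|a IHa b IHb|a IH|c a IH|] /=.
- have [lt|le] := ltnP n (size l); last first.
    rewrite nth_default // big1 // => i _.
    by rewrite gtn_eqF ?scale0r // (leq_trans (ltn_ord i)).
  rewrite (bigD1 (Ordinal lt)) //= eqxx scale1r big1 ?addr0 // => i.
  by rewrite -val_eqE /= eq_sym => /negPf ->; rewrite scale0r.
- by rewrite IHa IHb -big_split; apply: eq_bigr => i _; rewrite scalerDl.
- by rewrite IH -sumrN; apply: eq_bigr => i _; rewrite scaleNr.
- by rewrite IH scaler_sumr; apply: eq_bigr => i _; rewrite scalerA.
- by rewrite big1 // => i _; rewrite scale0r.
Qed.

Lemma leval_eq l e e' : same_coefs e e' (size l) -> leval l e = leval l e'.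
Proof.
rewrite !leval_sum; elim: (size l) => [|n IH] /=; first by rewrite !big_ord0.
by case=> en /IH e0; rewrite !big_ord_recr /= en e0.
Qed.

End LinearExpressions.

(* Atoms are compared up to conversion, as equal products may be built with  *)
(* different instances.                                                      *)
Ltac linear_index x l :=
  lazymatch l with
  | cons ?y ?t =>
      match goal with
      | _ => let _ := match goal with _ => unify x y end in constr:(O)
      | _ => let n := linear_index x t in constr:(S n)
      end
  end.

Ltac linear_atoms e l :=
  lazymatch e with
  | (?a + ?b)%R => let l1 := linear_atoms a l in linear_atoms b l1
  | (- ?a)%R => linear_atoms a l
  | (_ *: ?a)%R => linear_atoms a l
  | 0%R => l
  | _ =>
      match goal with
      | _ => let _ := linear_index e l in l
      | _ => constr:(cons e l)
      end
  end.

Ltac linear_reify C e l :=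
  lazymatch e with
  | (?a + ?b)%R =>
      let x := linear_reify C a l in let y := linear_reify C b l in
      constr:(LAdd x y)
  | (- ?a)%R => let x := linear_reify C a l in constr:(LOpp x)
  | (?c *: ?a)%R => let x := linear_reify C a l in constr:(LScale c x)
  | 0%R => constr:(@LZero C)
  | _ => let n := linear_index e l in constr:(@LAtom C n)
  end.

(* Reduces an equation between linear combinations to the equations between *)
(* the coefficients of their atoms.                                          *)
Ltac linear_eq C A :=
  lazymatch goal with
  | |- ?a = ?b =>
      let l0 := linear_atoms a (@nil A) in
      let l := linear_atoms b l0 in
      let x := linear_reify C a l in
      let y := linear_reify C b l in
      change (@leval C A l x = @leval C A l y);
      apply: leval_eq; cbn [same_coefs lcoef size eqn eq_op]; repeat split
  end.

(** * The algebra of the 4-box space *)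

Section Semilinear.
Variables (C : numClosedFieldType) (V W : lmodType C) (theta : {rmorphism C -> C}).
Variable h : V -> W.
Hypothesis h_lin : forall z x y, h (z *: x + y) = theta z *: h x + h y.

(** These lemmas serve linear maps, with [theta] the identity, and the star, with [theta] the
    complex conjugation. *)
Lemma semilin0 : h 0 = 0.
Proof.
by have := h_lin (-1) 0 0; rewrite scaleN1r oppr0 addr0 rmorphN1 scaleN1r addNr.
Qed.
Lemma semilinD x y : h (x + y) = h x + h y.
Proof. by rewrite -{1}[x]scale1r h_lin rmorph1 scale1r. Qed.
Lemma semilinZ z x : h (z *: x) = theta z *: h x.
Proof. by have := h_lin z x 0; rewrite !addr0 semilin0 addr0. Qed.
Lemma semilinN x : h (- x) = - h x.
Proof. by rewrite -scaleN1r semilinZ rmorphN1 scaleN1r. Qed.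
Lemma semilinB x y : h (x - y) = h x - h y.
Proof. by rewrite semilinD semilinN. Qed.

End Semilinear.

Section Corner.
Variables (C : fieldType) (A : algType C) (kappa : C) (e u f : A).
Hypothesis kappa_neq0 : kappa != 0.
Hypotheses (uu : u * u = f) (fu : f * u = u) (uf : u * f = u) (ff : f * f = f).
Hypotheses (efef : e * (f * (e * f)) = kappa *: (e * f)) (eue : e * (u * e) = 0).
Let ef := kappa^-1 *: (f * (e * f)).
Let eu := kappa^-1 *: (u * (e * u)).

Lemma pull (x y z : A) : x * y = z -> forall t, x * (y * t) = z * t.
Proof. by move=> <- t; rewrite mulrA. Qed.

Lemma pull3 (x y z w : A) : x * (y * z) = w -> forall t, x * (y * (z * t)) = w * t.
Proof. by move=> <- t; rewrite !mulrA. Qed.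

Lemma corner_efef : ef * ef = ef.
Proof.
rewrite /ef -scalerAl -scalerAr -!mulrA (pull ff) efef -scalerAr !scalerA.
by rewrite mulVf ?mulr1.
Qed.

Lemma corner_eueu : eu * eu = eu.
Proof.
rewrite /eu -scalerAl -scalerAr -!mulrA (pull uu).
have -> : e * (f * (e * u)) = kappa *: (e * u).
  by have := congr1 (fun x => x * u) efef; rewrite -scalerAl -!mulrA fu.
by rewrite -scalerAr !scalerA mulVf ?mulr1.
Qed.

Lemma corner_efeu : ef * eu = 0.
Proof.
by rewrite /ef /eu -scalerAl -scalerAr -!mulrA (pull fu) (pull3 eue) mul0r !mulr0 !scaler0.
Qed.

Lemma corner_euef : eu * ef = 0.
Proof.
by rewrite /ef /eu -scalerAl -scalerAr -!mulrA (pull uf) (pull3 eue) mul0r !mulr0 !scaler0.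
Qed.

Lemma corner_uef : u * ef = eu * u.
Proof. by rewrite /ef /eu -scalerAl -scalerAr -!mulrA (pull uf) uu. Qed.

Lemma corner_efu : ef * u = u * eu.
Proof. by rewrite /ef /eu -scalerAl -scalerAr -!mulrA fu (pull uu). Qed.

Lemma corner_fef : f * ef = ef.
Proof. by rewrite /ef -scalerAr (pull ff). Qed.
Lemma corner_eff : ef * f = ef.
Proof. by rewrite /ef -scalerAl -!mulrA ff. Qed.
Lemma corner_feu : f * eu = eu.
Proof. by rewrite /eu -scalerAr (pull fu). Qed.
Lemma corner_euf : eu * f = eu.
Proof. by rewrite /eu -scalerAl -!mulrA uf. Qed.

(** Conjugation by the reflection [u] interchanges the idempotents [ef] and [eu], which are
    orthogonal because [e * (u * e) = 0]. It therefore fixes their complement in [f]. *)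
Lemma corner_comm : u * (f - ef - eu) = (f - ef - eu) * u.
Proof.
rewrite !(mulrBl, mulrBr) uf fu corner_uef corner_efu.
by rewrite addrAC.
Qed.

Lemma corner_idem : (f - ef - eu) * (f - ef - eu) = f - ef - eu.
Proof.
rewrite !(mulrBl, mulrBr) ff corner_efef corner_eueu corner_efeu corner_euef.
rewrite corner_fef corner_eff corner_feu corner_euf.
linear_eq C A; rewrite /=; ring.
Qed.

End Corner.

(** * Two reflections, one of which has a two-dimensional commutant *)

Section Reflections.
Variables (C : numClosedFieldType) (A : algType C).
Variables (st : A -> A) (tr : A -> C) (gap a b rho : A) (d sum : C).
Hypothesis st_lin : forall z x y, st (z *: x + y) = z^* *: st x + st y.
Hypothesis st_mul : forall x y, st (x * y) = st y * st x.
Hypothesis tr_lin : forall z x y, tr (z *: x + y) = z * tr x + tr y.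
Hypothesis tr_mulC : forall x y, tr (x * y) = tr (y * x).
Hypotheses (gap_gap : gap * gap = gap) (gap_a : gap * a = a) (a_gap : a * gap = a)
  (gap_b : gap * b = b) (b_gap : b * gap = b) (a_a : a * a = gap) (b_b : b * b = gap)
  (rho_rho : rho * rho = rho) (gap_rho : gap * rho = 0) (rho_gap : rho * gap = 0).
Hypotheses (st_a : st a = a) (st_b : st b = b) (st_rho : st rho = rho)
  (st_gap : st gap = gap).
Hypotheses (tr_gap : tr gap = d *+ 2) (tr_rho : tr rho = d) (tr_a : tr a = 0)
  (tr_ab : tr (a * b) = - sum).
Hypothesis comm_a : forall x, gap * x = x -> x * gap = x -> a * x = x * a ->
  exists z w, x = z *: gap + w *: a.
Hypotheses (d_neq0 : d != 0) (sum_neq0 : sum != 0) (sum_d : sum ^+ 2 != (d *+ 2) ^+ 2).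

Let c := - sum / (d *+ 2).

Let tr0 : tr 0 = 0 := semilin0 (W := C^o) (theta := idfun) tr_lin.
Let trD x y : tr (x + y) = tr x + tr y := semilinD (W := C^o) (theta := idfun) tr_lin x y.
Let trZ z x : tr (z *: x) = z * tr x := semilinZ (W := C^o) (theta := idfun) tr_lin z x.
Let trN x : tr (- x) = - tr x := semilinN (W := C^o) (theta := idfun) tr_lin x.
Let trB x y : tr (x - y) = tr x - tr y := semilinB (W := C^o) (theta := idfun) tr_lin x y.
Let st0 : st 0 = 0 := semilin0 (theta := Num.conj) st_lin.
Let stD x y : st (x + y) = st x + st y := semilinD (theta := Num.conj) st_lin x y.
Let stZ z x : st (z *: x) = z^* *: st x := semilinZ (theta := Num.conj) st_lin z x.
Let stN x : st (- x) = - st x := semilinN (theta := Num.conj) st_lin x.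

Lemma d2_neq0 : d *+ 2 != 0. Proof. by rewrite mulrn_eq0. Qed.

(** Otherwise [b] is a combination of [gap] and [a], and [b * b = gap] leaves only [gap] and [a] up
    to sign. Their traces against [a] are 0 and [d *+ 2] up to sign, and the hypotheses on [sum]
    exclude both. *)
Lemma ab_noncomm : a * b != b * a.
Proof.
apply/eqP => ab; have [|||z [w bE]] := @comm_a b; rewrite ?gap_b ?b_gap //.
have zw : tr (a * b) = w * (d *+ 2).
  rewrite bE mulrDr -!scalerAr a_gap a_a trD !trZ tr_gap tr_a.
  by rewrite mulr0 add0r.
have tb : tr b = z * (d *+ 2) by rewrite bE trD !trZ tr_gap tr_a mulr0 addr0.
have e : gap = (z ^+ 2 + w ^+ 2) *: gap + (z * w *+ 2) *: a.
  rewrite -{1}b_b bE mulrDl !(mulrDr, =^~ scalerAr, =^~ scalerAl).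
  rewrite gap_gap gap_a a_gap a_a; linear_eq C A; rewrite /=; ring.
have e1 : z ^+ 2 + w ^+ 2 = 1.
  apply: (mulIf d2_neq0); rewrite mul1r -tr_gap -trZ [in RHS]e trD trZ.
  by rewrite [tr (_ *: a)]trZ tr_a mulr0 addr0.
have e2' : z * w = 0.
  apply: (mulIf d2_neq0); rewrite mul0r; apply: (mulIf (x := 2)); first by rewrite pnatr_eq0.
  have := congr1 (fun x => tr (a * x)) e.
  rewrite mulrDr -!scalerAr a_gap a_a trD !trZ tr_gap tr_a mulr0 add0r mul0r => {1}->.
  ring.
move/eqP: e2'; rewrite mulf_eq0 => /orP[/eqP z0|/eqP w0].
- move/eqP: sum_d; apply; rewrite -sqrrN -tr_ab zw exprMn.
  by rewrite z0 expr0n add0r in e1; rewrite e1 mul1r.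
- by move/eqP: sum_neq0; apply; apply: oppr_inj; rewrite -tr_ab zw w0 mul0r oppr0.
Qed.

(** Since [a] and [b] have the same square [gap], the anticommutator commutes with both. Commuting
    with [a] makes it a combination of [gap] and [a], commuting with [b] removes the [a] term, and
    the trace gives the coefficient. *)
Lemma anticomm : a * b + b * a = (c *+ 2) *: gap.
Proof.
have [|||z [w NE]] := @comm_a (a * b + b * a).
- by rewrite mulrDr !mulrA gap_a gap_b.
- by rewrite mulrDl -!mulrA a_gap b_gap.
- rewrite mulrDr mulrDl (pull a_a) -[b * a * a]mulrA a_a gap_b b_gap.
  by rewrite addrC mulrA.
have bN : b * (a * b + b * a) = (a * b + b * a) * b.
  rewrite mulrDr mulrDl (pull b_b) -[a * b * b]mulrA b_b gap_a a_gap.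
  by rewrite addrC mulrA.
have w0 : w = 0.
  move: bN; rewrite NE mulrDr mulrDl -!scalerAr -!scalerAl gap_b b_gap => /addrI h.
  apply/eqP; apply: contraT => w_neq0; have := ab_noncomm.
  by rewrite (scalerI w_neq0 h) eqxx.
rewrite NE w0 scale0r addr0; congr (_ *: _); apply: (mulIf d2_neq0).
rewrite -tr_gap -trZ -[z *: gap]addr0 -(scale0r a) -w0 -NE trD [tr (b * a)]tr_mulC.
by rewrite tr_ab tr_gap -mulr2n /c mulrnAl divfK ?d2_neq0.
Qed.

Definition wz := 2^-1 *: (a * b - b * a).
Definition zz := 2 *: rho - gap.

Lemma baE2 : b * a = c *: gap - wz.
Proof.
apply: (scalerI (a := 2%:R : C)); first by rewrite pnatr_eq0.
rewrite scalerBr scalerA [2 * c]mulrC mulr_natr -anticomm /wz scalerA mulfV ?pnatr_eq0 //.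
linear_eq C A; rewrite /=; ring.
Qed.

Lemma st_wz : st wz = - wz.
Proof.
rewrite /wz stZ stD stN !st_mul st_a st_b fmorphV rmorph_nat.
linear_eq C A; rewrite /=; ring.
Qed.

Lemma st_zz : st zz = zz.
Proof. by rewrite /zz stD stN stZ rmorph_nat st_rho st_gap. Qed.

(** The products [a * b] and [b * a] are [c *: gap + wz] and [c *: gap - wz], and their product is
    [gap]. *)
Lemma wz_wz : wz * wz = (c ^+ 2 - 1) *: gap.
Proof.
have aE : a * b = c *: gap + wz.
  rewrite -[LHS](addrK (b * a)) anticomm baE2.
  linear_eq C A; rewrite /=; ring.
have g1 : gap * wz = wz by rewrite /wz -scalerAr mulrBr !mulrA gap_a gap_b.
have g2 : wz * gap = wz by rewrite /wz -scalerAl mulrBl -!mulrA a_gap b_gap.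
have : (c *: gap + wz) * (c *: gap - wz) = gap.
  by rewrite -aE -baE2 -mulrA (pull b_b) gap_a a_a.
move: wz g1 g2 => w g1 g2; rewrite mulrBr !mulrDl -!scalerAl -!scalerAr gap_gap g1 g2 => h.
rewrite scalerBl scale1r -{2}h; linear_eq C A; rewrite /=; ring.
Qed.

Lemma tr_wz : tr wz = 0.
Proof. by rewrite /wz trZ trB [tr (b * a)]tr_mulC subrr mulr0. Qed.

Lemma zz_wz : zz * wz = - wz.
Proof.
have g1 : gap * wz = wz by rewrite /wz -scalerAr mulrBr !mulrA gap_a gap_b.
by rewrite /zz mulrBl -scalerAl g1 -{1}g1 mulrA rho_gap mul0r scaler0 sub0r.
Qed.

Lemma tr_zz_zz : tr (zz * zz) = d *+ 6.
Proof.
rewrite /zz mulrBl !mulrBr -!scalerAl -!scalerAr rho_rho rho_gap gap_rho gap_gap.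
rewrite !scaler0 subr0 sub0r opprK scalerA trD trZ tr_rho tr_gap; ring.
Qed.

Lemma tr_rot_sq (z w : C) :
  tr ((z *: zz - w *: wz) * (z *: zz - w *: wz)) =
  (d *+ 6) * z ^+ 2 + w ^+ 2 * (c ^+ 2 - 1) * (d *+ 2).
Proof.
have h1 : tr (wz * wz) = (c ^+ 2 - 1) * (d *+ 2) by rewrite wz_wz trZ tr_gap.
have h2 : tr (zz * wz) = 0 by rewrite zz_wz trN tr_wz oppr0.
have := tr_zz_zz; move: zz wz h1 h2 => x y h1 h2 h3.
rewrite mulrBl !mulrBr -!scalerAl -!scalerAr !trB !trZ [tr (y * x)]tr_mulC h1 h2 h3.
ring.
Qed.

End Reflections.

(** [h] is the Jones-Wenzl projection on three strings in terms of the cup-caps [a] and [b]. It is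
    symmetric in them, so the lemma covers both. *)
Lemma jw_kill (C : fieldType) (A : algType C) (delta : C) (d := delta ^+ 2 - 1) (a b h : A) :
  d != 0 -> a * a = delta *: a -> a * (b * a) = a ->
  h = 1 - (delta / d) *: (a + b) + d^-1 *: (a * b + b * a) -> a * h = 0.
Proof.
move=> d_neq0 aa aba ->.
rewrite mulrDr mulrBr mulr1 -!scalerAr !mulrDr aa !mulrA aa -(mulrA a b a) aba.
rewrite -scalerAl; linear_eq C A; rewrite /=; move: d_neq0; rewrite /d => h0; by field.
Qed.

(* In the 4-box space: the e_i are delta times the Jones projections, f and g *)
(* are the Jones-Wenzl projection on the first and on the last three strings, *)
(* and u and v are the corresponding differences of its two summands.         *)
Record level_four (C : numClosedFieldType) (A : algType C) (st : A -> A) (tr : A -> C)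
    (delta sigma : C) (e1 e2 e3 u v f g : A) (d := delta ^+ 2 - 1)
    (D := delta * (delta ^+ 2 - 2)) : Prop := LevelFour {
  lf_d_neq0 : d != 0;
  lf_D_neq0 : D != 0;
  lf_delta_neq0 : delta != 0;
  lf_delta_real : delta^* = delta;
  lf_sigma_unit : sigma * sigma^* = 1;
  lf_st_lin : forall z x y, st (z *: x + y) = z^* *: st x + st y;
  lf_st_mul : forall x y, st (x * y) = st y * st x;
  lf_tr_lin : forall z x y, tr (z *: x + y) = z * tr x + tr y;
  lf_tr_mulC : forall x y, tr (x * y) = tr (y * x);
  lf_e11 : e1 * e1 = delta *: e1;
  lf_e22 : e2 * e2 = delta *: e2;
  lf_e33 : e3 * e3 = delta *: e3;
  lf_e121 : e1 * (e2 * e1) = e1;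
  lf_e212 : e2 * (e1 * e2) = e2;
  lf_e232 : e2 * (e3 * e2) = e2;
  lf_e323 : e3 * (e2 * e3) = e3;
  lf_e13 : e1 * e3 = e3 * e1;
  lf_st_e1 : st e1 = e1;
  lf_st_e2 : st e2 = e2;
  lf_st_e3 : st e3 = e3;
  lf_st_u : st u = u;
  lf_st_v : st v = v;
  lf_fE : f = 1 - (delta / d) *: (e1 + e2) + d^-1 *: (e1 * e2 + e2 * e1);
  lf_gE : g = 1 - (delta / d) *: (e2 + e3) + d^-1 *: (e2 * e3 + e3 * e2);
  lf_uu : u * u = f;
  lf_vv : v * v = g;
  lf_fu : f * u = u;
  lf_gv : g * v = v;
  lf_slide : e3 * (e2 * (e1 * v)) = sigma^* *: (e3 * u);
  lf_tr_e3f : tr (e3 * f) = D;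
  lf_tr_uv : tr (u * v) = 0;
  lf_tr_u : tr u = 0;
  lf_tr_f : tr f = delta * D
}.

(** * The Jones-Wenzl projection in the 4-box space and the corner of [gap] *)

Section LevelFour.
Variables (C : numClosedFieldType) (A : algType C).
Variables (st : A -> A) (tr : A -> C) (delta sigma : C).
Let d : C := delta ^+ 2 - 1.
Let D : C := delta * (delta ^+ 2 - 2).
Let kappa : C := D / d.
Variables (e1 e2 e3 u v f g : A).
Hypothesis LF : level_four st tr delta sigma e1 e2 e3 u v f g.

Let d_neq0 := lf_d_neq0 LF.
Let D_neq0 := lf_D_neq0 LF.
Let delta_neq0 := lf_delta_neq0 LF.
Let delta_real := lf_delta_real LF.
Let sigma_unit := lf_sigma_unit LF.
Let st_lin := lf_st_lin LF.
Let st_mul := lf_st_mul LF.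
Let tr_lin := lf_tr_lin LF.
Let tr_mulC := lf_tr_mulC LF.
Let e11 := lf_e11 LF.
Let e22 := lf_e22 LF.
Let e33 := lf_e33 LF.
Let e121 := lf_e121 LF.
Let e212 := lf_e212 LF.
Let e232 := lf_e232 LF.
Let e323 := lf_e323 LF.
Let e13 := lf_e13 LF.
Let st_e1 := lf_st_e1 LF.
Let st_e2 := lf_st_e2 LF.
Let st_e3 := lf_st_e3 LF.
Let st_u := lf_st_u LF.
Let st_v := lf_st_v LF.
Let fE := lf_fE LF.
Let gE := lf_gE LF.
Let uu := lf_uu LF.
Let vv := lf_vv LF.
Let fu := lf_fu LF.
Let gv := lf_gv LF.
Let slide := lf_slide LF.
Let tr_e3f := lf_tr_e3f LF.
Let tr_uv := lf_tr_uv LF.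
Let tr_u := lf_tr_u LF.
Let tr_f := lf_tr_f LF.

Let tr0 : tr 0 = 0 := semilin0 (W := C^o) (theta := idfun) tr_lin.
Let trD x y : tr (x + y) = tr x + tr y := semilinD (W := C^o) (theta := idfun) tr_lin x y.
Let trZ z x : tr (z *: x) = z * tr x := semilinZ (W := C^o) (theta := idfun) tr_lin z x.
Let trN x : tr (- x) = - tr x := semilinN (W := C^o) (theta := idfun) tr_lin x.
Let trB x y : tr (x - y) = tr x - tr y := semilinB (W := C^o) (theta := idfun) tr_lin x y.
Let st0 : st 0 = 0 := semilin0 (theta := Num.conj) st_lin.
Let stD x y : st (x + y) = st x + st y := semilinD (theta := Num.conj) st_lin x y.
Let stZ z x : st (z *: x) = z^* *: st x := semilinZ (theta := Num.conj) st_lin z x.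
Let stN x : st (- x) = - st x := semilinN (theta := Num.conj) st_lin x.

Lemma d_real : d^* = d.
Proof. by rewrite rmorphB rmorphXn /= delta_real conjC1. Qed.
Lemma D_real : D^* = D.
Proof. by rewrite rmorphM rmorphB rmorphXn /= delta_real conjC_nat. Qed.

Lemma uf : u * f = u. Proof. by rewrite -uu mulrA uu fu. Qed.
Lemma vg : v * g = v. Proof. by rewrite -vv mulrA vv gv. Qed.
Lemma ff : f * f = f. Proof. by rewrite -{2}uu mulrA fu uu. Qed.
Lemma gg : g * g = g. Proof. by rewrite -{2}vv mulrA gv vv. Qed.
Lemma st_f : st f = f. Proof. by rewrite -uu st_mul st_u. Qed.
Lemma st_g : st g = g. Proof. by rewrite -vv st_mul st_v. Qed.

Lemma e1f : e1 * f = 0. Proof. exact: jw_kill d_neq0 e11 e121 fE. Qed.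
Lemma e2f : e2 * f = 0.
Proof. by apply: (jw_kill d_neq0 e22 e212); rewrite fE [e2 + e1]addrC [_ + e1 * e2]addrC. Qed.
Lemma e2g : e2 * g = 0. Proof. exact: jw_kill d_neq0 e22 e232 gE. Qed.
Lemma e3g : e3 * g = 0.
Proof. by apply: (jw_kill d_neq0 e33 e323); rewrite gE [e3 + e2]addrC [_ + e2 * e3]addrC. Qed.
Lemma ge2 : g * e2 = 0. Proof. by rewrite -st_g -st_e2 -st_mul e2g st0. Qed.
Lemma ge3 : g * e3 = 0. Proof. by rewrite -st_g -st_e3 -st_mul e3g st0. Qed.
Lemma e2v : e2 * v = 0. Proof. by rewrite -gv mulrA e2g mul0r. Qed.
Lemma e3v : e3 * v = 0. Proof. by rewrite -gv mulrA e3g mul0r. Qed.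
Lemma ve3 : v * e3 = 0. Proof. by rewrite -vg -mulrA ge3 mulr0. Qed.

Lemma slide_st : v * (e1 * (e2 * e3)) = sigma *: (u * e3).
Proof.
have := congr1 st slide; rewrite stZ conjCK !st_mul st_e1 st_e2 st_e3 st_v st_u.
by rewrite -!mulrA.
Qed.

(** The product of [v * (e1 * (e2 * e3))] with its adjoint is evaluated by the slide relation at
    both ends, or by the Temperley-Lieb relations in the middle. *)
Lemma ueu_vev : u * (e3 * u) = v * (e1 * v).
Proof.
apply: (scalerI delta_neq0).
transitivity ((v * (e1 * (e2 * e3))) * (e3 * (e2 * (e1 * v)))).
  rewrite slide slide_st -scalerAl -scalerAr -!mulrA (pull e33) scalerA sigma_unit.
  by rewrite scale1r -scalerAl -scalerAr.
rewrite -!mulrA (pull e33) -scalerAl -!scalerAr.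
by rewrite (pull3 e232) (pull3 e121).
Qed.

(** By the slide relation [e3 * u] is a multiple of a product ending in [v], and [v * e3 = 0]. *)
Lemma eue3 : e3 * (u * e3) = 0.
Proof.
have sb : sigma^* != 0.
  by apply: contra_neq (oner_neq0 C) => s0; rewrite -sigma_unit s0 mulr0.
apply: (scalerI sb); rewrite scaler0 mulrA scalerAl -slide -!mulrA ve3.
by rewrite !mulr0.
Qed.

Lemma kappa_neq0 : kappa != 0.
Proof. by rewrite mulf_neq0 ?invr_eq0. Qed.

(** The step of Wenzl's recursion: [a * (h * a)] is [kappa *: a] up to a multiple of [a * c], which
    [h] annihilates. The general form applies at either end of the four strings. *)
Lemma efe_gen (a b c h : A) : a * a = delta *: a -> a * (b * a) = a ->
  c * a = a * c -> c * h = 0 ->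
  h = 1 - (delta / d) *: (c + b) + d^-1 *: (c * b + b * c) ->
  a * (h * (a * h)) = kappa *: (a * h).
Proof.
move=> aa aba ca ch hE.
have e : a * (h * a) = kappa *: a - ((delta ^+ 2 - 2) / d) *: (a * c).
  rewrite hE mulrDl mulrBl mul1r -!scalerAl !mulrDl -!mulrA ca.
  rewrite mulrDr mulrBr -!scalerAr !mulrDr aa aba.
  have -> : a * (a * c) = delta *: (a * c) by rewrite mulrA aa -scalerAl.
  have -> : a * (c * (b * a)) = a * c by rewrite (mulrA a) -ca -!mulrA aba ca.
  have -> : a * (b * (a * c)) = a * c by rewrite (pull3 aba).
  linear_eq C A; rewrite /= /kappa /D; move: d_neq0; rewrite /d => h0; by field.
rewrite (pull3 e) mulrBl -!scalerAl -mulrA ch mulr0 scaler0 subr0 //.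
Qed.

Lemma efef3 : e3 * (f * (e3 * f)) = kappa *: (e3 * f).
Proof. exact: efe_gen e33 e323 e13 e1f fE. Qed.
Lemma egeg1 : e1 * (g * (e1 * g)) = kappa *: (e1 * g).
Proof.
apply: (@efe_gen e1 e2 e3 g e11 e121 (esym e13) e3g).
by rewrite gE [e3 + e2]addrC [e3 * e2 + _]addrC.
Qed.

(* [jw] is the Jones-Wenzl projection of the 4-box space; by [jwE] it does not *)
(* matter from which side it is built, and by [rhoE] neither does [rho].      *)
Definition ep := kappa^-1 *: (f * (e3 * f)).
Definition ep' := kappa^-1 *: (g * (e1 * g)).
Definition rho := kappa^-1 *: (u * (e3 * u)).
Definition jw := f - ep.
Definition gap := jw - rho.

Lemma rhoE : rho = kappa^-1 *: (v * (e1 * v)).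
Proof. by rewrite /rho ueu_vev. Qed.

Lemma e3ep : e3 * ep = e3 * f.
Proof. by rewrite /ep -scalerAr efef3 scalerA mulVf ?kappa_neq0 ?scale1r. Qed.
Lemma e1ep' : e1 * ep' = e1 * g.
Proof. by rewrite /ep' -scalerAr egeg1 scalerA mulVf ?kappa_neq0 ?scale1r. Qed.
Lemma st_ep : st ep = ep.
Proof.
rewrite /ep stZ !st_mul st_f st_e3 -mulrA; congr (_ *: _).
by rewrite fmorphV rmorphM fmorphV /= d_real D_real.
Qed.
Lemma st_ep' : st ep' = ep'.
Proof.
rewrite /ep' stZ !st_mul st_g st_e1 -mulrA; congr (_ *: _).
by rewrite fmorphV rmorphM fmorphV /= d_real D_real.
Qed.
Lemma st_rho : st rho = rho.
Proof.
rewrite /rho stZ !st_mul st_u st_e3 -mulrA; congr (_ *: _).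
by rewrite fmorphV rmorphM fmorphV /= d_real D_real.
Qed.

(** The uniqueness argument for Jones-Wenzl projections: one side is annihilated by the cup-caps
    from the left, the other from the right, so the product of the two equals each of them. *)
Lemma jwE : jw = g - ep'.
Proof.
have j1 : e1 * jw = 0 by rewrite /jw /ep mulrBr -scalerAr (pull e1f) e1f mul0r scaler0 subrr.
have j2 : e2 * jw = 0 by rewrite /jw /ep mulrBr -scalerAr (pull e2f) e2f mul0r scaler0 subrr.
have j3 : e3 * jw = 0 by rewrite /jw mulrBr e3ep subrr.
have k1 : (g - ep') * e1 = 0.
  have <- : st (g - ep') = g - ep' by rewrite stD stN st_g st_ep'.
  by rewrite -{1}st_e1 -st_mul mulrBr e1ep' subrr st0.
have k2 : (g - ep') * e2 = 0.
  by rewrite /ep' mulrBl -scalerAl -!mulrA ge2 !mulr0 scaler0 subrr.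
have k3 : (g - ep') * e3 = 0.
  by rewrite /ep' mulrBl -scalerAl -!mulrA ge3 !mulr0 scaler0 subrr.
have gj : g * jw = jw.
  rewrite gE mulrDl mulrBl mul1r -!scalerAl !mulrDl -!mulrA j2 j3 !mulr0.
  by rewrite !addr0 !scaler0 subr0 addr0.
transitivity ((g - ep') * jw).
  by rewrite mulrBl gj /ep' -scalerAl -!mulrA gj j1 mulr0 scaler0 subr0.
have h : (g - ep') * f = g - ep'.
  rewrite fE mulrDr mulrBr mulr1 -!scalerAr !mulrDr ![(g - ep') * (_ * _)]mulrA.
  by rewrite k1 k2 !mul0r !addr0 !scaler0 subr0 addr0.
by rewrite /jw /ep mulrBr -scalerAr (pull h) (pull k3) h mul0r scaler0 subr0.
Qed.

Lemma gap_u : u * gap = gap * u.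
Proof. exact: (corner_comm _ _ uu fu uf). Qed.
(** By [jwE] and [rhoE] the element [gap] has the same description in terms of [v], [g], [e1] as in
    terms of [u], [f], [e3]. *)
Lemma gap_v : v * gap = gap * v.
Proof. by rewrite /gap jwE rhoE; exact: (corner_comm _ _ vv gv vg). Qed.
Lemma gap_gap : gap * gap = gap.
Proof. exact: corner_idem kappa_neq0 uu fu uf ff efef3 eue3. Qed.
Lemma rho_rho : rho * rho = rho.
Proof. exact: corner_eueu kappa_neq0 uu fu efef3. Qed.
Lemma f_rho : f * rho = rho. Proof. exact: corner_feu _ _ fu. Qed.
Lemma jw_rho : jw * rho = rho.
Proof. by rewrite /jw mulrBl f_rho (corner_efeu _ fu eue3) subr0. Qed.
Lemma rho_jw : rho * jw = rho.
Proof.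
have st_jw : st jw = jw by rewrite /jw stD stN st_f st_ep.
by rewrite -{1}st_rho -st_jw -st_mul jw_rho st_rho. Qed.
Lemma gap_f : gap * f = gap.
Proof.
by rewrite /gap /jw !mulrBl ff (corner_eff _ _ ff) (corner_euf _ _ uf).
Qed.
Lemma gap_g : gap * g = gap.
Proof.
by rewrite /gap jwE rhoE !mulrBl gg (corner_eff _ _ gg) (corner_euf _ _ vg).
Qed.
Lemma gap_rho : gap * rho = 0.
Proof. by rewrite /gap mulrBl jw_rho rho_rho subrr. Qed.
Lemma rho_gap : rho * gap = 0.
Proof. by rewrite /gap mulrBr rho_jw rho_rho subrr. Qed.
Lemma st_gap : st gap = gap.
Proof. by rewrite /gap /jw !(stD, stN) st_f st_ep st_rho. Qed.

Lemma e3fv : e3 * (f * v) = (sigma^* / d) *: (e3 * u).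
Proof.
rewrite fE !(mulrBl, mulrDl) mul1r -!scalerAl !mulrDl -!mulrA e2v mulr0 addr0 add0r.
rewrite !(mulrBr, mulrDr) -!scalerAr e3v.
rewrite slide (mulrA e3 e1) -e13 -mulrA e3v.
by rewrite !mulr0 scaler0 subr0 add0r scalerA mulrC.
Qed.

(** [gap] is [f - ep - rho]. Here [f] fixes [u * v], the slide relation evaluates [ep * (u * v)],
    and [e3fv] evaluates [rho * (u * v)]. *)
Lemma gap_uv : gap * (u * v) = u * v
  - (sigma / kappa) *: (f * (e3 * (e2 * (e1 * g)))) - (sigma^* / d) *: rho.
Proof.
have h1 : ep * (u * v) = (sigma / kappa) *: (f * (e3 * (e2 * (e1 * g)))).
  rewrite /ep; have := congr1 (fun x => sigma *: (f * (x * v))) slide.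
  rewrite -!scalerAl -!scalerAr scalerA sigma_unit scale1r -!mulrA vv => h.
  by rewrite (pull fu) -h scalerA mulrC.
have h2 : rho * (u * v) = (sigma^* / d) *: rho.
  rewrite /rho -scalerAl -!mulrA (pull uu) e3fv -!scalerAr !scalerA.
  by rewrite mulrC.
by rewrite /gap /jw !mulrBl h1 h2 (pull fu).
Qed.

Lemma tr_rho : tr rho = d.
Proof.
rewrite /rho trZ tr_mulC -mulrA uu tr_e3f /kappa invfM invrK mulrC mulrA.
by rewrite mulfV ?mul1r.
Qed.
Lemma tr_ep : tr ep = d.
Proof.
rewrite /ep trZ tr_mulC -mulrA ff tr_e3f /kappa invfM invrK mulrC mulrA.
by rewrite mulfV ?mul1r.
Qed.
Lemma tr_gap : tr gap = delta * D - d *+ 2.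
Proof. by rewrite /gap /jw !trB tr_f tr_ep tr_rho -addrA -opprD. Qed.

Lemma tr_eu : tr (e3 * u) = 0.
Proof.
apply: (mulfI delta_neq0); rewrite mulr0 -trZ scalerAl -e33 -mulrA tr_mulC -mulrA.
by rewrite eue3 tr0.
Qed.
Lemma tr_gap_u : tr (gap * u) = 0.
Proof.
rewrite /gap /jw !mulrBl !trB fu tr_u /ep /rho -!scalerAl !trZ -!mulrA fu uu.
rewrite tr_mulC -mulrA uf tr_eu tr_mulC -mulrA fu tr_eu.
by rewrite !mulr0 !subr0.
Qed.

(** [u * v] is traceless, and the two terms subtracted in [gap_uv] have traces [sigma] and
    [sigma^*]. *)
Lemma tr_gap_uv : tr (gap * (u * v)) = - (sigma + sigma^*).
Proof.
rewrite gap_uv 2!trB 2!trZ tr_uv tr_rho.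
have h : e1 * (g * f) = d^-1 *: (e1 * (e2 * (e3 * f))).
  rewrite gE !(mulrBl, mulrDl) mul1r -!scalerAl !mulrDl -!mulrA e2f !mulr0.
  rewrite !(mulrBr, mulrDr) -!scalerAr add0r addr0 e1f (mulrA e1 e3) e13 -mulrA e1f.
  by rewrite mulr0 scaler0 subrr add0r.
have -> : tr (f * (e3 * (e2 * (e1 * g)))) = d^-1 * tr (e3 * f).
  by rewrite tr_mulC -!mulrA h -!scalerAr (pull3 e212) (pull3 e323) trZ.
rewrite tr_e3f [_ * D]mulrC -/kappa divfK ?kappa_neq0 // divfK // sub0r opprD.
by [].
Qed.

Lemma st_uv : st (u * v) = v * u. Proof. by rewrite st_mul st_u st_v. Qed.

(** The adjoint of the Temperley-Lieb term of [gap_uv]. *)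
Definition sy := g * (e1 * (e2 * (e3 * f))).

Lemma gap_vu : v * u = gap * (v * u) + (sigma^* / kappa) *: sy + (sigma / d) *: rho.
Proof.
have h := congr1 st gap_uv; move: h.
have -> : st (gap * (u * v)) = gap * (v * u).
  by rewrite st_mul st_uv st_gap -mulrA gap_u mulrA gap_v -mulrA.
rewrite 2!stD 2!stN 2!stZ st_rho st_uv !st_mul st_f st_e1 st_e2 st_e3 st_g -!mulrA.
rewrite !rmorphM !fmorphV rmorphM fmorphV /= conjCK d_real D_real => ->.
rewrite /sy; linear_eq C A; rewrite /=; ring.
Qed.

Lemma syE : sy = g * (e1 * (e2 * e3)) - (delta / d) *: (g * (e1 * e2))
  + d^-1 *: (g * e1).
Proof.
rewrite /sy {1}fE !(mulrBr, mulrDr, =^~ scalerAr) mulr1.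
have -> : e3 * (e1 * e2) = e1 * (e3 * e2) by rewrite mulrA -e13 -mulrA.
rewrite -e13 !(pull3 e121) e13 e232 (pull3 e232) e121 (pull e13) -mulrA !(pull ge3).
by rewrite !mul0r !add0r.
Qed.

(** By [jwE], with the right factor [g] of [ep'] expanded. Like [syE], this uses only left multiples
    of [g] by initial parts of [e1 * (e2 * e3)], so that [jw_rotation] becomes linear. *)
Lemma jw_expand : jw = g - kappa^-1 *: (g * e1)
  + (delta / D) *: (g * (e1 * e2)) - D^-1 *: (g * (e1 * (e2 * e3))).
Proof.
have -> : jw = g - kappa^-1 *: (g * (e1 * (1 - (delta / d) *: (e2 + e3)
    + d^-1 *: (e2 * e3 + e3 * e2)))) by rewrite -gE jwE.
rewrite !(mulrBr, mulrDr, =^~ scalerAr) mulr1.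
rewrite e13 (pull e13) -mulrA !(pull ge3) !mul0r.
linear_eq C A; rewrite /= /kappa; move: d_neq0 D_neq0 => h1 h2; by field; rewrite h1 h2.
Qed.

(* The right-hand side is the one-click rotation of [jw]. *)
Lemma jw_rotation : (1 - D ^- 2) *: sy - D^-1 *: jw =
  g * (e1 * (e2 * e3)) -
  kappa^-1 *: (d^-1 *: g + g * (e1 * e2) - (delta / d) *: (g * e1)).
Proof.
rewrite syE jw_expand; linear_eq C A; rewrite /= /kappa; move: d_neq0 D_neq0;
  rewrite /D /d => h1; rewrite mulf_eq0 negb_or => /andP[h2 h3]; field; rewrite ?h1 ?h2 ?h3 //.
Qed.

Section Anticommutator.
Hypotheses (delta_D : delta * D = d *+ 4) (D_d : D ^+ 2 = 3 * d ^+ 2 + 1).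
Hypothesis comm_gap_u : forall x, gap * x = x -> x * gap = x ->
  gap * u * x = x * (gap * u) -> exists z w, x = z *: gap + w *: (gap * u).
Hypotheses (sigma_neq0 : sigma + sigma^* != 0)
  (sigma_d : (sigma + sigma^*) ^+ 2 != (d *+ 2) ^+ 2).

Definition zvec := 2 *: rho - gap.
Definition wvec := 2^-1 *: ((gap * u) * (gap * v) - (gap * v) * (gap * u)).

Lemma tr_gap2 : tr gap = d *+ 2.
Proof. by rewrite tr_gap delta_D -mulrnBr. Qed.
Let a := gap * u.
Let b := gap * v.
Let gap_a : gap * a = a. Proof. by rewrite /a mulrA gap_gap. Qed.
Let a_gap : a * gap = a. Proof. by rewrite /a -mulrA gap_u mulrA gap_gap. Qed.
Let gap_b : gap * b = b. Proof. by rewrite /b mulrA gap_gap. Qed.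
Let b_gap : b * gap = b. Proof. by rewrite /b -mulrA gap_v mulrA gap_gap. Qed.
Let a_a : a * a = gap.
Proof. by rewrite /a -mulrA (pull gap_u) -mulrA uu gap_f gap_gap. Qed.
Let b_b : b * b = gap.
Proof. by rewrite /b -mulrA (pull gap_v) -mulrA vv gap_g gap_gap. Qed.
Let st_a : st a = a. Proof. by rewrite st_mul st_u st_gap gap_u. Qed.
Let st_b : st b = b. Proof. by rewrite st_mul st_v st_gap gap_v. Qed.
Let baE : b * a = gap * (v * u).
Proof. by rewrite /a /b -mulrA (pull gap_v) -mulrA (pull gap_gap). Qed.
Let tr_ab : tr (a * b) = - (sigma + sigma^*).
Proof. by rewrite -tr_gap_uv /a /b -mulrA (pull gap_u) -mulrA (pull gap_gap). Qed.

Lemma st_zvec : st zvec = zvec.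
Proof. exact: st_zz st_lin st_rho st_gap. Qed.
Lemma st_wvec : st wvec = - wvec.
Proof. exact: st_wz st_lin st_mul st_a st_b. Qed.
Lemma tr_zvec : tr (zvec * zvec) = d *+ 6.
Proof. exact: (tr_zz_zz tr_lin gap_gap rho_rho gap_rho rho_gap tr_gap2 tr_rho). Qed.
Lemma tr_zvec_wvec : tr (zvec * wvec) = 0.
Proof.
rewrite (zz_wz gap_a gap_b rho_gap) trN; apply/eqP; rewrite oppr_eq0; apply/eqP.
exact: (tr_wz _ _ tr_lin tr_mulC).
Qed.
Lemma tr_combination (z w : C) :
  tr ((z *: zvec - w *: wvec) * (z *: zvec - w *: wvec)) = d *+ 6 * z ^+ 2 +
  w ^+ 2 * ((- (sigma + sigma^*) / (d *+ 2)) ^+ 2 - 1) * (d *+ 2).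
Proof.
exact: (tr_rot_sq tr_lin tr_mulC gap_gap gap_a a_gap gap_b b_gap a_a b_b rho_rho
  gap_rho rho_gap tr_gap2 tr_rho tr_gap_u tr_ab comm_gap_u d_neq0 sigma_neq0 sigma_d).
Qed.

(* The left-hand side is the one-click rotation of [3 *: rho - jw = zvec].   *)
Lemma zvec_rotation :
  (3 * (sigma / kappa)) *: (v * u) - ((1 - D ^- 2) *: sy - D^-1 *: jw) =
  sigma *: (((3 * sigma + sigma^*) / (2 * D)) *: zvec - (3 / kappa) *: wvec).
Proof.
rewrite {1}gap_vu -baE.
rewrite (baE2 tr_lin tr_mulC gap_gap gap_a a_gap gap_b b_gap a_a b_b tr_gap2
  tr_gap_u tr_ab comm_gap_u d_neq0 sigma_neq0 sigma_d) [wz _ _](_ : _ = wvec) //.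
have -> : jw = gap + rho by rewrite /gap subrK.
(* The relation between [D ^+ 2] and [d ^+ 2] makes [sy] cancel: its coefficient from [v * u] is
   three times the inverse square of [kappa], which equals [1 - D ^- 2]. *)
rewrite /zvec; have D2 : D ^- 2 = 1 - 3 * (kappa ^- 2).
  rewrite /kappa expr_div_n invf_div; apply: (mulIf (x := D ^+ 2)); first exact: expf_neq0.
  rewrite mulVf ?expf_neq0 // mulrBl mul1r -mulrA divfK ?expf_neq0 // D_d; ring.
have kd : kappa = D / d by [].
have s1 : sigma^* = sigma^-1.
  by apply: (mulfI (x := sigma)); [|rewrite sigma_unit mulfV //];
    apply: contra_neq (oner_neq0 C) => s0; rewrite -sigma_unit s0 mul0r.
have s0 : sigma != 0.
  by apply: contra_neq (oner_neq0 C) => s0; rewrite -sigma_unit s0 mul0r.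
rewrite D2 kd s1; move: gap rho wvec sy => G r w Y.
linear_eq C A; rewrite /=; move: d_neq0 D_neq0 => h1 h2; field; rewrite ?h1 ?h2 ?s0 //.
Qed.

End Anticommutator.

End LevelFour.

(** Either [s ^+ 2 = 1], and the equation reduces to [d ^+ 2 = 1], or [t = s ^+ 2] is a primitive
    cube root of unity. In that case the equation becomes [12 * d ^+ 2 * t = 15 * d ^+ 2 - 3], so
    [t] is real; being also conjugate to its square, it would be 1. *)
Lemma rotation_numeric (C : numClosedFieldType) (s d D : C) (c := - (s + s^* ) / (d *+ 2))
    (p := (3 * s + s^* ) / (2 * D)) (q := 3 / (D / d)) :
  s * s^* = 1 -> s ^+ 6 = 1 -> d^* = d -> d != 0 -> D != 0 -> d ^+ 2 != 1 ->
  D^* = D -> D ^+ 2 = 3 * d ^+ 2 + 1 ->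
  (p + p^* ) * (s ^+ 2 * (d *+ 6 * p ^+ 2 + q ^+ 2 * (c ^+ 2 - 1) * (d *+ 2))) =
  d *+ 6 * (s ^+ 2 * p + (s^* ) ^+ 2 * p^* ) -> False.
Proof.
move=> ss s6 dr d0 D0 d1 Dr DE.
have s0 : s != 0 by apply: contra_neq (oner_neq0 C) => s0; rewrite -ss s0 mul0r.
have rE : s^* = s ^+ 5 by apply: (mulfI s0); rewrite ss -exprS s6.
have pb : p^* = (3 * s^* + s) / (2 * D).
  by rewrite /p rmorphM fmorphV rmorphD !rmorphM /= conjCK Dr !rmorph_nat.
rewrite pb => E.
(* The equation with denominators cleared and [D ^+ 2] replaced by its value in [d]. *)
have {E} : (s + s^* ) * s ^+ 2 * ((3 * s + s^* ) ^+ 2 + 3 * (s + s^* ) ^+ 2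
    - 12 * d ^+ 2) = (3 * d ^+ 2 + 1) * (s ^+ 2 * (3 * s + s^* ) +
    (s^* ) ^+ 2 * (3 * s^* + s)).
  rewrite -DE; have h : 3 * d / D ^+ 3 != 0 by rewrite !mulf_neq0 ?invr_eq0 ?expf_neq0 ?pnatr_eq0.
  apply: (mulIf h); apply: etrans (etrans E _); rewrite /c /p /q; field.
    by rewrite d0 D0.
  by rewrite D0.
have t3 : (s ^+ 2 - 1) * ((s ^+ 2) ^+ 2 + s ^+ 2 + 1) = 0.
  by transitivity (s ^+ 6 - 1); [ring | rewrite s6 subrr].
have [t1|t1] := eqVneq (s ^+ 2) 1.
  have rs : s^* = s by rewrite rE -[5%N]/(2 * 2 + 1)%N exprD exprM t1 expr1n mul1r.
  rewrite rs => E; move/eqP: d1; apply; apply/eqP; rewrite -subr_eq0.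
  have h : 48 * s != 0 by rewrite mulf_neq0 ?pnatr_eq0.
  apply/eqP; apply: (mulfI h); rewrite mulr0; apply/eqP; rewrite -oppr_eq0; apply/eqP.
  move/eqP: E; rewrite -subr_eq0 => /eqP <-.
  have -> : (3 * s + s) ^+ 2 = 16 * s ^+ 2 by ring.
  have -> : (s + s) ^+ 2 = 4 * s ^+ 2 by ring.
  by rewrite t1; ring.
move/eqP: t3; rewrite mulf_eq0 subr_eq0 (negPf t1) /= => /eqP Q.
have rt : s^* = - s * (s ^+ 2 + 1).
  by rewrite rE; apply/eqP; rewrite -subr_eq0 -(mulr0 s) -Q; apply/eqP; ring.
have r2 : (s^* ) ^+ 2 = (s ^+ 2) ^+ 2.
  by rewrite rE -exprM -[(5 * 2)%N]/(6 + 4)%N exprD s6 mul1r -exprM.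
move: t1 Q; rewrite r2 rt; set t := s ^+ 2 => t1 Q E.
have tE : t * (12 * d ^+ 2 * t) = t * (15 * d ^+ 2 - 3).
  apply: (mulfI s0); apply/eqP; rewrite -subr_eq0; apply/eqP.
  (* The cofactor of [t ^+ 2 + t + 1] is found by polynomial division. *)
  transitivity (((s + - s * (t + 1)) * t * ((3 * s + - s * (t + 1)) ^+ 2
      + 3 * (s + - s * (t + 1)) ^+ 2 - 12 * d ^+ 2)
    - (3 * d ^+ 2 + 1) * (t * (3 * s + - s * (t + 1))
      + t ^+ 2 * (3 * (- s * (t + 1)) + s)))
    - s * (- 4 * t ^+ 3 + 8 * t ^+ 2 + (9 * d ^+ 2 - 5) * t) * (t ^+ 2 + t + 1)).
    by rewrite /t; ring.
  by rewrite E Q mulr0 subr0 subrr.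
have t0 : t != 0 by rewrite expf_neq0.
have tr : t^* = t.
  have d12 : 12 * d ^+ 2 != 0 by rewrite mulf_neq0 ?expf_neq0 ?pnatr_eq0.
  apply: (mulfI d12); rewrite (mulfI t0 tE); have := congr1 Num.conj (mulfI t0 tE).
  have dd : (d ^+ 2)^* = d ^+ 2 by rewrite rmorphXn /= dr.
  by rewrite rmorphB (rmorphM _ (_ * d ^+ 2)) (rmorphM _ 12) (rmorphM _ 15) /= dd !rmorph_nat.
have tt : t ^+ 2 = t by rewrite -{2}tr rmorphXn /= r2.
move: t1; rewrite -(mulfI t0 (_ : t * t = t * 1)) ?eqxx // mulr1.
exact: tt.
Qed.

(** * Minimal projections *)

Section StarAlgebra.
Variables (C : numClosedFieldType) (A : falgType C).
Variables (st : A -> A) (tr : A -> C).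
Hypothesis st_lin : forall z x y, st (z *: x + y) = z^* *: st x + st y.
Hypothesis st_mul : forall x y, st (x * y) = st y * st x.
Hypothesis stK : forall x, st (st x) = x.
Hypothesis tr_lin : forall z x y, tr (z *: x + y) = z * tr x + tr y.
Hypothesis tr_mulC : forall x y, tr (x * y) = tr (y * x).
Hypothesis tr_pos : forall x, x != 0 -> 0 < tr (st x * x).

Let tr0 : tr 0 = 0 := semilin0 (W := C^o) (theta := idfun) tr_lin.
Let st0 : st 0 = 0 := semilin0 (theta := Num.conj) st_lin.
Let stD x y : st (x + y) = st x + st y := semilinD (theta := Num.conj) st_lin x y.
Let stZ z x : st (z *: x) = z^* *: st x := semilinZ (theta := Num.conj) st_lin z x.
Let stN x : st (- x) = - st x := semilinN (theta := Num.conj) st_lin x.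

Definition projection (p : A) := p * p = p /\ st p = p.
Definition minimal (p : A) := [/\ projection p, p != 0 &
  forall q, projection q -> p * q = q -> q = 0 \/ q = p].

Lemma st_mul_eq0 x : st x * x = 0 -> x = 0.
Proof.
move=> e; apply/eqP; apply: contraT => /tr_pos.
by rewrite e tr0 ltxx.
Qed.

Lemma st1 : st 1 = 1.
Proof. by rewrite -[RHS]stK -[st 1 in RHS]mulr1 st_mul stK mulr1. Qed.

Lemma st_horner (a : A) (r : {poly C}) : st a = a ->
  st (horner_alg a r) = horner_alg a (map_poly Num.conj r).
Proof.
move=> sa; elim/poly_ind: r => [|r c IH]; first by rewrite map_poly0 !rmorph0 st0.
rewrite !rmorphD !rmorphM /= map_polyX map_polyC !horner_algX !horner_algC.
rewrite stD st_mul IH sa stZ st1; congr (_ + _).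
elim/poly_ind: (map_poly _ r) => [|q d IHq]; first by rewrite rmorph0 mulr0 mul0r.
rewrite rmorphD rmorphM /= horner_algX horner_algC mulrDr mulrDl mulrA IHq.
by rewrite -scalerAr -scalerAl mul1r mulr1.
Qed.

Lemma horner_eigen (a z : A) (l : C) (r : {poly C}) : a * z = l *: z ->
  horner_alg a r * z = r.[l] *: z.
Proof.
move=> az; elim/poly_ind: r => [|r c IH]; first by rewrite rmorph0 horner0 mul0r scale0r.
rewrite rmorphD rmorphM /= horner_algX horner_algC hornerMXaddC mulrDl -mulrA az.
by rewrite -scalerAr IH scalerA -scalerAl mul1r -scalerDl [l * _]mulrC.
Qed.

(** In finite dimension some polynomial in [a] annihilates [p]. Splitting off its linear factors one
    at a time, the first one whose cofactor does not annihilate [p] yields the eigenvector. *)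
Lemma eigen_exists (a p : A) : p != 0 ->
  exists l r, horner_alg a r * p != 0 /\ a * (horner_alg a r * p) = l *: (horner_alg a r * p).
Proof.
move=> p0.
have [q q0 qp] : exists2 q : {poly C}, q != 0 & horner_alg a q * p = 0.
  pose X := [tuple a ^+ i * p | i < (\dim {:A}).+1].
  have nf : ~~ free X.
    apply/negP => /eqP fX; have := dimvS (subvf <<X>>%VS).
    by rewrite fX size_tuple ltnn.
  move/freeP: nf => nf; have [k [kX [i ki]]] : exists k : 'I_(\dim {:A}).+1 -> C,
      \sum_(i < (\dim {:A}).+1) k i *: X`_i = 0 /\ exists i, k i <> 0.
    apply: contrapT => h; apply: nf => k kX i; apply: contrapT => ki.
    by apply: h; exists k; split=> //; exists i.
  exists (\sum_(i < (\dim {:A}).+1) k i *: 'X^i).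
    apply: contra_notN ki => /eqP e; have := congr1 (fun q : {poly C} => q`_i) e.
    rewrite coef0 coef_sum (bigD1 i) //= coefZ coefXn eqxx mulr1 big1 ?addr0 //.
    by move=> j ji; rewrite coefZ coefXn [val i == _]eq_sym val_eqE (negPf ji) mulr0.
  rewrite -kX rmorph_sum mulr_suml; apply: eq_bigr => j _.
  rewrite -(tnth_nth 0) tnth_mktuple -mul_polyC rmorphM rmorphXn /= horner_algX.
  by rewrite horner_algC -!scalerAl mul1r.
have [n] := ubnP (size q); elim: n q q0 qp => // n IH q q0 qp sq.
have [/size_poly1P [c c0 qc]|] := boolP (size q == 1%N).
  move: qp; rewrite qc horner_algC -scalerAl mul1r => /eqP.
  by rewrite scaler_eq0 (negPf c0) (negPf p0).
move=> /closed_rootP [l /factor_theorem [r qr]].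
have [rp|rp] := eqVneq (horner_alg a r * p) 0.
  apply: (IH r) => //; first by apply: contraNneq q0 => r0; rewrite qr r0 mul0r.
  have r0 : r != 0 by apply: contraNneq q0 => r0; rewrite qr r0 mul0r.
  by rewrite -ltnS; apply: leq_trans sq; rewrite qr size_Mmonic ?monicXsubC // size_XsubC addn2.
exists l, r; split=> //; apply/eqP; rewrite -subr_eq0; apply/eqP.
by rewrite -qp qr mulrC rmorphM rmorphB /= horner_algX horner_algC -mulrA mulrBl -scalerAl mul1r.
Qed.

(** A replacement for the spectral theorem. For an eigenvector [z = r(a) * p], the element
    [st z * z] is a multiple of [z] and, suitably scaled, a nonzero projection below [p]. By
    minimality it is [p], so [p] itself is an eigenvector of [a]. *)
Lemma minimal_real (p a : A) : minimal p -> st a = a -> p * a = a -> a * p = a ->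
  exists l, a = l *: p.
Proof.
move=> [[pp sp] p0 pmin] sa pa ap.
have [l [r [z0 az]]] := eigen_exists a p0.
have comm q : p * horner_alg a q = horner_alg a q * p.
  elim/poly_ind: q => [|q d IHq]; first by rewrite rmorph0 mulr0 mul0r.
  rewrite rmorphD rmorphM /= horner_algX horner_algC mulrDr mulrDl mulrA IHq.
  by rewrite -!mulrA pa ap -scalerAr -scalerAl mul1r mulr1.
set z := _ * p in z0 az; set r' := map_poly Num.conj r.
have szE : st z = horner_alg a r' * p by rewrite st_mul sp st_horner // comm.
have pz : p * z = z by rewrite /z mulrA comm -mulrA pp.
have b0 : st z * z != 0 by apply: contraNneq z0 => e; apply/eqP; exact: st_mul_eq0.
have bE : st z * z = r'.[l] *: z by rewrite szE -mulrA pz (horner_eigen _ az).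
have zE : z * z = r.[l] *: z by rewrite {1}/z -mulrA pz (horner_eigen _ az).
set b := st z * z in b0 bE.
have bb : b * b = (r'.[l] * r.[l]) *: b.
  have zb : z * b = (r'.[l] * r.[l]) *: z by rewrite bE -scalerAr zE scalerA.
  by rewrite {1}/b -mulrA zb -scalerAr.
have sb : st b = b by rewrite st_mul stK.
have c0 : r'.[l] * r.[l] != 0.
  apply: contraNneq b0 => c0; apply/eqP; apply: st_mul_eq0.
  by rewrite sb bb c0 scale0r.
set c := r'.[l] * r.[l] in bb c0.
have cr : c^* = c.
  have := congr1 st bb; rewrite stZ st_mul sb bb => /eqP; rewrite -subr_eq0 -scalerBl.
  by rewrite scaler_eq0 (negPf b0) orbF subr_eq0 => /eqP.
have [||e|e] := pmin (c^-1 *: b).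
- split; last by rewrite stZ sb fmorphV /= cr.
  by rewrite -scalerAl -scalerAr bb !scalerA divfK.
- have psz : p * st z = st z by rewrite -{1}sp -st_mul /z -mulrA pp.
  by rewrite -scalerAr /b mulrA psz.
- by move/eqP: e; rewrite scaler_eq0 invr_eq0 (negPf c0) (negPf b0).
have pE : p = (c^-1 * r'.[l]) *: z by rewrite -e bE scalerA.
by exists l; rewrite -{1}ap pE -scalerAr az !scalerA mulrC mulrA.
Qed.

(** The compression of [x] is a combination of two self-adjoint elements, to which [minimal_real]
    applies. *)
Lemma minimal_corner (p x : A) : minimal p -> exists l, p * (x * p) = l *: p.
Proof.
move=> pm; have [[pp sp] p0 _] := pm; set y := p * _.
have py : p * y = y by rewrite /y mulrA pp.
have yp : y * p = y by rewrite /y -!mulrA pp.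
have psy : p * st y = st y by rewrite -[p]sp -st_mul yp.
have syp : st y * p = st y by rewrite -[p]sp -st_mul py.
have [|||l1 e1] := minimal_real pm (a := y + st y).
- by rewrite stD stK addrC.
- by rewrite mulrDr py psy.
- by rewrite mulrDl yp syp.
have [|||l2 e2] := minimal_real pm (a := 'i *: (y - st y)).
- by rewrite stZ stD stN stK conjCi scaleNr -scalerN opprB.
- by rewrite -scalerAr mulrBr py psy.
- by rewrite -scalerAl mulrBl yp syp.
exists (2^-1 * (l1 - 'i * l2)); rewrite -scalerA scalerBl -e1 -scalerA -e2 scalerA.
rewrite -expr2 sqrCi; apply: (scalerI (a := 2 : C)); first by rewrite pnatr_eq0.
rewrite scalerA mulfV ?pnatr_eq0 //; linear_eq C A; rewrite /=; ring.
Qed.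

Lemma corner_minimal (p : A) : projection p -> p != 0 ->
  (forall x, exists l, p * (x * p) = l *: p) -> minimal p.
Proof.
move=> [pp sp] p0 pc; split=> // q [qq sq] pq.
have qp : q * p = q by rewrite -[p]sp -{1}sq -st_mul pq.
have [l] := pc q; rewrite qp pq => qE; move: qq.
rewrite qE -scalerAl -scalerAr pp scalerA => /eqP; rewrite -subr_eq0 -scalerBl.
rewrite scaler_eq0 (negPf p0) orbF -[X in _ - X]mulr1 -mulrBr mulf_eq0 subr_eq0.
by case/orP=> /eqP ->; [left; rewrite scale0r|right; rewrite scale1r].
Qed.

(** Induction on the dimension of the right ideal generated by [q], which drops when [q] is replaced
    by a proper nonzero subprojection. *)
Lemma minimal_below (q : A) : projection q -> q != 0 ->
  exists2 p, minimal p & q * p = p.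
Proof.
have [n] := ubnP (\dim (amull q @: fullv)); elim: n q => // n IH q dq qP q0.
have [qm|] := pselect (minimal q); first by exists q => //; case: qP.
move=> qm; have [r [rP [qr [r0 rq]]]] : exists r, projection r /\ q * r = r /\ r <> 0 /\ r <> q.
  apply: contrapT => h; apply: qm; split=> // r rP qr; apply: contrapT => h'.
  by apply: h; exists r; split=> //; split=> //; split=> e; apply: h'; [left|right].
have [[qq sq] [rr sr]] := (qP, rP).
have [||p pm rp] := IH r _ rP; last 2 first.
- by apply/eqP.
- by exists p => //; rewrite -rp mulrA qr.
move: dq; rewrite ltnS; apply: leq_trans.
have sub : (amull r @: fullv <= amull q @: fullv)%VS.
  apply/subvP=> x /memv_imgP [y _ ->]; apply/memv_imgP; exists (r * y); rewrite ?memvf //.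
  by rewrite !lfunE /= mulrA qr.
have [le ne] := dimv_leqif_sup sub; rewrite ltn_neqAle le andbT ne.
apply/negP => /subvP/(_ q) h; have /h /memv_imgP [y _] : q \in (amull q @: fullv)%VS.
  by apply/memv_imgP; exists q; rewrite ?memvf // lfunE /= qq.
rewrite lfunE /= => qE; have rq' : r * q = q by rewrite {1}qE mulrA rr -qE.
by apply: rq; rewrite -{1}qr -{1}sq -sr -st_mul rq'.
Qed.

Section Decomposition.
Variables (I : finType) (m : I -> A) (P : pred I).
Hypothesis m_min : forall i, P i -> minimal (m i).
Hypothesis m_ineq : forall i j x, P i -> P j -> i != j -> m i * (x * m j) = 0.

Lemma sum_minimal_projection : projection (\sum_(i | P i) m i).
Proof.
have mm i j : P i -> P j -> i != j -> m i * m j = 0.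
  by move=> Pi Pj ij; have := m_ineq 1 Pi Pj ij; rewrite mul1r.
split.
  rewrite mulr_suml; apply: eq_bigr => i Pi; have [[pp _] _ _] := m_min Pi.
  rewrite mulr_sumr (bigD1 i) //= pp big1 ?addr0 // => j /andP[Pj ji].
  by rewrite mm // eq_sym.
rewrite (big_morph st stD st0); apply: eq_bigr => i Pi.
by have [[]] := m_min Pi.
Qed.

Let q := \sum_(i | P i) m i.

Lemma mul_sum_minimal i : P i -> m i * q = m i /\ q * m i = m i.
Proof.
have mm k j : P k -> P j -> k != j -> m k * m j = 0.
  by move=> Pi Pj ij; have := m_ineq 1 Pi Pj ij; rewrite mul1r.
move=> Pi; have [[pp _] _ _] := m_min Pi; split.
  rewrite mulr_sumr (bigD1 i) //= pp big1 ?addr0 // => j /andP[Pj ji].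
  by rewrite mm // eq_sym.
rewrite mulr_suml (bigD1 i) //= pp big1 ?addr0 // => j /andP[Pj ji].
by rewrite mm.
Qed.

End Decomposition.

End StarAlgebra.

(** * Box spaces as algebras, and morphisms between minimal projections *)

Local Open Scope nat_scope.

(** A nonzero loop value makes the identity diagrams nonzero, as the ring structure requires. It is
    derived from the first edge of the graph in [loop_neq0]. *)
Record nondegenerate (R : realType) := Nondegenerate {
  nd_algebra :> planar_star_algebra R;
  nd_subfactor : is_subfactor_planar_algebra nd_algebra;
  nd_loop : loop nd_algebra false != 0%R
}.

(* The box spaces, with their structure of finite-dimensional algebra. *)
Definition tl (R : realType) (P : nondegenerate R) n s : Type := box P (n, s).

Section BoxAlgebra.
Variables (R : realType) (P : nondegenerate R) (n : nat) (s : bool).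
Local Open Scope ring_scope.

HB.instance Definition _ := Vector.copy (tl P n s) (box P (n, s)).

Lemma tl_mulDl (x y z : tl P n s) : mul (x + y) z = mul x z + mul y z.
Proof. by have := mul_linearl 1 x y z; rewrite !scale1r. Qed.
Lemma tl_mulDr (x y z : tl P n s) : mul x (y + z) = mul x y + mul x z.
Proof. by have := mul_linearr 1 x y z; rewrite !scale1r. Qed.
Lemma idn_neq0 : idn P n s != 0.
Proof.
apply/eqP => e; have := trace_idn (nd_subfactor P) n s; rewrite e.
have := trace_linear (-1) (0 : box P (n, s)) 0.
rewrite scaleN1r addNr mulN1r addNr => -> /esym/eqP.
by rewrite expf_eq0 (negPf (nd_loop P)) andbF.
Qed.

HB.instance Definition _ := GRing.Zmodule_isNzRing.Build (tl P n s)
  (@mulA _ P n s) (@mul1x _ P n s) (@mulx1 _ P n s) tl_mulDl tl_mulDr idn_neq0.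

Lemma tl_scalerAl (z : R[i]) (x y : tl P n s) : z *: (x * y) = (z *: x) * y.
Proof.
rewrite -[z *: x]addr0; have := mul_linearl z x 0 y; rewrite /GRing.mul /= => ->.
by rewrite [mul 0 y](mul0r (y : tl P n s)) addr0.
Qed.
HB.instance Definition _ := GRing.Lmodule_isLalgebra.Build R[i] (tl P n s) tl_scalerAl.

Lemma tl_scalerAr (z : R[i]) (x y : tl P n s) : z *: (x * y) = x * (z *: y).
Proof.
rewrite -[z *: y]addr0; have := mul_linearr z x y 0; rewrite /GRing.mul /= => ->.
by rewrite [mul x 0](mulr0 (x : tl P n s)) addr0.
Qed.
HB.instance Definition _ := GRing.Lalgebra_isAlgebra.Build R[i] (tl P n s) tl_scalerAr.
HB.instance Definition _ := Algebra_isFalgebra.Build R[i] (tl P n s).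

End BoxAlgebra.

Section PlainHoms.
Variables (R : realType) (P : planar_star_algebra R).
Implicit Types (s : bool) (m n k a b : nat).
Local Open Scope ring_scope.

Lemma compose_linearl m k n a b r s (ha : a.*2 = (m + k)%N) (hb : b.*2 = (k + n)%N)
    (hr : r.*2 = (m + n)%N) z (x x' : box P (a, s)) (y : box P (b, s)) :
  compose ha hb hr (z *: x + x') y = z *: compose ha hb hr x y + compose ha hb hr x' y.
Proof.
by rewrite -[LHS]bx_vac bx_compose_vac /mor bx_linear ncap_lincomb
  -[compose _ _ _ x y]bx_vac -[compose _ _ _ x' y]bx_vac !bx_compose_vac.
Qed.

Lemma compose_linearr m k n a b r s (ha : a.*2 = (m + k)%N) (hb : b.*2 = (k + n)%N)
    (hr : r.*2 = (m + n)%N) z (x : box P (a, s)) (y y' : box P (b, s)) :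
  compose ha hb hr x (z *: y + y') = z *: compose ha hb hr x y + compose ha hb hr x y'.
Proof.
by rewrite -[LHS]bx_vac bx_compose_vac bx_linear /mor bx_lincomb ncap_lincomb
  -[compose _ _ _ x y]bx_vac -[compose _ _ _ x y']bx_vac !bx_compose_vac.
Qed.

Lemma compose0l m k n a b r s (ha : a.*2 = (m + k)%N) (hb : b.*2 = (k + n)%N)
    (hr : r.*2 = (m + n)%N) (y : box P (b, s)) : compose ha hb hr (0 : box P (a, s)) y = 0.
Proof.
have := compose_linearl ha hb hr (-1) (0 : box P (a, s)) 0 y.
by rewrite scaleN1r addNr scaleN1r addNr.
Qed.

Lemma composeZl m k n a b r s (ha : a.*2 = (m + k)%N) (hb : b.*2 = (k + n)%N)
    (hr : r.*2 = (m + n)%N) z (x : box P (a, s)) (y : box P (b, s)) :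
  compose ha hb hr (z *: x) y = z *: compose ha hb hr x y.
Proof.
by have := compose_linearl ha hb hr z x 0 y; rewrite !addr0 compose0l addr0.
Qed.

Lemma compose0r m k n a b r s (ha : a.*2 = (m + k)%N) (hb : b.*2 = (k + n)%N)
    (hr : r.*2 = (m + n)%N) (x : box P (a, s)) : compose ha hb hr x (0 : box P (b, s)) = 0.
Proof.
have := compose_linearr ha hb hr (-1) x (0 : box P (b, s)) 0.
by rewrite scaleN1r addNr scaleN1r addNr.
Qed.

Lemma composeZr m k n a b r s (ha : a.*2 = (m + k)%N) (hb : b.*2 = (k + n)%N)
    (hr : r.*2 = (m + n)%N) z (x : box P (a, s)) (y : box P (b, s)) :
  compose ha hb hr x (z *: y) = z *: compose ha hb hr x y.
Proof.
by have := compose_linearr ha hb hr z x y 0; rewrite !addr0 compose0r addr0.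
Qed.

Lemma trace0 n s : trace (0 : box P (n, s)) = 0.
Proof. exact: (semilin0 (V := box P (n, s)) (W := R[i]^o) (theta := idfun) (@trace_linear R P n s)). Qed.

Lemma star0 c : star (0 : box P c) = 0.
Proof. exact: (semilin0 (theta := Num.conj) (@star_linear R P c)). Qed.

Section Positivity.
Hypothesis HP : is_subfactor_planar_algebra P.

(** Both traces are the same [pairing], so positivity in the box space carries over to morphisms. *)
Lemma trace_hom m n a s (h : a.*2 = (m + n)%N) (h' : a.*2 = (n + m)%N) (x : box P (a, s)) :
  x != 0 -> 0 < trace (compose h h' (esym (addnn m)) x (star x)).
Proof.
move=> x0; rewrite trace_compose pairingC // -(trace_compose (esym (addnn a)) (esym (addnn a)) (esym (addnn a))).
exact: (trace_positive HP).
Qed.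

Lemma trace_projection_pos n s (p : box P (n, s)) : is_projection p -> p != 0 -> 0 < trace p.
Proof. by move=> [pp sp] /(trace_positive HP); rewrite sp pp. Qed.

End Positivity.

Lemma hom_traceC m n a s (h : a.*2 = (m + n)%N) (h' : a.*2 = (n + m)%N) (x y : box P (a, s)) :
  trace (compose h h' (esym (addnn m)) x y) = trace (compose h' h (esym (addnn n)) y x).
Proof. by rewrite !trace_compose pairingC. Qed.

Lemma equivalent_sym n m s (p : box P (n, s)) (q : box P (m, s)) :
  equivalent p q -> equivalent q p.
Proof.
move=> [a [h [h' [v [vq vp]]]]]; exists a, h', h, (star v); rewrite starK.
by split.
Qed.

Lemma equivalent_refl n s (p : box P (n, s)) : is_projection p -> equivalent p p.
Proof. by move=> [pp sp]; exists n, (esym (addnn n)), (esym (addnn n)), p; rewrite sp. Qed.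

Lemma equivalent_trace n m s (p : box P (n, s)) (q : box P (m, s)) :
  equivalent p q -> trace p = trace q.
Proof. by move=> [a [h [h' [v [<- <-]]]]]; rewrite hom_traceC. Qed.

Section Edges.
Variables (n m : nat) (s : bool) (p : box P (n, s)) (q : box P (m, s)).
Hypotheses (pP : is_projection p) (qP : is_projection q).

Definition intertwiner a (h : a.*2 = (m + n.+1)%N) (x : box P (a, s)) :=
  compose (esym (addnn m)) h h q x = x /\
  compose h (esym (addnn n.+1)) h x (add_right_string p) = x.

(** The map in the definition of the multiplicity is idempotent, so its image consists of its fixed
    points. *)
Lemma edge_multiplicityE a (h : a.*2 = (m + n.+1)%N) :
  exists U : {vspace box P (a, s)}, edge_multiplicity p q = \dim U /\
    forall x, x \in U <-> intertwiner h x.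
Proof.
have ea : a = (m + n.+1)./2%N by rewrite -h doubleK.
subst a; rewrite /edge_multiplicity; case: eqP => [h'|//].
rewrite (eq_irrelevance h' h).
pose f (x : box P ((m + n.+1)./2, s)) : box P ((m + n.+1)./2, s) :=
  compose (esym (addnn m)) h h q (compose h (esym (addnn n.+1)) h x (add_right_string p)).
have lf : linear f by move=> z x y; rewrite /f compose_linearl compose_linearr.
pose fl := GRing.isLinear.Build _ _ _ _ f lf.
pose fL : {linear box P ((m + n.+1)./2, s) -> box P ((m + n.+1)./2, s)} := HB.pack f fl.
exists <<[seq f x | x <- vbasis fullv]>>%VS; split=> // x.
have -> : <<[seq f x | x <- vbasis fullv]>>%VS = (linfun fL @: fullv)%VS.
  rewrite -[X in (_ @: X)%VS](span_basis (vbasisP fullv)) limg_span; congr span.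
  by apply: eq_map => y; rewrite lfunE.
have [qq _] := qP; have [pp _] := pP.
have ii : mul (add_right_string p) (add_right_string p) = add_right_string p.
  by rewrite -iota_mul pp.
split=> [/memv_imgP [y _ ->]|[qx xp]].
- rewrite lfunE /= /f; split.
    by rewrite -(compose_assoc (esym (addnn m)) (esym (addnn m)) h (esym (addnn m)))
         -/(mul q q) qq.
  rewrite (compose_assoc (esym (addnn m)) h (esym (addnn n.+1)) h h).
  rewrite (compose_assoc h (esym (addnn n.+1)) (esym (addnn n.+1)) h (esym (addnn n.+1))).
  by rewrite -/(mul _ _) ii.
- by apply/memv_imgP; exists x; rewrite ?memvf // lfunE /= /f xp qx.
Qed.

End Edges.
End PlainHoms.

Section Homs.
Variables (R : realType) (P : nondegenerate R).
Implicit Types (s : bool) (m n k a b : nat).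
Let HP := nd_subfactor P.
Local Open Scope ring_scope.

Definition tl_star n s : tl P n s -> tl P n s := @star R P (n, s).
Definition tl_trace n s : tl P n s -> R[i] := @trace R P n s.

Lemma tl_star_linear n s z (x y : tl P n s) :
  tl_star (z *: x + y) = z^* *: tl_star x + tl_star y.
Proof. exact: star_linear. Qed.
Lemma tl_star_mul n s (x y : tl P n s) : tl_star (x * y) = tl_star y * tl_star x.
Proof. exact: star_mul. Qed.
Lemma tl_starK n s (x : tl P n s) : tl_star (tl_star x) = x.
Proof. exact: starK. Qed.
Lemma tl_trace_linear n s z (x y : tl P n s) :
  tl_trace (z *: x + y) = z * tl_trace x + tl_trace y.
Proof. exact: trace_linear. Qed.
Lemma tl_trace_pos n s (x : tl P n s) : x != 0 -> 0 < tl_trace (tl_star x * x).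
Proof. exact: (trace_positive HP). Qed.
Lemma tl_trace_mulC n s (x y : tl P n s) : tl_trace (x * y) = tl_trace (y * x).
Proof. exact: trace_mulC. Qed.

Lemma minimalE n s (p : tl P n s) : is_minimal_projection p = minimal (@tl_star n s) p.
Proof. by []. Qed.

Lemma box_corner n s (p x : box P (n, s)) : is_minimal_projection p ->
  exists l, mul p (mul x p) = l *: p.
Proof.
exact: (minimal_corner (st := @tl_star n s) (tr := @tl_trace n s)
  (@tl_star_linear n s) (@tl_star_mul n s) (@tl_starK n s)
  (@tl_trace_linear n s) (@tl_trace_pos n s)).
Qed.

Section Fixed.
Variables (n m a : nat) (s : bool).
Variables (h : a.*2 = (m + n)%N) (h' : a.*2 = (n + m)%N).
Notation "x '\c' y" := (compose (esym (addnn m)) h h x y) (at level 40).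
Notation "x 'c\' y" := (compose h (esym (addnn n)) h x y) (at level 40).
Notation "x '\m' y" := (compose h h' (esym (addnn m)) x y) (at level 40).
Notation "x '\n' y" := (compose h' h (esym (addnn n)) x y) (at level 40).

Lemma star_lcomp (q : box P (m, s)) (x : box P (a, s)) :
  star (q \c x) = compose h' (esym (addnn m)) h' (star x) (star q).
Proof. exact: star_compose. Qed.
Lemma star_rcomp (p : box P (n, s)) (x : box P (a, s)) :
  star (x c\ p) = compose (esym (addnn n)) h' h' (star p) (star x).
Proof. exact: star_compose. Qed.

(** A witness [v] of equivalence need not be cut down by [p] and [q]; its compression is, and
    remains a witness. *)
Lemma equivalent_normal (p : box P (n, s)) (q : box P (m, s)) (v : box P (a, s)) :
  is_projection p -> is_projection q -> v \m star v = q -> star v \n v = p ->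
  exists w : box P (a, s), [/\ q \c w = w, w c\ p = w, w \m star w = q
    & star w \n w = p].
Proof.
move=> [pp sp] [qq sq] vq vp; pose w := q \c v.
have wE : w = v c\ p by rewrite /w -vq -vp; exact: compose_assoc.
have qw : q \c w = w by rewrite /w -[in RHS]qq; symmetry; exact: compose_assoc.
have wp : w c\ p = w.
  by rewrite wE -[in RHS]pp; exact: compose_assoc.
exists w; split=> //.
- rewrite {1}/w star_lcomp sq.
  rewrite (compose_assoc (esym (addnn m)) h h' h (esym (addnn m))).
  rewrite -(compose_assoc h h' (esym (addnn m)) (esym (addnn m)) h') vq.
  by rewrite -/(mul q q) -/(mul q _) !qq.
- rewrite {2}wE wE star_rcomp sp.
  rewrite (compose_assoc (esym (addnn n)) h' h h' (esym (addnn n))).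
  rewrite -(compose_assoc h' h (esym (addnn n)) (esym (addnn n)) h) vp.
  by rewrite -/(mul p p) -/(mul p _) !pp.
Qed.

(** By minimality of [q], [y] times its adjoint is [l *: q], with [l] positive by the trace.
    Dividing [y] by the square root of [l] gives a partial isometry [v]; its initial projection [r]
    is minimal because the corner of [r] is carried into that of [q]. *)
Lemma hom_subprojection (p : box P (n, s)) (q : box P (m, s)) (y : box P (a, s)) :
  is_projection p -> is_minimal_projection q -> q \c y = y -> y c\ p = y -> y != 0 ->
  exists r : box P (n, s), [/\ is_minimal_projection r, mul p r = r, equivalent r q
    & exists c : R[i], star y \n y = c *: r].
Proof.
move=> [pp sp] qm qy yp y0; have [[qq sq] q0 _] := qm.
have yq : y \m star y = mul q (mul (y \m star y) q).
  rewrite -{1 2}qy star_lcomp sq.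
  rewrite (compose_assoc (esym (addnn m)) h h' h (esym (addnn m))).
  by congr mul; symmetry; apply: compose_assoc.
have [l lE] := box_corner (y \m star y) qm.
have {}lE : y \m star y = l *: q by rewrite yq; exact: lE.
have tq := trace_projection_pos HP (conj qq sq) q0.
have l0 : 0 < l.
  have := trace_hom HP h h' y0; rewrite lE -[l *: q]addr0 trace_linear.
  rewrite trace0.
  by rewrite addr0 pmulr_lgt0.
pose v := (sqrtC l)^-1 *: y; have s0 : 0 < (sqrtC l)^-1 by rewrite invr_gt0 sqrtC_gt0.
have sv : star v = (sqrtC l)^-1 *: star y.
  rewrite /v -[_ *: y]addr0 star_linear star0.
  by rewrite addr0 (CrealP (gtr0_real s0)).
have ss : (sqrtC l)^-1 * (sqrtC l)^-1 = l^-1 by rewrite -invfM -expr2 sqrtCK.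
have vv : v \m star v = q.
  by rewrite sv composeZl composeZr scalerA ss lE scalerA mulVf ?scale1r // gt_eqF.
pose r := star v \n v.
have vvE : star v \n v = l^-1 *: (star y \n y).
  by rewrite sv composeZl composeZr scalerA ss.
have qv : q \c v = v by rewrite composeZr qy.
have vp : v c\ p = v by rewrite composeZl yp.
have rr : mul r r = r.
  rewrite /r /mul (compose_assoc h' h (esym (addnn n)) (esym (addnn n)) h).
  by rewrite -(compose_assoc h h' h (esym (addnn m)) (esym (addnn n))) vv qv.
have sr : star r = r.
  by rewrite /r (star_compose _ _ _ h h' (esym (addnn n))) starK.
have tr : trace r = trace q by rewrite -hom_traceC vv.
have r0 : r != 0.
  apply: contraTneq tq => r0; rewrite -tr r0.
  by rewrite trace0 ltxx.
exists r; split.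
- rewrite minimalE; apply: corner_minimal => //; first exact: star_mul.
  move=> x; pose w := compose h (esym (addnn n)) h v x.
  have [c cE] := box_corner (w \m star v) qm; exists c.
  have e1 : mul r (mul x r) = compose h' h (esym (addnn n)) (star v)
      (compose (esym (addnn m)) h h (w \m star v) v).
    rewrite /r {1}/mul (compose_assoc h' h (esym (addnn n)) (esym (addnn n)) h).
    congr compose; rewrite /mul -(compose_assoc h (esym (addnn n)) (esym (addnn n)) h).
    by rewrite -/w (compose_assoc h h' h (esym (addnn m)) (esym (addnn n))).
  have e2 : star v = compose h' (esym (addnn m)) h' (star v) q by rewrite -{1}qv star_lcomp sq.
  move: (w \m star v) cE e1 => X cE e1; rewrite [LHS]e1 e2 -{2}qv.
  rewrite -(compose_assoc (esym (addnn m)) (esym (addnn m)) h (esym (addnn m)) h h).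
  rewrite (compose_assoc h' (esym (addnn m)) h h' h (esym (addnn n))).
  rewrite -(compose_assoc (esym (addnn m)) (esym (addnn m)) h (esym (addnn m)) h h).
  have := cE; rewrite /mul => ->.
  by rewrite composeZl composeZr qv.
- rewrite /r /mul -(compose_assoc (esym (addnn n)) h' h h' (esym (addnn n))).
  by congr compose; rewrite -{2}vp star_rcomp sp.
- by exists a, h, h', v.
- by exists l; rewrite /r vvE scalerA mulfV ?scale1r // gt_eqF.
Qed.

End Fixed.

(** Schur's lemma: the subprojection of [p] supplied by a nonzero morphism must be [p]. *)
Lemma hom_equivalent n m a s (h : a.*2 = (m + n)%N) (p : box P (n, s))
    (q : box P (m, s)) (y : box P (a, s)) :
  is_minimal_projection p -> is_minimal_projection q ->
  compose (esym (addnn m)) h h q y = y -> compose h (esym (addnn n)) h y p = y ->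
  y != 0 -> equivalent p q.
Proof.
move=> pm qm qy yp y0; have h' : a.*2 = (n + m)%N by rewrite h addnC.
have [pP _ pmin] := pm.
have [r [rm pr rq _]] := hom_subprojection h' pP qm qy yp y0.
have [rP r0 _] := rm; have [r0'|<- //] := pmin r rP pr.
by rewrite r0' eqxx in r0.
Qed.

Lemma inequivalent_corner n s (p q x : box P (n, s)) :
  is_minimal_projection p -> is_minimal_projection q -> ~ equivalent p q ->
  mul q (mul x p) = 0.
Proof.
move=> pm qm ne; apply/eqP; apply: contra_notT ne => y0.
have [[[pp _] _ _] [[qq _] _ _]] := (pm, qm).
apply: (hom_equivalent (h := esym (addnn n)) pm qm _ _ y0); rewrite -/(mul _ _).
- by rewrite mulA qq.
- by rewrite -!mulA pp.
Qed.

End Homs.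

(** * Principal graphs *)

Lemma dimv1_scalar (K : fieldType) (V : vectType K) (U : {vspace V}) (x y : V) :
  \dim U <= 1 -> x \in U -> y \in U -> y != 0%R -> exists c, x = (c *: y)%R.
Proof.
move=> dU xU yU y0; have yl : (<[y]> <= U)%VS by rewrite -memvE.
have /eqP e : <[y]>%VS == U by rewrite eqEdim yl dim_vline y0.
by move: xU; rewrite -e => /vlineP.
Qed.

Section Classes.
Variables (R : realType) (P : planar_star_algebra R) (s : bool) (G : pointed_graph).
Hypothesis HP : is_subfactor_planar_algebra P.
Variable phi : minimal_projection P s -> vert G.
Hypotheses (phi_onto : forall v, exists p, phi p = v)
  (phi_eq : forall p q, phi p = phi q <-> equivalent (proj p) (proj q))
  (phi_base : forall p, phi p = base G <-> equivalent (proj p) (empty_diagram P s))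
  (phi_edges : forall p q, edges (phi p) (phi q) = edge_multiplicity (proj p) (proj q))
  (phi_dual : forall p q (ep : ~~ odd (level p)),
     equivalent (rotate_pi ep (proj p)) (proj q) -> phi q = gdual (phi p)).
Local Open Scope ring_scope.

(** The labelling [phi] on bare projections; minimality is part of the relation. *)
Definition cls n (p : box P (n, s)) (u : vert G) :=
  exists h : is_minimal_projection p, phi (MinimalProjection h) = u.

Lemma cls_minimal n (p : box P (n, s)) u : cls p u -> is_minimal_projection p.
Proof. by case. Qed.

Lemma cls_exists n (p : box P (n, s)) : is_minimal_projection p -> exists u, cls p u.
Proof. by move=> h; exists (phi (MinimalProjection h)), h. Qed.

Lemma cls_equiv n m (p : box P (n, s)) (q : box P (m, s)) u v :
  cls p u -> cls q v -> u = v <-> equivalent p q.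
Proof. by move=> [hp <-] [hq <-]; exact: phi_eq. Qed.

Lemma cls_transfer n m (p : box P (n, s)) (q : box P (m, s)) u :
  cls p u -> is_minimal_projection q -> equivalent p q -> cls q u.
Proof. by move=> cp hq e; exists hq; apply/esym; apply/(cls_equiv cp); first by exists hq. Qed.

Lemma cls_rep u : exists n (p : box P (n, s)), cls p u.
Proof. by have [[n p h] e] := phi_onto u; exists n, p, h. Qed.

Lemma cls_edge n m (p : box P (n, s)) (q : box P (m, s)) u v :
  cls p u -> cls q v -> edges u v = edge_multiplicity p q.
Proof. by move=> [hp <-] [hq <-]; exact: phi_edges. Qed.

Lemma cls_dual n (en : ~~ odd n) (p : box P (n, s)) u :
  cls p u -> is_minimal_projection (rotate_pi en p) -> cls (rotate_pi en p) (gdual u).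
Proof.
move=> [hp <-] hq; exists hq; apply: (phi_dual (p := MinimalProjection hp)).
by apply: equivalent_refl; case: hq.
Qed.

Lemma empty_minimal : is_minimal_projection (empty_diagram P s).
Proof.
have e0 : idn P 0 s = empty_diagram P s by rewrite -vacE.
split; last 2 first.
- exact: empty_diagram_neq0.
- move=> q [qq _] _; move: qq; rewrite (box0E HP q) -e0.
  move: (empty_coef q) => c; have := mul_linearl c (idn P 0 s) 0 (c *: idn P 0 s).
  rewrite !addr0 mul1x => ->; have -> : mul (0 : box P (0, s)) (c *: idn P 0 s) = 0.
    exact: compose0l.
  rewrite addr0 scalerA => /eqP; rewrite -subr_eq0 -scalerBl scaler_eq0 e0.
  rewrite (negPf (empty_diagram_neq0 HP s)) orbF -[X in _ - X]mulr1 -mulrBr mulf_eq0 subr_eq0.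
  by case/orP=> /eqP ->; [left; rewrite scale0r|right; rewrite scale1r].
- by split; rewrite -e0 ?mul1x // star_idn.
Qed.

Lemma cls_base : cls (empty_diagram P s) (base G).
Proof.
exists empty_minimal; apply/phi_base; apply: equivalent_refl.
by case: empty_minimal.
Qed.

Lemma edge_parity n m (p : box P (n, s)) (q : box P (m, s)) :
  edge_multiplicity p q <> 0%N -> exists a, a.*2 = (m + n.+1)%N.
Proof. by rewrite /edge_multiplicity; case: eqP => // h _; eexists; exact: h. Qed.

Lemma edge_intertwiner n m (p : box P (n, s)) (q : box P (m, s)) u v :
  cls p u -> cls q v -> edges u v <> 0%N ->
  exists a (h : a.*2 = (m + n.+1)%N) (x : box P (a, s)), intertwiner p q h x /\ x != 0.
Proof.
move=> cp cq; rewrite (cls_edge cp cq) => e0; have [a h] := edge_parity e0.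
have [pP _ _] := cls_minimal cp; have [qP _ _] := cls_minimal cq.
have [U [dU UE]] := edge_multiplicityE pP qP h.
exists a, h, (vpick U); split; first by apply/UE; exact: memv_pick.
by rewrite vpick0; apply/negP => /eqP U0; apply: e0; rewrite dU U0 dimv0.
Qed.

(** A nonzero morphism along the edge shows that the empty diagram with a string added is nonzero;
    the trace of this projection is positive and a multiple of the loop value. *)
Lemma edge_loop_neq0 u : edges (base G) u <> 0%N -> loop P false != 0.
Proof.
have [m [q cq]] := cls_rep u => /(edge_intertwiner cls_base cq) [a [h [x [[_ xp] x0]]]].
have i0 : add_right_string (empty_diagram P s) != 0.
  by apply: contraNneq x0 => i0; rewrite -xp i0 compose0r.
have [[ee se] e0 _] := empty_minimal.
have := trace_projection_pos HP _ i0; rewrite trace_iota // => h'.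
apply: contraTneq (h' _) => [->|]; first by rewrite mul0r ltxx.
by split; rewrite -?iota_mul ?ee // star_iota se.
Qed.

End Classes.

Section Decompositions.
Variables (R : realType) (P : nondegenerate R) (s : bool) (G : pointed_graph).
Let HP := nd_subfactor P.
Variable phi : minimal_projection P s -> vert G.
Hypotheses (phi_onto : forall v, exists p, phi p = v)
  (phi_eq : forall p q, phi p = phi q <-> equivalent (proj p) (proj q))
  (phi_base : forall p, phi p = base G <-> equivalent (proj p) (empty_diagram P s))
  (phi_edges : forall p q, edges (phi p) (phi q) = edge_multiplicity (proj p) (proj q)).
Hypothesis multfree : forall u v, edges (p := G) u v <= 1.
Local Open Scope ring_scope.
Notation cls := (cls phi).

Lemma cls_mul0 n (p q : tl P n s) u v x : cls p u -> cls q v -> u != v -> q * (x * p) = 0.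
Proof.
move=> cp cq /eqP uv; apply: inequivalent_corner (cls_minimal cp) (cls_minimal cq) _ => e.
by apply: uv; apply/(cls_equiv phi_eq cp cq).
Qed.

Lemma iota_projection n (p : box P (n, s)) :
  is_projection p -> is_projection (add_right_string p).
Proof. by case=> pp sp; split; rewrite -?iota_mul ?pp ?star_iota ?sp. Qed.

Lemma projection_above n (i r : tl P n s) : star i = i -> star r = r -> i * r = r -> r * i = r.
Proof. by move=> si sr ir; have := star_mul i r; rewrite [mul _ _]ir si sr => e; exact: esym e. Qed.

(** The space of morphisms along a simple edge is at most one-dimensional. It contains [r'] and a
    partial isometry from [r] to [r'], so these are proportional, which forces the two projections
    to coincide. *)
Lemma below_unique n (p : box P (n, s)) (r r' : tl P n.+1 s) u v :
  cls p u -> cls r v -> cls r' v -> (add_right_string p : tl P n.+1 s) * r = r ->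
  (add_right_string p : tl P n.+1 s) * r' = r' -> r = r'.
Proof.
move=> cp cr cr' pr pr'; have [pP p0 _] := cls_minimal cp.
have [rP r0 _] := cls_minimal cr; have [rP' r0' _] := cls_minimal cr'.
have [ipp sip] := iota_projection pP.
have rp : r * (add_right_string p : tl P n.+1 s) = r.
  by apply: projection_above => //; case: rP.
have rp' : r' * (add_right_string p : tl P n.+1 s) = r'.
  by apply: projection_above => //; case: rP'.
have e : equivalent r r' by apply/(cls_equiv phi_eq cr cr').
have [a [h [h' [v0 [vr' vr]]]]] := e.
have an : a = n.+1 by apply: double_inj; rewrite h addnn.
subst a; have [w [rw wr ww w'w]] := equivalent_normal rP rP' vr' vr.
have {}rw : mul r' w = w by rewrite -[RHS]rw; congr compose; exact: eq_irrelevance.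
have {}wr : mul w r = w by rewrite -[RHS]wr; congr compose; exact: eq_irrelevance.
have {}w'w : mul (star w) w = r by rewrite -[RHS]w'w; congr compose; exact: eq_irrelevance.
have [U [dU UE]] := edge_multiplicityE pP rP' (esym (addnn n.+1)).
have d1 : (\dim U <= 1)%N by rewrite -dU -(cls_edge phi_edges cp cr') multfree.
have wU : w \in U.
  apply/UE; split; first exact: rw.
  by rewrite -/(mul _ _) -{1}wr -mulA [mul r _]rp wr.
have rU : r' \in U by apply/UE; split; [case: rP'|exact: rp'].
have [c wE] := dimv1_scalar d1 wU rU r0'.
have [r'r' sr'] := rP'; have [rr _] := rP.
have rE : r = (c^* * c) *: r'.
  have := w'w; rewrite wE -[c *: r']addr0 star_linear star0 !addr0 sr' => <-.
  have := @tl_scalerAl _ P n.+1 s; rewrite /GRing.mul /= => <-.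
  have := @tl_scalerAr _ P n.+1 s; rewrite /GRing.mul /= => <-.
  by rewrite r'r' scalerA.
have : r * r = r by [].
rewrite {1 2}rE -scalerAl -scalerAr [r' * r']r'r' scalerA => e2.
move: rE e2; set k := c^* * c => rE; rewrite [RHS]rE => /eqP.
rewrite -subr_eq0 -scalerBl scaler_eq0 (negPf r0') orbF -[X in _ - X]mulr1 -mulrBr mulf_eq0.
rewrite subr_eq0 => /orP[|] /eqP k0; last by rewrite rE k0 scale1r.
by move: r0; rewrite rE k0 scale0r eqxx.
Qed.

Lemma below_edge n (p : box P (n, s)) (r : tl P n.+1 s) u v :
  cls p u -> cls r v -> (add_right_string p : tl P n.+1 s) * r = r -> edges u v <> 0%N.
Proof.
move=> cp cr pr; have [pP p0 _] := cls_minimal cp; have [rP r0 _] := cls_minimal cr.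
have [ipp sip] := iota_projection pP.
have rp : r * (add_right_string p : tl P n.+1 s) = r.
  by apply: projection_above => //; case: rP.
have [U [dU UE]] := edge_multiplicityE pP rP (esym (addnn n.+1)).
have rU : r \in U by apply/UE; split; [case: rP|exact: rp].
rewrite (cls_edge phi_edges cp cr) dU => /eqP; rewrite dimv_eq0 => /eqP U0.
by move: rU; rewrite U0 memv0 (negPf r0).
Qed.

Lemma above_edge n (p : box P (n, s)) u v : cls p u -> edges u v <> 0%N ->
  exists r : tl P n.+1 s, cls r v /\ (add_right_string p : tl P n.+1 s) * r = r.
Proof.
move=> cp uv; have [m [q cq]] := cls_rep phi_onto v.
have [a [h [x [[qx xp] x0]]]] := edge_intertwiner phi_edges cp cq uv.
have [pP p0 _] := cls_minimal cp; have h' : a.*2 = (n.+1 + m)%N by rewrite h addnC.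
have [r [rm pr rq _]] := hom_subprojection h' (iota_projection pP) (cls_minimal cq) qx xp x0.
by exists r; split=> //; apply: (cls_transfer phi_eq cq rm); exact: equivalent_sym.
Qed.

(** One subprojection is chosen for each neighbour, and their sum [q] is a projection below that of
    [p] with a string. A nonzero remainder would contain a minimal projection; its class is a
    neighbour of [u], so by [below_unique] it is one of those already in [q]. *)
Lemma iota_decomposition n (p : box P (n, s)) u : cls p u ->
  exists m : vert G -> tl P n.+1 s,
    (forall v, edges u v != 0%N ->
       cls (m v) v /\ (add_right_string p : tl P n.+1 s) * m v = m v) /\
    (add_right_string p : tl P n.+1 s) = \sum_(v | edges u v != 0%N) m v.
Proof.
move=> cp.
have [m mP] : exists m : vert G -> tl P n.+1 s, forall v, edges u v != 0%N ->
    cls (m v) v /\ (add_right_string p : tl P n.+1 s) * m v = m v.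
  suff /choice [m mP] : forall v, exists r : tl P n.+1 s, edges u v != 0%N ->
    cls r v /\ (add_right_string p : tl P n.+1 s) * r = r by exists m.
  move=> v.
  have [e|/negPf ne] := boolP (edges u v != 0%N); last by exists 0; rewrite ?ne.
  by have [r rP] := above_edge cp (elimN eqP e); exists r.
exists m; split=> //; have [pP p0 _] := cls_minimal cp.
have [ipp sip] := iota_projection pP.
have m_min v : edges u v != 0%N -> minimal (@tl_star _ P n.+1 s) (m v).
  by move=> /mP [/cls_minimal].
have m_ineq v w x : edges u v != 0%N -> edges u w != 0%N -> v != w -> m v * (x * m w) = 0.
  by move=> /mP [cv _] /mP [cw _] vw; rewrite (cls_mul0 _ cw cv) // eq_sym.
set q := \sum_(v | _) _.
have [qq sq] : projection (@tl_star _ P n.+1 s) q.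
  exact: (sum_minimal_projection (@tl_star_linear _ P n.+1 s) m_min m_ineq).
set i := (add_right_string p : tl P n.+1 s).
have iq : i * q = q.
  rewrite mulr_sumr; apply: eq_bigr => v /mP [_ e]; exact: e.
have qi : q * i = q.
  by apply: projection_above.
apply/eqP; rewrite -subr_eq0; apply: contraT => z0.
have zP : projection (@tl_star _ P n.+1 s) (i - q).
  split; first by rewrite mulrBl !mulrBr [i * i]ipp iq qi qq subrr subr0.
  rewrite (semilinB (theta := Num.conj) (@tl_star_linear _ P n.+1 s)).
  by rewrite [tl_star i]sip sq.
have [w wm zw] := minimal_below (@tl_star_mul _ P n.+1 s) zP z0.
have iw : i * w = w by rewrite -zw mulrA mulrBr [i * i]ipp iq.
have [v cw] := cls_exists phi (wm : is_minimal_projection w).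
have ev := below_edge cp cw iw.
have evb : edges u v != 0%N by apply/eqP.
have [cm im] := mP v evb; have wE := below_unique cp cw cm iw im.
have [_ w0 _] := wm; move: w0; rewrite -{1}zw mulrBl iw {2}wE.
have [_ ->] := mul_sum_minimal m_min m_ineq evb.
by rewrite wE subrr eqxx.
Qed.

(** The trace is constant on classes, and adding a string multiplies it by the loop value. *)
Lemma class_dimensions : exists D : vert G -> R[i],
  [/\ forall n (p : box P (n, s)) u, cls p u -> trace p = D u,
      forall u, 0 < D u, D (base G) = 1
    & forall u, loop P false * D u = \sum_(v | edges u v != 0%N) D v].
Proof.
have [D DP] : exists D : vert G -> R[i], forall u, exists n (p : box P (n, s)), cls p u /\ trace p = D u.
  suff /choice [D DP] : forall u, exists z n (p : box P (n, s)), cls p u /\ trace p = z.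
    by exists D.
  by move=> u; have [n [p cp]] := cls_rep phi_onto u; exists (trace p), n, p.
have DE n (p : box P (n, s)) u : cls p u -> trace p = D u.
  move=> cp; have [m [q [cq <-]]] := DP u.
  by apply: equivalent_trace; apply/(cls_equiv phi_eq cp cq).
exists D; split=> //.
- move=> u; have [n [p [/cls_minimal [pP p0 _] <-]]] := DP u.
  have h0 := @trace_projection_pos _ _ HP _ _ p pP p0; exact: h0.
- rewrite -(DE _ _ _ (cls_base HP phi_base)) -vacE; have := trace_idn HP 0 s.
  by rewrite expr0.
- move=> u; have [n [p [cp <-]]] := DP u.
  have [m [mP mE]] := iota_decomposition cp.
  rewrite -trace_iota // -[LHS]/(tl_trace (add_right_string p : tl P n.+1 s)) mE.
  rewrite (big_morph (@tl_trace _ P n.+1 s) (id1 := 0) (op1 := +%R)).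
  + by apply: eq_bigr => v /mP [/DE].
  + move=> x y; exact: (semilinD (W := R[i]^o) (theta := idfun) (@tl_trace_linear _ P n.+1 s)).
  + exact: trace0.
Qed.

End Decompositions.

(** * Projections ending in a cup-cap *)

Section CapProjection.
Variables (R : realType) (P : planar_star_algebra R).
Hypothesis HP : is_subfactor_planar_algebra P.
Implicit Types (s : bool) (n : nat).

Section Values.
Variables (n : nat) (s : bool) (x y : box P (n, s)).
Hypotheses (h : n.+1.*2 = n.+2 + n) (h' : n.+1.*2 = n + n.+2).

Lemma cup_between : ncap n.*2.+2 n (bx 0 (add_right_string x) (bx 0 (add_right_string y) (vac P s))) =
  cup n (cup n (bx 0 (mul x y) (vac P s))).
Proof.
have es := es0 s; have d0 := @dg_vac _ P s; have dy := dg_bx_vac y.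
rewrite (bx_iota es d0) // add0n.
have dc : dg n.+1 (cup n (bx 0 y (vac P s))) by exact: dg_cup.
rewrite (bx_iota es dc) // add0n -(@cup_bx _ P s 0 n (n, s)) //=.
have := @ncap_lay _ P s (LCup P) n.*2 n n (cup (n + n.*2) (bx 0 x (bx 0 y (vac P s)))).
rewrite /= subn0 addn2 addn0 => -> //; last by rewrite addnn.
have := @lay_ncap _ P s (LCup P) n.*2 n n (bx 0 x (bx 0 y (vac P s))).
rewrite /= => <- //; last 2 first.
- by rewrite addnn.
- by rewrite -addnn leq_addr.
by rewrite mul_vac /mor add0n.
Qed.

Lemma compose_cup_cap :
  compose h h' (esym (addnn n.+2)) (add_right_string x) (add_right_string y) =
  mul (jones P n.+2 n s) (add_right_string (add_right_string (mul x y))).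
Proof.
have es := es0 s; have d0 := @dg_vac _ P s; have dz := dg_bx_vac (mul x y).
apply: box_inj; rewrite [RHS]mul_vac mor0_jones //; last exact: dg_bx_vac.
rewrite bx_compose_vac /mor add0n cup_between.
rewrite !(bx_iota es d0) //= !add0n (@zigr _ P s n.+1) //; first exact: dg_cup.
by rewrite doubleS -addnn; lia.
Qed.

Lemma compose_cap_cup :
  compose h' h (esym (addnn n)) (add_right_string x) (add_right_string y) =
  (loop P false *: mul x y)%R.
Proof.
have es := es0 s; have d0 := @dg_vac _ P s; have dz := dg_bx_vac (mul x y).
apply: box_inj; rewrite bx_compose_vac /mor add0n bx_scal doubleS -(addn2 n).
rewrite -(@ncap_add _ P s) cup_between /=.
have -> : n.*2.+2 - n = n.+2 by rewrite -addnn; lia.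
have dc : dg n.+1 (cup n (bx 0 (mul x y) (vac P s))) by exact: dg_cup.
rewrite (@zigl _ P s n.+1) //; last by rewrite doubleS -addnn; lia.
by rewrite (cap_cup_same HP dz) // -addnn leq_addr.
Qed.

End Values.

(** [x] with one string added, read as a morphism between [n] and [n.+2] strings, is a partial
    isometry up to normalisation. *)
Lemma cap_equivalent n s (x : box P (n, s)) : (0 < loop P false)%R ->
  is_projection x ->
  equivalent ((loop P false)^-1 *: mul (jones P n.+2 n s) (add_right_string (add_right_string x)))%R x.
Proof.
move=> lp [xx sx]; have l0 : (loop P false != 0)%R by rewrite gt_eqF.
have h : n.+1.*2 = n.+2 + n by rewrite doubleS -addnn; lia.
have h' : n.+1.*2 = n + n.+2 by rewrite h addnC.
have ss : ((sqrtC (loop P false))^-1 * (sqrtC (loop P false))^-1)%R = (loop P false)^-1%R.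
  by rewrite -invfM -expr2 sqrtCK.
pose v := ((sqrtC (loop P false))^-1 *: add_right_string x)%R.
have sv : star v = v.
  rewrite /v (semilinZ (theta := Num.conj) (@star_linear R P _)) star_iota sx /=.
  by rewrite geC0_conj // invr_ge0 sqrtC_ge0 ltW.
exists n.+1, h', h, v; rewrite sv; split.
- by rewrite composeZl composeZr compose_cap_cup xx !scalerA ss mulVf ?scale1r.
- by rewrite composeZl composeZr compose_cup_cap xx !scalerA ss.
Qed.

End CapProjection.

Section Basics.
Variables (R : realType) (P : nondegenerate R).
Implicit Types (s : bool) (n : nat).
Let HP := nd_subfactor P.
Local Open Scope ring_scope.
Notation delta := (loop P false).

(** Positions start at 0: in the 4-box space [E 4 0], [E 4 1], [E 4 2] are the [e1], [e2], [e3] of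
    [level_four]. *)
Definition E n i s : tl P n s := jones P n i s.
Definition iota_ n s (x : tl P n s) : tl P n.+1 s := add_right_string x.
Definition lam_ n s (x : tl P n (~~ s)) : tl P n.+1 s := lam s x.

Lemma loop_gt0 : 0 < delta.
Proof.
have := @tl_trace_pos _ P 1 false 1 (oner_neq0 _).
have -> : tl_star (1 : tl P 1 false) = 1 by exact: star_idn.
by rewrite mulr1.
Qed.

Lemma iotaM n s (x y : tl P n s) : iota_ (x * y) = iota_ x * iota_ y.
Proof. exact: iota_mul. Qed.
Lemma iota1 n s : iota_ (1 : tl P n s) = 1. Proof. exact: iota_idn. Qed.
Lemma iota_lin n s z (x y : tl P n s) : iota_ (z *: x + y) = z *: iota_ x + iota_ y.
Proof. exact: iota_linear. Qed.
Lemma iotaD n s (x y : tl P n s) : iota_ (x + y) = iota_ x + iota_ y.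
Proof. exact: (semilinD (theta := idfun) (@iota_lin n s)). Qed.
Lemma iotaZ n s z (x : tl P n s) : iota_ (z *: x) = z *: iota_ x.
Proof. exact: (semilinZ (theta := idfun) (@iota_lin n s)). Qed.
Lemma iotaB n s (x y : tl P n s) : iota_ (x - y) = iota_ x - iota_ y.
Proof. exact: (semilinB (theta := idfun) (@iota_lin n s)). Qed.
Lemma iotaE n i s : (i.+1 < n)%N -> iota_ (E n i s) = E n.+1 i s.
Proof. exact: iota_jones. Qed.
Lemma lamM n s (x y : tl P n (~~ s)) : lam_ (x * y) = lam_ x * lam_ y.
Proof. exact: lam_mul. Qed.
Lemma lam1 n s : lam_ (1 : tl P n (~~ s)) = 1. Proof. exact: lam_idn. Qed.
Lemma lam_lin n s z (x y : tl P n (~~ s)) : lam_ (z *: x + y) = z *: lam_ x + lam_ y.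
Proof. exact: lam_linear. Qed.
Lemma lamD n s (x y : tl P n (~~ s)) : lam_ (x + y) = lam_ x + lam_ y.
Proof. exact: (semilinD (theta := idfun) (@lam_lin n s)). Qed.
Lemma lamZ n s z (x : tl P n (~~ s)) : lam_ (z *: x) = z *: lam_ x.
Proof. exact: (semilinZ (theta := idfun) (@lam_lin n s)). Qed.
Lemma lamB n s (x y : tl P n (~~ s)) : lam_ (x - y) = lam_ x - lam_ y.
Proof. exact: (semilinB (theta := idfun) (@lam_lin n s)). Qed.
Lemma lamE n i s : (i.+1 < n)%N -> lam_ (E n i (~~ s)) = E n.+1 i.+1 s.
Proof. by move=> h; exact: lam_jones. Qed.

Lemma starD n s (x y : tl P n s) : tl_star (x + y) = tl_star x + tl_star y.
Proof. exact: (semilinD (theta := Num.conj) (@tl_star_linear _ P n s)). Qed.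
Lemma starZ n s z (x : tl P n s) : tl_star (z *: x) = z^* *: tl_star x.
Proof. exact: (semilinZ (theta := Num.conj) (@tl_star_linear _ P n s)). Qed.
Lemma starB n s (x y : tl P n s) : tl_star (x - y) = tl_star x - tl_star y.
Proof. exact: (semilinB (theta := Num.conj) (@tl_star_linear _ P n s)). Qed.
Lemma star1 n s : tl_star (1 : tl P n s) = 1. Proof. exact: star_idn. Qed.
Lemma starE n i s : (i.+1 < n)%N -> tl_star (E n i s) = E n i s.
Proof. exact: star_jones. Qed.
Lemma star_iota_ n s (x : tl P n s) : tl_star (iota_ x) = iota_ (tl_star x).
Proof. exact: star_iota. Qed.
Lemma star_lam_ n s (x : tl P n (~~ s)) : tl_star (lam_ x) = lam_ (tl_star x).
Proof. exact: star_lam. Qed.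

Lemma EE n i s : (i.+1 < n)%N -> E n i s * E n i s = delta *: E n i s.
Proof. exact: (jones_sq HP). Qed.
Lemma EEE n i s : (i.+2 < n)%N -> E n i s * (E n i.+1 s * E n i s) = E n i s.
Proof. exact: jones_braid. Qed.
Lemma EEE' n i s : (i.+2 < n)%N -> E n i.+1 s * (E n i s * E n i.+1 s) = E n i.+1 s.
Proof. exact: jones_braid'. Qed.

Lemma trD n s (x y : tl P n s) : tl_trace (x + y) = tl_trace x + tl_trace y.
Proof. exact: (semilinD (W := R[i]^o) (theta := idfun) (@tl_trace_linear _ P n s)). Qed.
Lemma trZ n s z (x : tl P n s) : tl_trace (z *: x) = z * tl_trace x.
Proof. exact: (semilinZ (W := R[i]^o) (theta := idfun) (@tl_trace_linear _ P n s)). Qed.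
Lemma trB n s (x y : tl P n s) : tl_trace (x - y) = tl_trace x - tl_trace y.
Proof. exact: (semilinB (W := R[i]^o) (theta := idfun) (@tl_trace_linear _ P n s)). Qed.
Lemma tr0 n s : tl_trace (0 : tl P n s) = 0. Proof. exact: trace0. Qed.
Lemma tr1 n s : tl_trace (1 : tl P n s) = delta ^+ n.
Proof. exact: (trace_idn HP). Qed.
Lemma tr_iota n s (x : tl P n s) : tl_trace (iota_ x) = delta * tl_trace x.
Proof. exact: (trace_iota HP). Qed.
Lemma tr_E_iota n s (x : tl P n.+1 s) : tl_trace (E n.+2 n s * iota_ x) = tl_trace x.
Proof. exact: trace_jones_iota. Qed.
Lemma tr_Elast n s : tl_trace (E n.+2 n s) = delta ^+ n.+1.
Proof. by rewrite -[E _ _ _]mulr1 -iota1 tr_E_iota tr1. Qed.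

Lemma loop_real : delta^* = delta. Proof. by rewrite geC0_conj // ltW // loop_gt0. Qed.

Lemma E_iota2 n s (x : tl P n s) :
  is_projection (x : box P (n, s)) ->
  is_projection (delta^-1 *: (E n.+2 n s * iota_ (iota_ x)) : box P (n.+2, s)).
Proof.
move=> [xx sx]; have h : n.+1.*2 = (n.+2 + n)%N by rewrite doubleS -addnn; lia.
have h' : n.+1.*2 = (n + n.+2)%N by rewrite h addnC.
have e := compose_cup_cap (x : box P (n, s)) x h h'; rewrite xx in e.
have st : tl_star (E n.+2 n s * iota_ (iota_ x)) = E n.+2 n s * iota_ (iota_ x).
  rewrite [E _ _ _ * _](esym e) /tl_star (star_compose _ _ _ h' h (esym (addnn n.+2))).
  by rewrite star_iota sx.
have cm : iota_ (iota_ x) * E n.+2 n s = E n.+2 n s * iota_ (iota_ x).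
  move: st; rewrite tl_star_mul starE // !star_iota_.
  by rewrite [tl_star x](sx : tl_star x = x).
split; last by rewrite -[LHS]/(tl_star _) starZ st fmorphV /= loop_real.
have EEx : (E n.+2 n s * iota_ (iota_ x)) * (E n.+2 n s * iota_ (iota_ x)) =
    delta *: (E n.+2 n s * iota_ (iota_ x)).
  rewrite -mulrA [iota_ _ * (_ * _)]mulrA cm -!mulrA -!iotaM [x * x]xx mulrA EE //.
  by rewrite -scalerAl.
change (delta^-1 *: (E n.+2 n s * iota_ (iota_ x)) * (delta^-1 *: (E n.+2 n s * iota_ (iota_ x)))
  = delta^-1 *: (E n.+2 n s * iota_ (iota_ x))).
rewrite -scalerAl -scalerAr EEx !scalerA divfK //; exact: (nd_loop P).
Qed.

(** [r - m] is a projection of trace 0, so it vanishes by positivity. *)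
Lemma projection_eq n s (r m : tl P n s) : is_projection (r : box P (n, s)) ->
  is_projection (m : box P (n, s)) -> r * m = m -> tl_trace r = tl_trace m -> r = m.
Proof.
move=> [rr sr] [mm sm] rm tt; have mr := projection_above sr sm rm.
apply/eqP; rewrite -subr_eq0; apply: contraT => /tl_trace_pos.
rewrite starB [tl_star r]sr [tl_star m]sm mulrBl !mulrBr [r * r]rr rm mr [m * m]mm.
by rewrite subrr subr0 trB tt subrr ltxx.
Qed.

Lemma equivalent_minimal n m s (t : tl P n s) (p : box P (m, s)) :
  is_projection (t : box P (n, s)) -> is_minimal_projection p -> equivalent t p ->
  is_minimal_projection (t : box P (n, s)).
Proof.
move=> tP pm [a [h [h' [v [vp vt]]]]]; have [pP p0 _] := pm.
have [w [pw wt ww w'w]] := equivalent_normal tP pP vp vt.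
have w0 : w != 0 by apply: contraNneq p0 => w0; rewrite -ww w0 compose0l.
have [r [rm tr rp [c cE]]] := hom_subprojection h' tP pm pw wt w0.
have [[rr sr] r0 _] := rm.
suff -> : t = r by [].
have tE : t = c *: r :> box P (n, s) by rewrite -w'w cE.
by rewrite -[RHS]tr tE /mul composeZl -/(mul r r) rr.
Qed.

End Basics.

(** * The uncappable element of the 3-box space *)

Section Sides.
Variables (R : realType) (P : nondegenerate R).
Let HP := nd_subfactor P.
Local Open Scope ring_scope.
Notation delta := (loop P false).
Notation d := (delta ^+ 2 - 1).

Definition jw2 s : tl P 2 s := 1 - delta^-1 *: E P 2 0 s.
Definition jw3 s : tl P 3 s := 1 - (delta / d) *: (E P 3 0 s + E P 3 1 s)
  + d^-1 *: (E P 3 0 s * E P 3 1 s + E P 3 1 s * E P 3 0 s).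

(** What the graph contributes to the 3-box space of one shading, with the graph removed. The last
    fields reflect that [E P 3 0 s] is a multiple of a minimal projection of depth 1, inequivalent
    to [p] and [q]. *)
Record side s (p q : tl P 3 s) : Prop := Side {
  side_p : is_minimal_projection (p : box P (3, s));
  side_q : is_minimal_projection (q : box P (3, s));
  side_pq : forall x, p * (x * q) = 0;
  side_qp : forall x, q * (x * p) = 0;
  side_jw3 : jw3 s = p + q;
  side_trace : tl_trace p = tl_trace q;
  side_E0p : forall x, E P 3 0 s * (x * p) = 0;
  side_E0q : forall x, E P 3 0 s * (x * q) = 0;
  side_E0 : forall x, exists c, E P 3 0 s * (x * E P 3 0 s) = c *: E P 3 0 s
}.

Section FromGraph.
Variables (s : bool) (G : pointed_graph).
Variable phi : minimal_projection P s -> vert G.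
Hypotheses (phi_onto : forall v, exists p, phi p = v)
  (phi_eq : forall p q, phi p = phi q <-> equivalent (proj p) (proj q))
  (phi_base : forall p, phi p = base G <-> equivalent (proj p) (empty_diagram P s))
  (phi_edges : forall p q, edges (phi p) (phi q) = edge_multiplicity (proj p) (proj q)).
Hypothesis multfree : forall u v, (edges (p := G) u v <= 1)%N.
Notation cls := (cls phi).
Variables v1 v2 v3 v4 : vert G.
Hypotheses (edges0 : forall u, (edges (base G) u != 0%N) = (u == v1))
  (edges1 : forall u, (edges v1 u != 0%N) = (u == base G) || (u == v2))
  (edges2 : forall u, (edges v2 u != 0%N) = [|| u == v1, u == v3 | u == v4])
  (vu : uniq [:: base G; v1; v2; v3; v4]).
Variable D : vert G -> R[i].
Hypotheses (DE : forall n (p : box P (n, s)) u, cls p u -> trace p = D u)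
  (D2 : D v2 = d) (D34 : D v3 + D v4 = delta * (delta ^+ 2 - 2)) (D3 : D v3 = D v4).
Hypothesis d_neq0 : d != 0.

Let l0 : delta != 0. Proof. exact: nd_loop. Qed.

Lemma cls_idn1 : cls (idn P 1 s) v1.
Proof.
have c0 := cls_base HP phi_base.
have [m [mP mE]] := iota_decomposition phi_onto phi_eq phi_edges multfree c0.
have [c1 _] := mP v1 (etrans (edges0 v1) (eqxx _)).
suff e : m v1 = 1 by rewrite -[idn P 1 s]/(1 : tl P 1 s) -e.
rewrite -(iota1 P 0 s) /iota_ -[(1 : tl P 0 s)]/(idn P 0 s) [idn P 0 s](vacE P s) mE.
by rewrite (eq_bigl _ _ edges0) big_pred1_eq.
Qed.

Lemma cls_cap n (x : box P (n, s)) u : cls x u ->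
  cls (delta^-1 *: (E P n.+2 n s * iota_ (iota_ x)) : box P (n.+2, s)) u.
Proof.
move=> cx; have xm := cls_minimal cx; have [xP _ _] := xm.
have tP := E_iota2 xP; have e := cap_equivalent HP (loop_gt0 P) xP.
have tm := equivalent_minimal tP xm e.
by apply: (cls_transfer phi_eq cx tm); exact: equivalent_sym.
Qed.

Lemma jw2_E : jw2 s * E P 2 0 s = 0.
Proof. by rewrite mulrBl mul1r -scalerAl EE // scalerA mulVf // scale1r subrr. Qed.
Lemma star_jw2 : tl_star (jw2 s) = jw2 s.
Proof. by rewrite starB star1 starZ starE // fmorphV /= loop_real. Qed.
Lemma E_jw2 : E P 2 0 s * jw2 s = 0.
Proof. by rewrite mulrBr mulr1 -scalerAr EE // scalerA mulVf // scale1r subrr. Qed.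

(** The subprojection of class [v2] is annihilated by the cup-cap, whose class is the base. Hence it
    lies below [jw2 s], and equality of traces makes the two equal. *)
Lemma cls_jw2 : cls (jw2 s : box P (2, s)) v2.
Proof.
have c0 := cls_base HP phi_base; have := cls_cap c0.
have -> : iota_ (iota_ (empty_diagram P s : tl P 0 s)) = 1.
  by rewrite -vacE -[vac P s 0]/(1 : tl P 0 s) !iota1.
rewrite mulr1 => cE.
have e12 : edges v1 v2 <> 0%N by apply/eqP; rewrite edges1 eqxx orbT.
have [r [cr rr]] := above_edge phi_onto phi_eq phi_edges cls_idn1 e12.
have [rP _ _] := cls_minimal cr.
have ne : base G != v2 by move: vu; rewrite /= !inE !negb_or; case/and5P => /and4P[].
have rE0 : E P 2 0 s * r = 0.
  have := cls_mul0 phi_eq 1 cr cE; rewrite eq_sym => /(_ ne).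
  rewrite mul1r -scalerAl => /eqP; rewrite scaler_eq0 invr_eq0 (negPf l0) /=.
  by move/eqP.
have jr : jw2 s * r = r by rewrite mulrBl mul1r -scalerAl rE0 scaler0 subr0.
have jj : jw2 s * jw2 s = jw2 s.
  by rewrite {2}/jw2 mulrBr mulr1 -scalerAr jw2_E scaler0 subr0.
suff -> : jw2 s = r by [].
apply: projection_eq => //; first by split; [exact: jj|exact: star_jw2].
rewrite [RHS](DE cr) D2 /jw2 trB trZ tr1 tr_Elast expr1 expr2.
by rewrite mulVf.
Qed.

Lemma E_jw3 i : (i < 2)%N -> E P 3 i s * jw3 s = 0.
Proof.
case: i => [|[|//]] _.
- exact: (jw_kill d_neq0 (@EE _ P 3 0 s isT) (@EEE _ P 3 0 s isT)).
- apply: (jw_kill d_neq0 (@EE _ P 3 1 s isT) (@EEE' _ P 3 0 s isT)).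
  by rewrite /jw3 [E P 3 0 s + _]addrC [E P 3 0 s * _ + _]addrC.
Qed.

Lemma star_jw3 : tl_star (jw3 s) = jw3 s.
Proof.
have dr : d^* = d by rewrite rmorphB rmorphXn /= loop_real conjC1.
rewrite /jw3 starD starB star1 !starZ !starD !tl_star_mul !starE // rmorphM !fmorphV /=.
by rewrite loop_real dr [E P 3 1 s * _ + _]addrC.
Qed.

Lemma jw3_E i : (i < 2)%N -> jw3 s * E P 3 i s = 0.
Proof.
move=> hi; have hi' : (i.+1 < 3)%N by [].
rewrite -(starE P s hi') -star_jw3 -tl_star_mul E_jw3 //.
exact: (semilin0 (theta := Num.conj) (@tl_star_linear _ P 3 s)).
Qed.

Lemma jw3_mul x : E P 3 0 s * x = 0 -> E P 3 1 s * x = 0 -> jw3 s * x = x.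
Proof.
move=> h0 h1; rewrite mulrDl mulrBl mul1r -!scalerAl !mulrDl -!mulrA h0 h1 !mulr0.
by rewrite !addr0 !scaler0 subr0 addr0.
Qed.

Lemma tr_jw3 : tl_trace (jw3 s) = delta * (delta ^+ 2 - 2).
Proof.
have t0 : tl_trace (E P 3 0 s) = delta ^+ 2.
  by rewrite -(@iotaE _ P 2 0 s isT) tr_iota tr_Elast expr1.
have t1 : tl_trace (E P 3 1 s * E P 3 0 s) = delta.
  by rewrite -(@iotaE _ P 2 0 s isT) tr_E_iota tr_Elast.
rewrite /jw3 trD trB !trZ !trD tr1 tr_Elast t0 t1 tl_trace_mulC t1.
by move: d_neq0 => h; field.
Qed.

(** [p] and [q] are the subprojections of classes [v3] and [v4] of [jw2 s] with a string added. Both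
    cup-caps annihilate them, so their sum lies below [jw3 s]; the traces agree. *)
Lemma side_exists : exists p q : tl P 3 s, side p q /\ cls p v3 /\ cls q v4.
Proof.
have e23 : edges v2 v3 <> 0%N by apply/eqP; rewrite edges2 eqxx orbT.
have e24 : edges v2 v4 <> 0%N by apply/eqP; rewrite edges2 eqxx !orbT.
have [p [cp pp]] := above_edge phi_onto phi_eq phi_edges cls_jw2 e23.
have [q [cq qq]] := above_edge phi_onto phi_eq phi_edges cls_jw2 e24.
have c1 := cls_cap cls_idn1.
have i1 : iota_ (iota_ (idn P 1 s : tl P 1 s)) = 1 by rewrite -[idn P 1 s]/(1 : tl P 1 s) !iota1.
rewrite i1 mulr1 in c1.
have [pP p0 _] := cls_minimal cp; have [qP q0 _] := cls_minimal cq.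
have [n13 n14] : v3 != v1 /\ v4 != v1.
  by move: vu; rewrite /= !inE !negb_or ![v1 == _]eq_sym; case/and5P => _ /and3P[].
have n34 : v3 != v4 by move: vu; rewrite /= !inE; case/and5P.
have kill r v : cls r v -> v != v1 -> (add_right_string (jw2 s) : tl P 3 s) * r = r ->
    E P 3 0 s * r = 0 /\ E P 3 1 s * r = 0.
  move=> cr vv jr; split.
    by rewrite -jr mulrA -(@iotaE _ P 2 0 s isT) -iotaM E_jw2
      -(subrr (1 : tl P 2 s)) iotaB subrr mul0r.
  have := cls_mul0 phi_eq 1 cr c1 vv; rewrite mul1r -scalerAl => /eqP.
  by rewrite scaler_eq0 invr_eq0 (negPf l0) => /eqP.
have [p0' p1'] := kill _ _ cp n13 pp; have [q0' q1'] := kill _ _ cq n14 qq.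
have pq x : p * (x * q) = 0 by apply: (cls_mul0 phi_eq x cq cp); rewrite eq_sym.
have qp x : q * (x * p) = 0 by exact: (cls_mul0 phi_eq x cp cq).
have jE : jw3 s = p + q.
  apply: projection_eq.
  - split; last exact: star_jw3.
    apply: (jw3_mul (x := jw3 s)); exact: E_jw3.
  - have [ppp spp] := pP; have [qqq sqq] := qP.
    split; last by rewrite -[LHS]/(tl_star (p + q)) starD [tl_star p]spp [tl_star q]sqq.
    have e1 : p * q = 0 by have := pq 1; rewrite mul1r.
    have e2 : q * p = 0 by have := qp 1; rewrite mul1r.
    rewrite -[LHS]/((p + q) * (p + q)) mulrDl !mulrDr e1 e2 [p * p]ppp [q * q]qqq.
    by rewrite addr0 add0r.
  - by rewrite mulrDr !jw3_mul.
  - by rewrite tr_jw3 trD [tl_trace p](DE cp) [tl_trace q](DE cq) D34.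
exists p, q; split=> //.
have e01 : edges (base G) v1 <> 0%N by apply/eqP; rewrite edges0 eqxx.
have c0 : cls (delta^-1 *: E P 2 0 s : box P (2, s)) (base G).
  have := cls_cap (cls_base HP phi_base).
  have -> : iota_ (iota_ (empty_diagram P s : tl P 0 s)) = 1.
    by rewrite -vacE -[vac P s 0]/(1 : tl P 0 s) !iota1.
  by rewrite mulr1.
(* This projection is the cup-cap of the 2-box space, of base class, with a string added; [v1] is
   the only neighbour of the base. *)
have cE : cls (delta^-1 *: E P 3 0 s : box P (3, s)) v1.
  have [m [mP mE]] := iota_decomposition phi_onto phi_eq phi_edges multfree c0.
  have [cm _] := mP v1 (etrans (edges0 v1) (eqxx _)).
  suff <- : m v1 = delta^-1 *: E P 3 0 s by [].
  rewrite -(@iotaE _ P 2 0 s isT) -iotaZ [iota_ _]mE.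
  by rewrite (eq_bigl _ _ edges0) big_pred1_eq.
have E0 (r : tl P 3 s) v x : cls r v -> v != v1 -> E P 3 0 s * (x * r) = 0.
  move=> cr vv; have := cls_mul0 phi_eq x cr cE vv; rewrite -scalerAl => /eqP.
  by rewrite scaler_eq0 invr_eq0 (negPf l0) => /eqP.
split=> //.
- exact: cls_minimal cp.
- exact: cls_minimal cq.
- by rewrite [LHS](DE cp) [RHS](DE cq).
- by move=> x; exact: E0 cp n13.
- by move=> x; exact: E0 cq n14.
- move=> x; have [c e] := box_corner (x : box P (3, s)) (cls_minimal cE).
  exists (c * delta); move: e; rewrite -[mul _ _]/((delta^-1 *: E P 3 0 s) * (x * (delta^-1 *: E P 3 0 s))).
  rewrite -scalerAl -!scalerAr !scalerA => e.
  have dd : delta^-1 * delta^-1 != 0 by rewrite mulf_neq0 ?invr_eq0.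
  apply: (scalerI dd); rewrite e !scalerA; congr (_ *: _); field; exact: l0.
Qed.

End FromGraph.
End Sides.

(** * Clicks of 3-boxes and the scalar [sigma] *)

Section Rotation.
Variables (R : realType) (P : nondegenerate R).
Let HP := nd_subfactor P.
Local Open Scope ring_scope.
Notation delta := (loop P false).
Notation d := (delta ^+ 2 - 1).
Notation E := (E P).

(** The Markov property turns the hypothesis into the vanishing of the trace of [w] times its
    adjoint. *)
Lemma E_iota_eq0 n s (w : tl P n.+1 s) : E n.+2 n s * iota_ w = 0 -> w = 0.
Proof.
move=> h; apply/eqP; apply: contraT => w0.
have s0 : tl_star w != 0.
  by apply: contraNneq w0 => e; rewrite -[w]tl_starK e (semilin0 (theta := Num.conj) (@tl_star_linear _ P n.+1 s)).
have := tl_trace_pos s0; rewrite tl_starK -tr_E_iota iotaM mulrA h mul0r tr0.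
by rewrite ltxx.
Qed.

Lemma star0_ n s : tl_star (0 : tl P n s) = 0.
Proof. exact: (semilin0 (theta := Num.conj) (@tl_star_linear _ P n s)). Qed.

Lemma lam0 n s : lam_ (0 : tl P n (~~ s)) = 0.
Proof. exact: (semilin0 (theta := idfun) (@lam_lin _ P n s)). Qed.

Definition rl n s u (x : tl P n u) : tl P n s := rotl s x.
Definition rr n s u (x : tl P n u) : tl P n s := rotr s x.

Lemma rl_lin n s u z (x y : tl P n u) : rl s (z *: x + y) = z *: rl s x + rl s y.
Proof. exact: rotl_linear. Qed.
Lemma rr_lin n s u z (x y : tl P n u) : rr s (z *: x + y) = z *: rr s x + rr s y.
Proof. exact: rotr_linear. Qed.
Lemma rlZ n s u z (x : tl P n u) : rl s (z *: x) = z *: rl s x.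
Proof. exact: (semilinZ (theta := idfun) (@rl_lin n s u)). Qed.
Lemma rrZ n s u z (x : tl P n u) : rr s (z *: x) = z *: rr s x.
Proof. exact: (semilinZ (theta := idfun) (@rr_lin n s u)). Qed.
Lemma rlD n s u (x y : tl P n u) : rl s (x + y) = rl s x + rl s y.
Proof. exact: (semilinD (theta := idfun) (@rl_lin n s u)). Qed.
Lemma rlB n s u (x y : tl P n u) : rl s (x - y) = rl s x - rl s y.
Proof. exact: (semilinB (theta := idfun) (@rl_lin n s u)). Qed.
Lemma star_rl n s (x : tl P n (~~ s)) : tl_star (rl s x) = rr s (tl_star x).
Proof. exact: star_rotl. Qed.
Lemma star_rr n s (x : tl P n (~~ s)) : tl_star (rr s x) = rl s (tl_star x).
Proof. exact: star_rotr. Qed.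

Lemma tr_rot n s (x y : tl P n.+1 (~~ s)) : tl_trace (rl s x * rr s y) = tl_trace (x * y).
Proof. exact: (trace_rot HP). Qed.

Lemma rl1_3 s u : u = ~~ s -> rl s (1 : tl P 3 u) = E 3 0 s * E 3 1 s.
Proof.
move=> eu; have := @rotl_iota R P 1 u s (idn P 2 u) (E 3 0 s * E 3 1 s) eu.
rewrite iota_idn (lam_idn P 2 eu) => h; rewrite [LHS]h; first exact: mul1x.
move=> f df; rewrite mor0_mul // !mor0_jones //; last exact: dg_cupcap.
by rewrite (zigr (dg_cap 1 df)).
Qed.

Lemma slide_rr s (x : tl P 3 (~~ s)) :
  E 4 2 s * (E 4 1 s * (E 4 0 s * lam_ x)) = E 4 2 s * iota_ (rr s x).
Proof. exact: jones3_lam. Qed.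

(** By [slide_rr], an annihilation of [x] is carried through three cup-caps to its rotation; the
    position moves up by one here and down by one in [rr_left_kill]. *)
Lemma rr_right_kill s (x : tl P 3 (~~ s)) : x * E 3 0 (~~ s) = 0 -> rr s x * E 3 1 s = 0.
Proof.
move=> h; apply: E_iota_eq0; rewrite iotaM mulrA -slide_rr (@iotaE _ P 3 1 s isT).
by rewrite -(@lamE _ P 3 0 s isT) -!mulrA -lamM h lam0 !mulr0.
Qed.

Lemma rr_left_kill s (x : tl P 3 (~~ s)) : E 3 1 (~~ s) * x = 0 -> E 3 0 s * rr s x = 0.
Proof.
move=> h; have c02 : E 4 2 s * E 4 0 s = E 4 0 s * E 4 2 s by symmetry; exact: jones_far.
apply: E_iota_eq0; rewrite iotaM (@iotaE _ P 3 0 s isT) mulrA c02 -mulrA -slide_rr.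
rewrite (mulrA (E 4 0 s)) -c02 -mulrA (pull3 (@EEE _ P 4 0 s isT)) mulrA c02.
by rewrite -(@lamE _ P 3 1 s isT) -mulrA -lamM h lam0 mulr0.
Qed.

Definition rp n s u (x : tl P n u) : tl P n s := rotpi s x.

Lemma rp_lin n s u z (x y : tl P n u) : rp s (z *: x + y) = z *: rp s x + rp s y.
Proof. exact: rotpi_linear. Qed.
Lemma rpZ n s u z (x : tl P n u) : rp s (z *: x) = z *: rp s x.
Proof. exact: (semilinZ (theta := idfun) (@rp_lin n s u)). Qed.
Lemma rpD n s u (x y : tl P n u) : rp s (x + y) = rp s x + rp s y.
Proof. exact: (semilinD (theta := idfun) (@rp_lin n s u)). Qed.
Lemma rpB n s u (x y : tl P n u) : rp s (x - y) = rp s x - rp s y.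
Proof. exact: (semilinB (theta := idfun) (@rp_lin n s u)). Qed.

Lemma rp_E2 s : rp s (E 2 0 s) = E 2 0 s.
Proof.
have d0 := @dg_vac _ P s; have d2 : dg 2 (ncup 0 2 (vac P s)).
  by have := @dg_ncup _ P s 0 0 2 _ d0; exact.
have es : s = s (+) odd 2 by rewrite addbF.
rewrite /rp /rotpi (bx_jones es d2) // /jones /=; have d3 := dg_cup 2 d2.
rewrite !(zigr d3) //.
by rewrite -(@cup_cap _ P s 0 0).
Qed.

Lemma rp_E30 s : rp s (E 3 0 (~~ s)) = E 3 1 s.
Proof.
rewrite -(@iotaE _ P 2 0 _ isT) -(@lamE _ P 2 0 s isT) -[in RHS]rp_E2.
by apply: rotpi_iota => //; rewrite addbT.
Qed.

Lemma rp_E31 s : rp s (E 3 1 (~~ s)) = E 3 0 s.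
Proof.
have h u : u = s -> rp s (E 2 0 u) = E 2 0 s by move=> ->; exact: rp_E2.
rewrite -(@iotaE _ P 2 0 _ isT) -(@lamE _ P 2 0 _ isT) -(h _ (negbK s)).
by apply: rotpi_lam => //; rewrite ?addbT.
Qed.

Lemma rpM n s t (x y : tl P n t) : t = s (+) odd n -> rp s (x * y) = rp s y * rp s x.
Proof. by move=> e; exact: rotpi_mul. Qed.

Lemma rp1 n s t : t = s (+) odd n -> rp s (1 : tl P n t) = 1.
Proof. by move=> e; exact: rotpi_idn. Qed.

Lemma rp_jw3 s : rp s (jw3 P (~~ s)) = jw3 P s.
Proof.
have e : ~~ s = s (+) odd 3 by rewrite addbT.
rewrite /jw3 rpD rpB !rpZ !rpD !rpM // rp_E30 rp_E31 rp1 //.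
by rewrite [E 3 1 s + _]addrC.
Qed.

Lemma rp3E s (x : tl P 3 (~~ s)) : rp s x = rr s (rr (~~ s) (rr s x)).
Proof. exact: rotpi3. Qed.

Section TwoSides.
Variables p q : forall s, tl P 3 s.
Hypothesis sd : forall s, side (p s) (q s).
Hypotheses (d_neq0 : d != 0).
Let S s := p s - q s.

Let pp s : p s * p s = p s. Proof. by have [[[]]] := sd s. Qed.
Let qq s : q s * q s = q s. Proof. by have [_ [[]]] := sd s. Qed.
Let sp s : tl_star (p s) = p s. Proof. by have [[[]]] := sd s. Qed.
Let sq s : tl_star (q s) = q s. Proof. by have [_ [[]]] := sd s. Qed.
Let pq s : p s * q s = 0. Proof. by have := side_pq (sd s) 1; rewrite mul1r. Qed.
Let qp s : q s * p s = 0. Proof. by have := side_qp (sd s) 1; rewrite mul1r. Qed.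

Lemma S_S s : S s * S s = jw3 P s.
Proof.
by rewrite (side_jw3 (sd s)) mulrBl !mulrBr pp pq qp qq subr0 sub0r opprK.
Qed.
Lemma jw3_S s : jw3 P s * S s = S s.
Proof. by rewrite (side_jw3 (sd s)) mulrDl !mulrBr pp pq qp qq subr0 sub0r. Qed.
Lemma S_jw3 s : S s * jw3 P s = S s.
Proof. by rewrite (side_jw3 (sd s)) mulrBl !mulrDr pp pq qp qq addr0 add0r. Qed.
Lemma star_S s : tl_star (S s) = S s. Proof. by rewrite starB sp sq. Qed.
Lemma tr_S s : tl_trace (S s) = 0.
Proof. by rewrite trB (side_trace (sd s)) subrr. Qed.
Lemma E_S s i : (i < 2)%N -> E 3 i s * S s = 0.
Proof. by move=> h; rewrite -jw3_S mulrA (E_jw3 s d_neq0 h) mul0r. Qed.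
Lemma S_E s i : (i < 2)%N -> S s * E 3 i s = 0.
Proof. by move=> h; rewrite -S_jw3 -mulrA (jw3_E s d_neq0 h) mulr0. Qed.
Lemma tr_p_neq0 s : tl_trace (p s) != 0.
Proof.
by have [[pP p0 _]] := sd s; rewrite gt_eqF //; exact: (trace_projection_pos HP pP p0).
Qed.

(** Two of the four annihilations of [X] by cup-caps are inherited from S by sliding. The other two
    use that [E 3 0 s] is inequivalent to [p s] and [q s]. Then [X] is a combination of [p s] and
    [q s], and having trace 0 it is a multiple of S. *)
Lemma rl_S s : exists a, rl s (S (~~ s)) = a *: S s.
Proof.
pose X := rl s (S (~~ s)); have XE : X = tl_star (rr s (S (~~ s))) by rewrite star_rr star_S.
have E1X : E 3 1 s * X = 0.
  by rewrite XE -(@starE _ P 3 1 s isT) -tl_star_mul rr_right_kill ?star0_ // S_E.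
have XE0 : X * E 3 0 s = 0.
  by rewrite XE -(@starE _ P 3 0 s isT) -tl_star_mul rr_left_kill ?star0_ // E_S.
have rr1 : rr s (1 : tl P 3 (~~ s)) = E 3 1 s * E 3 0 s.
  by rewrite -(star1 P 3 (~~ s)) -star_rl rl1_3 // tl_star_mul !starE.
have E0X : E 3 0 s * X = 0.
  have hX : X = X * jw3 P s + (delta / d) *: (X * E 3 1 s) - d^-1 *: (X * E 3 1 s * E 3 0 s).
    rewrite /jw3 mulrDr mulrBr mulr1 -!scalerAr !mulrDr !mulrA XE0 mul0r.
    linear_eq R[i] (tl P 3 s); rewrite /=; ring.
  have k1 : E 3 0 s * (X * jw3 P s) = 0.
    by rewrite (side_jw3 (sd s)) !mulrDr (side_E0p (sd s)) (side_E0q (sd s)) addr0.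
  have [c cE] := side_E0 (sd s) (X * E 3 1 s).
  have k2 : E 3 0 s * (X * E 3 1 s) = c *: (E 3 0 s * E 3 1 s).
    rewrite -{1}(@EEE' _ P 3 0 s isT) scalerAl -cE -!mulrA.
    by [].
  (* Since [E 3 1 s * E 3 0 s] is a click of 1, this trace is a multiple of the trace of S. *)
  have c0 : c = 0.
    have : tl_trace (E 3 0 s * (X * E 3 1 s) * (E 3 1 s * E 3 0 s)) = 0.
      have -> : E 3 0 s * (X * E 3 1 s) * (E 3 1 s * E 3 0 s) =
          delta *: (E 3 0 s * (X * (E 3 1 s * E 3 0 s))).
        by rewrite -!mulrA (pull (@EE _ P 3 1 s isT)) -!scalerAl -!scalerAr.
      rewrite trZ tl_trace_mulC -!mulrA EE // -!scalerAr trZ -rr1 tr_rot mulr1 tr_S.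
      by rewrite !mulr0.
    rewrite k2 -scalerAl trZ -!mulrA (pull (@EE _ P 3 1 s isT)) -scalerAl -scalerAr.
    rewrite EEE // trZ -(@iotaE _ P 2 0 s isT) tr_iota tr_Elast expr1 => /eqP.
    by rewrite !mulf_eq0 (negPf (nd_loop P)) !orbF => /eqP.
  rewrite {1}hX mulrBr mulrDr k1 -!scalerAr (mulrA _ (X * _)) k2 c0 !scale0r mul0r !scaler0.
  by rewrite addr0 subr0.
have XE1 : X * E 3 1 s = 0.
  have hX : X * E 3 1 s = jw3 P s * (X * E 3 1 s) + (delta / d) *: (E 3 0 s * X * E 3 1 s)
      + (delta / d) *: (E 3 1 s * X * E 3 1 s)
      - d^-1 *: (E 3 0 s * (E 3 1 s * X) * E 3 1 s + E 3 1 s * (E 3 0 s * X) * E 3 1 s).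
    rewrite /jw3 mulrDl mulrBl mul1r -!scalerAl !mulrDl !mulrA.
    linear_eq R[i] (tl P 3 s); rewrite /=; ring.
  have k : jw3 P s * (X * E 3 1 s) = 0.
    have h (r : tl P 3 s) y : tl_star r = r -> (forall x, E 3 0 s * (x * r) = 0) ->
        r * (y * E 3 0 s) = 0.
      move=> sr Er; have e : tl_star (r * (y * E 3 0 s)) = 0.
        by rewrite 2!tl_star_mul starE // sr -mulrA Er.
      by rewrite -[LHS]tl_starK e star0_.
    rewrite -(@EEE' _ P 3 0 s isT).
    have -> : jw3 P s * (X * (E 3 1 s * (E 3 0 s * E 3 1 s))) =
      jw3 P s * (X * E 3 1 s * E 3 0 s) * E 3 1 s by rewrite !mulrA.
    rewrite (side_jw3 (sd s)) mulrDl (h _ _ (sp s) (side_E0p (sd s))).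
    by rewrite (h _ _ (sq s) (side_E0q (sd s))) addr0 mul0r.
  by rewrite hX k E0X E1X !mul0r !mulr0 !mul0r !scaler0 !addr0 scaler0 subr0.
have jX : jw3 P s * X = X by exact: jw3_mul.
have Xj : X * jw3 P s = X.
  by rewrite /jw3 mulrDr mulrBr mulr1 -!scalerAr !mulrDr !mulrA XE0 XE1 !mul0r !addr0 !scaler0 subr0 addr0.
have [a aE] := box_corner (X : box P (3, s)) (side_p (sd s)).
have [b bE] := box_corner (X : box P (3, s)) (side_q (sd s)).
have X2 : X = a *: p s + b *: q s.
  rewrite -{1}jX -{1}Xj (side_jw3 (sd s)) mulrDl !mulrDr (side_pq (sd s)) (side_qp (sd s)).
  by rewrite addr0 add0r [p s * _]aE [q s * _]bE.
exists a; rewrite -/X X2 scalerBr; congr (_ + _); rewrite -scaleNr; congr (_ *: _).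
(* The trace of [X] is that of S times a click of 1, which starts with a cup-cap annihilated by
   S. *)
have : tl_trace X = 0.
  rewrite -[X]mulr1.
  have -> : (1 : tl P 3 s) = rr s (rl (~~ s) (1 : tl P 3 s)).
    by symmetry; apply: rotlK.
  by rewrite tr_rot rl1_3 ?negbK // mulrA S_E // mul0r tr0.
rewrite X2 trD !trZ -(side_trace (sd s)) -mulrDl => /eqP.
by rewrite mulf_eq0 (negPf (tr_p_neq0 s)) orbF addrC addr_eq0 => /eqP.
Qed.

Lemma rr_S s a : rl s (S (~~ s)) = a *: S s -> rr s (S (~~ s)) = a^* *: S s.
Proof. by move=> e; rewrite -[S (~~ s)]star_S -star_rl e starZ star_S. Qed.

(** [tr_rot] shows that the scalars for the two shadings agree and have modulus 1. The half turn
    multiplies S by the cube of the conjugate scalar and fixes [jw3], the square of S, so the sixth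
    power is 1. *)
Lemma sigma_exists : delta ^+ 2 - 2 != 0 -> exists sigma : R[i],
  [/\ sigma * sigma^* = 1, sigma ^+ 6 = 1 & forall s, rl s (S (~~ s)) = sigma *: S s].
Proof.
move=> D_neq0; have T0 : delta * (delta ^+ 2 - 2) != 0 by rewrite mulf_neq0 // nd_loop.
have [a0 e0] := rl_S false; have [a1 e1] := rl_S true.
have tS s : tl_trace (S s * S s) = delta * (delta ^+ 2 - 2) by rewrite S_S (tr_jw3 s d_neq0).
have e01 : a0 = a1.
  apply: (mulIf T0); rewrite -{1}(tS false) -trZ scalerAl -e0.
  have -> : S false = rr false (rl true (S false)) by symmetry; exact: rotlK.
  by rewrite tr_rot [rl true _]e1 -scalerAr trZ tS.
have e s : rl s (S (~~ s)) = a0 *: S s by case: s => //; rewrite e01.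
have n1 : a0 * a0^* = 1.
  apply: (mulIf T0); rewrite mul1r -[in RHS](tS true).
  rewrite -(@tr_rot 2 false) [rl _ _]e [rr _ _](rr_S (e false)).
  by rewrite -[in RHS]scalerAr trZ -[in RHS]scalerAl trZ tS mulrA [a0^* * _]mulrC.
exists a0; split=> //.
have r s : rr s (S (~~ s)) = a0^* *: S s by exact: rr_S.
have pS : rp true (S false) = (a0^* ^+ 3) *: S true.
  rewrite [LHS](@rp3E true) [rr true (S _)](r true) !rrZ [rr false (S true)](r false) !rrZ.
  by rewrite [rr true (S _)](r true) !scalerA; congr (_ *: _); ring.
have := rp_jw3 true; rewrite -S_S rpM // pS -scalerAl -scalerAr scalerA -exprD S_S => h.
have : (a0^* ^+ 6 - 1) * (delta * (delta ^+ 2 - 2)) = 0.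
  by rewrite -(tr_jw3 true d_neq0) -trZ scalerBl scale1r h subrr tr0.
move/eqP; rewrite mulf_eq0 (negPf T0) orbF subr_eq0 => /eqP h6.
by rewrite -[LHS]mulr1 -h6 -exprMn n1 expr1n.
Qed.

End TwoSides.
End Rotation.

(** * Rotations in the 4-box space *)

Section LevelFourBoxes.
Variables (R : realType) (P : nondegenerate R).
Let HP := nd_subfactor P.
Local Open Scope ring_scope.
Notation delta := (loop P false).
Notation d := (delta ^+ 2 - 1).
Notation D := (delta * (delta ^+ 2 - 2)).
Notation E := (E P).
Variables (p q : forall s, tl P 3 s) (sigma : R[i]).
Hypothesis sd : forall s, side (p s) (q s).
Hypotheses (d_neq0 : d != 0) (D_neq0 : D != 0).
Hypotheses (sigma_unit : sigma * sigma^* = 1) (sigma6 : sigma ^+ 6 = 1).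
Hypothesis rot : forall s, rl s (p (~~ s) - q (~~ s)) = sigma *: (p s - q s).

Definition sym s : tl P 3 s := p s - q s.
Definition su s : tl P 4 s := iota_ (sym s).
Definition sv s : tl P 4 s := lam_ (sym (~~ s)).
Definition sf s : tl P 4 s := iota_ (jw3 P s).
Definition sg s : tl P 4 s := lam_ (jw3 P (~~ s)).

Lemma rot_st s : rr s (sym (~~ s)) = sigma^* *: sym s.
Proof. exact: (rr_S sd (rot s)). Qed.

Lemma rl1_4 s u : u = ~~ s -> rl s (1 : tl P 4 u) = E 4 0 s * (E 4 1 s * E 4 2 s).
Proof.
move=> eu; have := @rotl_iota R P 2 u s (idn P 3 u) (E 4 0 s * (E 4 1 s * E 4 2 s)) eu.
rewrite iota_idn (lam_idn P 3 eu) => h; rewrite [LHS]h; first exact: mul1x.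
move=> f df; have df2 := dg_cupcap 2 2 df; have df1 := dg_cupcap 1 1 df2.
rewrite !(mor0_mul _ _ df) (@mor0_jones _ P 4 2) // (@mor0_jones _ P 4 1) //.
rewrite (@mor0_jones _ P 4 0) //.
by rewrite (zigr (dg_cap 1 df2)) // (zigr (dg_cap 2 df)).
Qed.

Lemma rl_sandwich s (x y : tl P 3 (~~ s)) :
  rl s (iota_ x * (E 4 2 (~~ s) * iota_ y)) = lam_ x * iota_ (rl s y).
Proof. exact: rotl_sandwich. Qed.

Lemma rlK n s (x : tl P n.+1 s) : rr s (rl (~~ s) x) = x.
Proof. by apply: rotlK. Qed.

(** Up to the factor [sigma], [sv s * su s] is the click of a sandwich of two copies of S. Its trace
    is that of the sandwich against a click of 1, which starts with a cup-cap annihilated by S. *)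
Lemma tr_su_sv s : tl_trace (su s * sv s) = 0.
Proof.
have s0 : sigma != 0 by apply: contra_neq (oner_neq0 R[i]) => s0; rewrite -sigma_unit s0 mul0r.
apply: (mulfI s0); rewrite mulr0 tl_trace_mulC -trZ scalerAr -iotaZ -rot -rl_sandwich.
rewrite -[rl s _]mulr1 -[X in _ * X]rlK tr_rot rl1_4 ?negbK //.
have k : iota_ (sym (~~ s)) * E 4 0 (~~ s) = 0.
  by rewrite -(@iotaE _ P 3 0 _ isT) -iotaM (S_E sd d_neq0) // -(subrr (1 : tl P 3 _)) iotaB subrr.
by rewrite -!mulrA (pull k) mul0r !mulr0 tr0.
Qed.

Lemma level_four_boxes s : level_four (@tl_star _ P 4 s) (@tl_trace _ P 4 s) delta sigma
  (E 4 0 s) (E 4 1 s) (E 4 2 s) (su s) (sv s) (sf s) (sg s).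
Proof.
split=> //.
- exact: nd_loop.
- exact: loop_real.
- exact: tl_star_linear.
- exact: tl_star_mul.
- exact: tl_trace_linear.
- exact: tl_trace_mulC.
- exact: EE.
- exact: EE.
- exact: EE.
- exact: EEE.
- exact: EEE'.
- exact: EEE.
- exact: EEE'.
- exact: jones_far.
- exact: starE.
- exact: starE.
- exact: starE.
- by rewrite star_iota_ (star_S sd).
- by rewrite star_lam_ (star_S sd).
- rewrite /sf /jw3 iotaD iotaB iota1 !iotaZ !iotaD !iotaM.
  by rewrite (@iotaE _ P 3 0 s isT) (@iotaE _ P 3 1 s isT).
- rewrite /sg /jw3 lamD lamB lam1 !lamZ !lamD !lamM.
  by rewrite (@lamE _ P 3 0 s isT) (@lamE _ P 3 1 s isT).
- by rewrite -iotaM (S_S sd).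
- by rewrite -lamM (S_S sd).
- by rewrite -iotaM (jw3_S sd).
- by rewrite -lamM (jw3_S sd).
- by rewrite slide_rr rot_st iotaZ -scalerAr.
- by rewrite tr_E_iota (tr_jw3 s d_neq0).
- exact: tr_su_sv.
- by rewrite tr_iota (tr_S sd) mulr0.
- by rewrite tr_iota (tr_jw3 s d_neq0).
Qed.

Notation kappa := (D / d).
Definition srho s : tl P 4 s := rho delta (E 4 2 s) (su s).
Definition sjw s : tl P 4 s := jw delta (E 4 2 s) (sf s).
Definition sgap s : tl P 4 s := gap delta (E 4 2 s) (su s) (sf s).

Lemma lrK n s (x : tl P n.+1 s) : rl s (rr (~~ s) x) = x.
Proof. by apply: rotrK. Qed.

Lemma lrK' n s u (x : tl P n.+1 s) : u = ~~ s -> rl s (rr u x) = x.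
Proof. by move=> eu; apply: rotrK. Qed.

Lemma rr1_3 s : rr s (1 : tl P 3 (~~ s)) = E 3 1 s * E 3 0 s.
Proof. by rewrite -(star1 P 3 (~~ s)) -star_rl rl1_3 // tl_star_mul !starE. Qed.

(** The click permutes the five Temperley-Lieb diagrams of the 3-box space; the next lemmas complete
    the list. *)
Lemma rl_E30 s : rl s (E 3 0 (~~ s)) = E 3 1 s.
Proof.
have eu : ~~ s = ~~ s by [].
rewrite -(@iotaE _ P 2 0 _ isT).
have := @rotl_iota R P 1 (~~ s) s (E 2 0 (~~ s)) (E 3 0 s * E 3 1 s) eu => h.
rewrite [LHS]h; last first.
  move=> f df; rewrite mor0_mul // !mor0_jones //; last exact: dg_cupcap.
  by rewrite (zigr (dg_cap 1 df)).
by rewrite -[LHS]/(lam_ (E 2 0 (~~ s)) * (E 3 0 s * E 3 1 s)) (@lamE _ P 2 0 s isT) EEE'.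
Qed.

Lemma rl_E31 s : rl s (E 3 1 (~~ s)) = E 3 0 s.
Proof.
have e : rr (~~ s) (E 3 0 s) = E 3 1 (~~ s).
  case: s; first by rewrite -(@starE _ P 3 0 true isT) -(@star_rl _ P 3 false) (rl_E30 false) starE.
  by rewrite -(@starE _ P 3 0 false isT) -(@star_rl _ P 3 true) (rl_E30 true) starE.
by rewrite -e lrK.
Qed.

Lemma rl_E3101 s : rl s (E 3 1 (~~ s) * E 3 0 (~~ s)) = 1.
Proof.
have e : rr (~~ s) (1 : tl P 3 s) = E 3 1 (~~ s) * E 3 0 (~~ s).
  by case: s; [exact: (rr1_3 false)|exact: (rr1_3 true)].
by rewrite -e lrK.
Qed.

Lemma rl_E3010 s : rl s (E 3 0 (~~ s) * E 3 1 (~~ s)) = E 3 1 s * E 3 0 s.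
Proof.
have e1 : rl (~~ s) (1 : tl P 3 s) = E 3 0 (~~ s) * E 3 1 (~~ s).
  by apply: rl1_3; rewrite negbK.
rewrite -e1 -rr1_3 -[rr s 1]lrK; congr (rl s _).
have e3 := @rp3E _ P s 1; rewrite rp1 ?addbT // in e3.
by rewrite e3 (lrK' _ (esym (negbK s))).
Qed.

Lemma rl_jw3 s : rl s (jw3 P (~~ s)) = E 3 0 s * E 3 1 s
  - (delta / d) *: (E 3 1 s + E 3 0 s) + d^-1 *: (E 3 1 s * E 3 0 s + 1).
Proof. by rewrite /jw3 rlD rlB !rlZ !rlD rl1_3 // rl_E30 rl_E31 rl_E3101 rl_E3010. Qed.

Lemma rl_iota4 s (x : tl P 3 (~~ s)) :
  rl s (iota_ x) = lam_ x * (E 4 0 s * (E 4 1 s * E 4 2 s)).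
Proof.
apply: rotl_iota => // f df; have df2 := dg_cupcap 2 2 df; have df1 := dg_cupcap 1 1 df2.
rewrite !(mor0_mul _ _ df) (@mor0_jones _ P 4 2) // (@mor0_jones _ P 4 1) //.
rewrite (@mor0_jones _ P 4 0) //.
by rewrite (zigr (dg_cap 1 df2)) // (zigr (dg_cap 2 df)).
Qed.

Lemma rl_rho s : rl s (srho (~~ s)) = (sigma / kappa) *: (sv s * su s).
Proof.
rewrite /srho /rho rlZ rl_sandwich rot iotaZ -scalerAr scalerA mulrC.
by [].
Qed.

(** [jw] is a box with an added string minus a sandwich, so [rl_iota4] and [rl_sandwich] apply;
    [jw_rotation] identifies the outcome. *)
Lemma rl_jw s : rl s (sjw (~~ s)) =
  (1 - D ^- 2) *: sy (E 4 0 s) (E 4 1 s) (E 4 2 s) (sf s) (sg s) - D^-1 *: sjw s.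
Proof.
rewrite /sjw (jw_rotation (level_four_boxes s)) /jw /ep rlB rlZ rl_iota4 rl_sandwich.
congr (_ - _ *: _); rewrite rl_jw3 iotaD iotaB !iotaZ !iotaD !iotaM iota1.
rewrite (@iotaE _ P 3 0 s isT) (@iotaE _ P 3 1 s isT) -/(sg s).
have ge2 := ge2 (level_four_boxes s).
rewrite !(mulrBr, mulrDr, =^~ scalerAr) ge2 (pull ge2) mul0r mulr1.
linear_eq R[i] (tl P 4 s); rewrite /=; ring.
Qed.

Lemma rp_sym s : rp (~~ s) (sym s) = sigma^* ^+ 3 *: sym (~~ s).
Proof.
have r := rot_st; case: s.
- rewrite [LHS](@rp3E _ _ false) [rr _ (sym _)](r false) !rrZ [rr _ (sym _)](r true) !rrZ.
  by rewrite [rr _ (sym _)](r false) !scalerA; congr (_ *: _); ring.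
- rewrite [LHS](@rp3E _ _ true) [rr _ (sym _)](r true) !rrZ [rr _ (sym _)](r false) !rrZ.
  by rewrite [rr _ (sym _)](r true) !scalerA; congr (_ *: _); ring.
Qed.

Lemma rp_su s : rp s (su s) = sigma^* ^+ 3 *: sv s.
Proof.
rewrite /sv -lamZ -rp_sym; apply: rotpi_iota => //; exact: (esym (addbF s)).
Qed.

Lemma rp_E42 s : rp s (E 4 2 s) = E 4 0 s.
Proof.
rewrite -(@lamE _ P 3 1 s isT) -(@iotaE _ P 3 0 s isT) -rp_E31.
by apply: rotpi_lam => //; exact: (esym (addbF s)).
Qed.

Let s6 : sigma^* ^+ 3 * sigma^* ^+ 3 = 1.
Proof. by rewrite -exprD -rmorphXn sigma6 rmorph1. Qed.

Lemma rpM4 s (x y : tl P 4 s) : rp s (x * y) = rp s y * rp s x.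
Proof. by apply: rpM; rewrite addbF. Qed.

(** The half turn takes [su] to [sv] up to a scalar of square 1, and exchanges the first and last
    cup-caps; by [rhoE] the result is the same element. *)
Lemma rp_rho s : rp s (srho s) = srho s.
Proof.
have e : rp s (su s * (E 4 2 s * su s)) = sv s * (E 4 0 s * sv s).
  rewrite !rpM4 rp_su rp_E42 -!scalerAl -!scalerAr scalerA s6 scale1r -mulrA.
  by [].
by rewrite /srho {1}/rho rpZ e (rhoE (level_four_boxes s)).
Qed.

Lemma rp_jw s : rp s (sjw s) = sjw s.
Proof.
have fE : sf s = su s * su s by rewrite (lf_uu (level_four_boxes s)).
have e : rp s (sf s) = sg s.
  by rewrite fE rpM4 rp_su -scalerAl -scalerAr scalerA s6 scale1r (lf_vv (level_four_boxes s)).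
have e2 : rp s (sf s * (E 4 2 s * sf s)) = sg s * (E 4 0 s * sg s).
  by rewrite !rpM4 e rp_E42 -mulrA.
by rewrite /sjw {1}/jw /ep rpB rpZ e e2 (jwE (level_four_boxes s)).
Qed.

Lemma rp_gap s : rp s (sgap s) = sgap s.
Proof. by rewrite /sgap /gap rpB [rp s (jw _ _ _)]rp_jw [rp s (rho _ _ _)]rp_rho. Qed.

End LevelFourBoxes.

(** * Arithmetic of [delta] and [sigma] *)

Section Numbers.
Variables (C : numClosedFieldType) (delta : C).
Local Open Scope ring_scope.
Notation x := (delta ^+ 2).
Notation d := (delta ^+ 2 - 1).
Notation D := (delta * (delta ^+ 2 - 2)).
Hypotheses (delta_neq0 : delta != 0) (x2 : x ^+ 2 = 6 * x - 4).

Let rel : x ^+ 2 - 6 * x + 4 = 0. Proof. by rewrite x2; ring. Qed.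

(** Non-vanishing is shown by a Bezout identity with [x ^+ 2 - 6 * x + 4], as in [D_neq0_of] and
    [d2_neq14_of]. *)
Lemma d_neq0_of : d != 0.
Proof.
apply: contra_neq (oner_neq0 C) => d0.
by transitivity (d * (x - 5) - (x ^+ 2 - 6 * x + 4)); [ring | rewrite d0 rel; ring].
Qed.

Lemma D_neq0_of : D != 0.
Proof.
rewrite mulf_neq0 //; have n4 : 4 != 0 :> C by rewrite pnatr_eq0.
apply: contra_neq n4 => d0.
by transitivity ((x - 2) * (x - 4) - (x ^+ 2 - 6 * x + 4)); [ring | rewrite d0 rel; ring].
Qed.

Lemma delta_D_of : delta * D = d *+ 4.
Proof.
apply/eqP; rewrite -subr_eq0; apply/eqP; rewrite -rel; ring.
Qed.

Lemma D_d_of : D ^+ 2 = 3 * d ^+ 2 + 1.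
Proof.
apply/eqP; rewrite -subr_eq0; apply/eqP.
by transitivity ((x ^+ 2 - 6 * x + 4) * (x - 1)); [ring | rewrite rel mul0r].
Qed.

Lemma d2_neq1_of : d ^+ 2 != 1.
Proof.
rewrite -subr_eq0; have n4 : 4 != 0 :> C by rewrite pnatr_eq0.
have -> : d ^+ 2 - 1 = 4 * d.
  apply/eqP; rewrite -subr_eq0; apply/eqP; rewrite -rel; ring.
by rewrite mulf_neq0 // d_neq0_of.
Qed.

Lemma d2_neq14_of : 4 * d ^+ 2 != 1.
Proof.
rewrite -subr_eq0; have n : 55 != 0 :> C by rewrite pnatr_eq0.
apply: contra_neq n => d0.
transitivity ((4 * d ^+ 2 - 1) * (16 * x - 83) - (x ^+ 2 - 6 * x + 4) * (4 * (16 * x - 83) + 256)).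
  ring.
by rewrite d0 rel; ring.
Qed.

Variable sigma : C.
Hypotheses (sigma_unit : sigma * sigma^* = 1) (sigma6 : sigma ^+ 6 = 1).

Let s0 : sigma != 0.
Proof. by apply: contra_neq (oner_neq0 C) => s0; rewrite -sigma_unit s0 mul0r. Qed.
Let rE : sigma^* = sigma ^+ 5.
Proof. by apply: (mulfI s0); rewrite sigma_unit -exprS sigma6. Qed.

Lemma sigma_sum_sq : (sigma + sigma^*) ^+ 2 = 4 \/ (sigma + sigma^*) ^+ 2 = 1.
Proof.
rewrite rE; have t3 : (sigma ^+ 2 - 1) * ((sigma ^+ 2) ^+ 2 + sigma ^+ 2 + 1) = 0.
  by transitivity (sigma ^+ 6 - 1); [ring | rewrite sigma6 subrr].
have e : (sigma + sigma ^+ 5) ^+ 2 = sigma ^+ 2 + 2 * sigma ^+ 6 + sigma ^+ 6 * sigma ^+ 4.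
  by ring.
move/eqP: t3; rewrite mulf_eq0 subr_eq0 => /orP[/eqP t1|/eqP t1].
  left; rewrite e sigma6 t1 -[4%N]/(2 * 2)%N exprM t1; ring.
right; rewrite e sigma6; apply/eqP; rewrite -subr_eq0; apply/eqP; rewrite -t1; ring.
Qed.

Lemma sigma_sum_neq0 : sigma + sigma^* != 0.
Proof.
rewrite -sqrf_eq0; by case: sigma_sum_sq => ->; rewrite ?oner_eq0 ?pnatr_eq0.
Qed.

Lemma sigma_sum_d : (sigma + sigma^*) ^+ 2 != (d *+ 2) ^+ 2.
Proof.
have -> : (d *+ 2) ^+ 2 = 4 * d ^+ 2 by ring.
case: sigma_sum_sq => ->; last by rewrite eq_sym d2_neq14_of.
have n4 : 4 != 0 :> C by rewrite pnatr_eq0.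
rewrite -{1}[4]mulr1 -subr_eq0 -mulrBr mulf_neq0 // subr_eq0 eq_sym.
exact: d2_neq1_of.
Qed.

(** The left side is minus the sum of the inverses of [sigma ^+ 2] and [sigma ^+ 4]. It is -2 if
    [sigma ^+ 2 = 1], and 1 if [sigma ^+ 2] is a primitive cube root of unity. *)
Lemma sigma_sum_neq2 : - (sigma^* ^+ 3 * (sigma + sigma^*)) != 2.
Proof.
have n3 : 3 != 0 :> C by rewrite pnatr_eq0.
apply/eqP => h.
have t3 : (sigma ^+ 2 - 1) * ((sigma ^+ 2) ^+ 2 + sigma ^+ 2 + 1) = 0.
  by transitivity (sigma ^+ 6 - 1); [ring | rewrite sigma6 subrr].
have e2 : sigma ^+ 4 + sigma ^+ 2 = - 2.
  rewrite -[RHS]mulr1 -{1}h rE.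
  transitivity ((sigma ^+ 6) ^+ 2 * sigma ^+ 4 + (sigma ^+ 6) ^+ 3 * sigma ^+ 2).
    by rewrite sigma6 !expr1n !mul1r.
  ring.
move/eqP: t3; rewrite mulf_eq0 subr_eq0 => /orP[/eqP t1|/eqP t1].
  have n4 : 4 != 0 :> C by rewrite pnatr_eq0.
  move/eqP: n4; apply; transitivity (sigma ^+ 4 + sigma ^+ 2 + 2); last by rewrite e2 addNr.
  by rewrite -[4%N]/(2 * 2)%N exprM t1; ring.
move/eqP: (oner_neq0 C); apply; apply: oppr_inj; rewrite oppr0 -t1.
by rewrite -exprM e2; ring.
Qed.

End Numbers.

(** * The case of two graphs Lambda *)

Section BothLambda.
Variables (R : realType) (P : nondegenerate R).
Let HP := nd_subfactor P.
Local Open Scope ring_scope.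
Notation delta := (loop P false).
Notation d := (delta ^+ 2 - 1).
Notation D := (delta * (delta ^+ 2 - 2)).
Notation kappa := (D / d).
Notation E := (E P).
Variables (p q : forall s, tl P 3 s) (sigma : R[i]).
Hypothesis sd : forall s, side (p s) (q s).
Hypothesis x2 : (delta ^+ 2) ^+ 2 = 6 * delta ^+ 2 - 4.
Hypotheses (sigma_unit : sigma * sigma^* = 1) (sigma6 : sigma ^+ 6 = 1).
Hypothesis rot : forall s, rl s (p (~~ s) - q (~~ s)) = sigma *: (p s - q s).

Let l0 : delta != 0. Proof. exact: nd_loop. Qed.
Let d0 := d_neq0_of x2.
Let D0 := D_neq0_of l0 x2.
Let LF s := level_four_boxes sd d0 D0 sigma_unit rot s.
Notation u := (su p q).
Notation v := (sv p q).
Notation G := (sgap p q).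

Hypothesis gap_minimal : forall s,
  is_minimal_projection (2^-1 *: (G s + G s * u s) : box P (4, s)) /\
  is_minimal_projection (2^-1 *: (G s - G s * u s) : box P (4, s)).

(** Such an [x] commutes with the two minimal projections, whose sum is [G s], and is a scalar on
    each. *)
Lemma gap_commutant s x : G s * x = x -> x * G s = x ->
  G s * u s * x = x * (G s * u s) ->
  exists z w, x = z *: G s + w *: (G s * u s).
Proof.
move=> Gx xG ux; have [mp mq] := gap_minimal s.
have two : (2 : R[i]) != 0 by rewrite pnatr_eq0.
have sand (a : tl P 4 s) : a * a = a -> a * x = x * a -> a * (x * a) = a * x.
  by move=> aa ax; rewrite -ax mulrA aa.
have [[pp _] _ _] := mp; have [[qq _] _ _] := mq.
have [al ale] := box_corner (x : box P (4, s)) mp.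
have [be bee] := box_corner (x : box P (4, s)) mq.
have cp : (2^-1 *: (G s + G s * u s)) * x = x * (2^-1 *: (G s + G s * u s)).
  by rewrite -scalerAl -scalerAr mulrDl mulrDr Gx xG ux.
have cq : (2^-1 *: (G s - G s * u s)) * x = x * (2^-1 *: (G s - G s * u s)).
  by rewrite -scalerAl -scalerAr mulrBl mulrBr Gx xG ux.
have ep := etrans (esym (sand _ pp cp)) ale; have eq := etrans (esym (sand _ qq cq)) bee.
exists ((al + be) / 2), ((al - be) / 2).
transitivity ((2^-1 *: (G s + G s * u s)) * x + (2^-1 *: (G s - G s * u s)) * x).
  rewrite -mulrDl [X in X * x](_ : _ = G s) //.
  by linear_eq R[i] (tl P 4 s); rewrite /=; field; rewrite ?two.
rewrite ep eq; linear_eq R[i] (tl P 4 s); rewrite /=; ring.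
Qed.

Let dD := delta_D_of x2.
Let Dd := D_d_of x2.
Let sn0 := sigma_sum_neq0 sigma_unit sigma6.
Let snd := sigma_sum_d x2 sigma_unit sigma6.

Definition z4 s : tl P 4 s := zvec delta (E 4 2 s) (u s) (sf P s).
Definition w4 s : tl P 4 s := wvec delta (E 4 2 s) (u s) (v s) (sf P s).
Notation pr := ((3 * sigma + sigma^*) / (2 * D)).

Lemma rl_z4 s : rl s (z4 (~~ s)) = sigma *: (pr *: z4 s - (3 / kappa) *: w4 s).
Proof.
rewrite -[RHS](zvec_rotation (LF s) dD Dd (@gap_commutant s) sn0 snd).
have -> : z4 (~~ s) = 3 *: srho p q (~~ s) - sjw P (~~ s).
  rewrite /z4 /zvec /gap /srho /sjw.
  linear_eq R[i] (tl P 4 (~~ s)); rewrite /=; ring.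
rewrite rlB rlZ (rl_rho rot) (rl_jw sd d0 D0 sigma_unit rot) scalerA.
by [].
Qed.

Lemma star_z4 s : tl_star (z4 s) = z4 s. Proof. exact: st_zvec (LF s). Qed.
Lemma star_w4 s : tl_star (w4 s) = - w4 s. Proof. exact: st_wvec (LF s). Qed.

Let dr : d^* = d. Proof. exact: d_real (LF true). Qed.
Let Dr : D^* = D. Proof. exact: D_real (LF true). Qed.
Let kr : kappa^* = kappa. Proof. by rewrite rmorphM fmorphV /= dr Dr. Qed.

Lemma rr_z4 s : rr s (z4 (~~ s)) = sigma^* *: (pr^* *: z4 s + (3 / kappa) *: w4 s).
Proof.
rewrite -[z4 (~~ s)]star_z4 -star_rl rl_z4 starZ starB [tl_star (_ *: z4 s)]starZ
  [tl_star (_ *: w4 s)]starZ star_z4 star_w4.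
have -> : (3 / kappa)^* = 3 / kappa by rewrite rmorphM fmorphV /= kr rmorph_nat.
by rewrite scalerN opprK.
Qed.

Lemma rp_z4 s : rp s (z4 s) = z4 s.
Proof.
by rewrite /z4 /zvec rpB rpZ [rp s (rho _ _ _)](rp_rho sd d0 D0 sigma_unit sigma6 rot)
  [rp s (gap _ _ _ _)](rp_gap sd d0 D0 sigma_unit sigma6 rot).
Qed.

(* [rp] is the fourth power of [rr] and fixes [z4]. *)
Lemma rl3_z4 s : rl s (rl (~~ s) (rl s (z4 (~~ s)))) = rr s (z4 (~~ s)).
Proof.
have e : z4 (~~ s) = rr (~~ s) (rr s (rr (~~ s) (rr s (z4 (~~ s))))).
  by rewrite -{1}rp_z4; apply: rotpi4; exact: (esym (negbK s)).
by rewrite {1}e lrK (lrK' _ (esym (negbK s))) lrK.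
Qed.

(** The trace of the double click of [z4] times [z4] is computed twice: by [tr_rot] as the trace of
    the square of a single click, and by a linear recurrence between clicks of [z4] that closes up
    because of [rl3_z4]. *)
Lemma gap_parts_not_minimal : False.
Proof.
have six : d *+ 6 = tl_trace (z4 false * z4 false).
  by rewrite [RHS](tr_zvec (LF false) dD).
have zw : tl_trace (z4 false * w4 false) = 0 by exact: (tr_zvec_wvec (LF false)).
have wz : tl_trace (w4 false * z4 false) = 0 by rewrite tl_trace_mulC zw.
have T1 : tl_trace (rl false (rl true (z4 false)) * z4 false) =
    sigma ^+ 2 * (d *+ 6 * pr ^+ 2 + (3 / kappa) ^+ 2 *
      ((- (sigma + sigma^*) / (d *+ 2)) ^+ 2 - 1) * (d *+ 2)).
  have sq (y : tl P 4 true) z : tl_trace ((z *: y) * (z *: y)) = z ^+ 2 * tl_trace (y * y).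
    by rewrite -scalerAl -scalerAr scalerA trZ.
  rewrite -[X in _ * X]rlK tr_rot [rl true _](rl_z4 true) sq; congr (_ * _).
  exact: (tr_combination (LF true) dD (@gap_commutant true) sn0 snd).
(* The terms in [w4] of the two opposite clicks cancel. *)
have pE : (pr + pr^*) *: z4 false = sigma^* *: rl false (z4 true) + sigma *: rr false (z4 true).
  rewrite [rl false _](rl_z4 false) [rr false _](rr_z4 false) !scalerA sigma_unit.
  rewrite [sigma^* * sigma]mulrC sigma_unit !scale1r.
  linear_eq R[i] (tl P 4 false); rewrite /=; ring.
(* Two further clicks are applied to [pE]: three clicks amount to one in the opposite direction, and
   opposite clicks cancel. *)
have T2 : (pr + pr^*) *: rl false (rl true (z4 false)) =
    sigma^* *: rr false (z4 true) + sigma *: rl false (z4 true).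
  have lin (x y y' : tl P 4 false) a b c : c *: x = a *: y + b *: y' ->
      c *: rl false (rl true x) = a *: rl false (rl true y) + b *: rl false (rl true y').
    by move=> e; rewrite -2!rlZ e rlD 2!rlZ rlD 2!rlZ.
  by rewrite (lin _ _ _ _ _ _ pE) [rl false (rl true (rl false _))](rl3_z4 false)
    [rl true (rr false _)](@lrK' _ P 3 true false).
have T3 : (pr + pr^*) * tl_trace (rl false (rl true (z4 false)) * z4 false) =
    d *+ 6 * (sigma ^+ 2 * pr + sigma^* ^+ 2 * pr^*).
  have lin (x y : tl P 4 false) a b c e f a' b' : tl_trace (y * x) = 0 ->
      tl_trace (((a *: (a' *: (b *: x + e *: y))) + c *: (b' *: (f *: x - e *: y))) * x) =
      (a * a' * b + c * b' * f) * tl_trace (x * x).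
    move=> yx; transitivity (a * (a' * (b * tl_trace (x * x) + e * tl_trace (y * x))) +
      c * (b' * (f * tl_trace (x * x) - e * tl_trace (y * x)))); last by rewrite yx; ring.
    by rewrite mulrDl -!scalerAl mulrDl mulrBl -!scalerAl trD !trZ trD trB !trZ.
  rewrite -trZ scalerAl T2 [rr false _](rr_z4 false) [rl false _](rl_z4 false).
  rewrite (lin _ _ _ _ _ _ _ _ _ wz) -six; ring.
rewrite T1 in T3.
exact: (rotation_numeric sigma_unit sigma6 dr d0 D0 (d2_neq1_of x2) Dr Dd T3).
Qed.

End BothLambda.

(** * Dimensions and the conclusion *)

Section Dimensions.
Variables (C : numClosedFieldType) (delta : C).
Local Open Scope ring_scope.
Notation x := (delta ^+ 2).
Notation d := (delta ^+ 2 - 1).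
Notation TD := (delta * (delta ^+ 2 - 2)).
Hypothesis delta_neq0 : delta != 0.

Lemma simple_sum n (es : seq (nat * nat)) (D : 'I_n.+1 -> C) (u : 'I_n.+1) :
  \sum_(v | simple_edges es u v != 0%N) D v =
  \sum_(0 <= k < n.+1)
    if ((u : nat, k) \in es) || ((k, u : nat) \in es) then D (inord k) else 0.
Proof.
rewrite big_mkcond big_mkord; apply: eq_bigr => i _; rewrite inord_val /simple_edges.
by case: (_ || _).
Qed.

Let eq0 (a b c : C) : c != 0 -> c * (a - b) = 0 -> a = b.
Proof. by move=> c0 /eqP; rewrite mulf_eq0 (negPf c0) subr_eq0 => /eqP. Qed.

Let two : 2 != 0 :> C. Proof. by rewrite pnatr_eq0. Qed.

(** [a1] to [a7] are the dimensions of the vertices, and the hypotheses are the eigenvector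
    equations. *)
Lemma Lambda_numbers (a1 a2 a3 a4 a5 a6 a7 : C) :
  delta = a1 -> delta * a1 = 1 + a2 -> delta * a2 = a1 + a3 + a4 ->
  delta * a3 = a2 + a5 -> delta * a4 = a2 + a5 -> delta * a5 = a3 + a4 + a6 ->
  delta * a6 = a5 + a7 -> delta * a7 = a6 -> a3 + a4 != 0 ->
  [/\ x ^+ 2 = 6 * x - 4, a2 = d, a3 + a4 = TD, a3 = a4 & a5 = d].
Proof.
move=> <- e1 e2 e3 e4 e5 e6 e7 n34.
have a2E : a2 = d by rewrite -[LHS](addKr 1) -e1; ring.
have a34 : a3 + a4 = TD.
  by apply: (addrI delta); rewrite addrA -e2 a2E; ring.
have x0 : delta ^+ 2 - 2 != 0.
  by move: n34; rewrite a34 mulf_eq0 negb_or => /andP[].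
have a34' : a3 = a4 by apply: (mulfI delta_neq0); rewrite e3 e4.
have a6E : a6 = delta * a5 - TD by rewrite -a34 e5; ring.
(* The end of the path gives [delta ^+ 2 * a6 = delta * a5 + a6]; with [a6E] this is a linear
   equation for [a5]. *)
have a5E : a5 = d.
  apply: (eq0 (c := delta * (delta ^+ 2 - 2))); first by rewrite mulf_neq0.
  have e : delta * (delta * a6) - delta * a5 - a6 = 0 by rewrite e6 -e7; ring.
  rewrite -e a6E; ring.
split=> //; apply: (eq0 (c := 1)); first exact: oner_neq0.
transitivity (delta * (a3 + a4) - 4 * x + 4); first by rewrite a34; ring.
by rewrite mulrDr e3 e4 a5E a2E; ring.
Qed.

(** The symmetry exchanging the two branches forces equal dimensions, because [delta ^+ 2 - 2] is
    nonzero. Then twice [a5] and twice [a6] are [x] and [x - 2], which gives the value 2 at the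
    end. *)
Lemma Lambda'_numbers (a1 a2 a3 a4 a5 a6 a7 a8 a9 : C) :
  delta = a1 -> delta * a1 = 1 + a2 -> delta * a2 = a1 + a3 + a4 ->
  delta * a3 = a2 + a5 + a6 -> delta * a4 = a2 + a7 + a8 -> delta * a5 = a3 + a9 ->
  delta * a6 = a3 -> delta * a7 = a4 -> delta * a8 = a4 + a9 -> delta * a9 = a5 + a8 ->
  a3 + a4 != 0 ->
  [/\ x ^+ 2 = 6 * x - 4 /\ a2 = d, a3 + a4 = TD, a3 = a4,
      a5 + a6 = d /\ a7 + a8 = d & a5 - a6 - a7 + a8 = 2].
Proof.
move=> <- e1 e2 e3 e4 e5 e6 e7 e8 e9 n34.
have a2E : a2 = d by rewrite -[LHS](addKr 1) -e1; ring.
have a34 : a3 + a4 = TD.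
  by apply: (addrI delta); rewrite addrA -e2 a2E; ring.
have x0 : delta ^+ 2 - 2 != 0.
  by move: n34; rewrite a34 mulf_eq0 negb_or => /andP[].
have a34' : a3 = a4.
  apply: (eq0 x0); transitivity (delta * (delta * a3 - delta * a4) - 2 * (a3 - a4)); first by ring.
  rewrite e3 e4; transitivity ((delta * a5 - delta * a8) + (delta * a6 - delta * a7) - 2 * (a3 - a4)).
    by ring.
  by rewrite e5 e8 e6 e7; ring.
have a58 : a5 = a8 by apply: (mulfI delta_neq0); rewrite e5 e8 a34'.
have a67 : a6 = a7 by apply: (mulfI delta_neq0); rewrite e6 e7 a34'.
have a3E : 2 * a3 = TD by rewrite -a34 -a34'; ring.
have a6E : 2 * a6 = delta ^+ 2 - 2.
  by apply: (mulfI delta_neq0); rewrite -a3E -e6; ring.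
have a5E : 2 * a5 = x.
  apply: (eq0 x0); transitivity (2 * (delta * (delta * a5) - 2 * a5) - x * (delta ^+ 2 - 2)).
    by ring.
  rewrite e5 (mulrDr delta) e9 -a58; transitivity (delta * (2 * a3) - x * (delta ^+ 2 - 2)); first by ring.
  by rewrite a3E; ring.
have x2 : x ^+ 2 = 6 * x - 4.
  apply: (eq0 (c := 1)); first exact: oner_neq0.
  transitivity (delta * (2 * a3) - 4 * x + 4); first by rewrite a3E; ring.
  transitivity (2 * (delta * a3) - 4 * x + 4); first by ring.
  rewrite e3 a2E; transitivity (2 * a5 + 2 * a6 - 2 * x + 2); first by ring.
  by rewrite a5E a6E; ring.
have a56 : a5 + a6 = d by apply: (mulfI two); rewrite mulrDr a5E a6E; ring.
split=> //; first by split=> //; rewrite -a67 -a58 addrC.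
by rewrite -a67 -a58; transitivity (2 * a5 - 2 * a6); [ring | rewrite a5E a6E; ring].
Qed.

Lemma Lambda_dimensions (D : vert Lambda -> C) (v := fun k : nat => inord k : 'I_8) :
  (forall u, 0 < D u) -> D (base Lambda) = 1 ->
  (forall u, delta * D u = \sum_(w | edges u w != 0%N) D w) ->
  [/\ x ^+ 2 = 6 * x - 4, D (v 2%N) = d, D (v 3%N) + D (v 4%N) = TD,
      D (v 3%N) = D (v 4%N) & D (v 5%N) = d].
Proof.
move=> Dpos; have -> : base Lambda = v 0%N by apply: val_inj; rewrite /= inordK.
move=> D0 Dsum.
have eq k : (k < 8)%N -> delta * D (v k) = \sum_(0 <= j < 8)
    if ((k, j) \in [:: (0, 1); (1, 2); (2, 3); (2, 4); (3, 5); (4, 5); (5, 6); (6, 7)]%N)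
     || ((j, k) \in [:: (0, 1); (1, 2); (2, 3); (2, 4); (3, 5); (4, 5); (5, 6); (6, 7)]%N)
    then D (v j) else 0.
  move=> k8; have e := simple_sum [:: (0, 1); (1, 2); (2, 3); (2, 4); (3, 5); (4, 5);
    (5, 6); (6, 7)]%N (D : 'I_8 -> C) (v k).
  by rewrite {2 3}/v inordK // in e; rewrite Dsum; exact: e.
have := (eq 0 isT, eq 1 isT, eq 2 isT, eq 3 isT, eq 4 isT, eq 5 isT, eq 6 isT, eq 7 isT)%N.
rewrite unlock /= D0 !add0r !addr0 mulr1 !addrA.
move=> [[[[[[[e0 e1] e2] e3] e4] e5] e6] e7].
by apply: (Lambda_numbers e0 e1 e2 e3 e4 e5 e6 e7); rewrite gt_eqF // addr_gt0.
Qed.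

Lemma Lambda'_dimensions (D : vert Lambda' -> C) (v := fun k : nat => inord k : 'I_10) :
  (forall u, 0 < D u) -> D (base Lambda') = 1 ->
  (forall u, delta * D u = \sum_(w | edges u w != 0%N) D w) ->
  [/\ x ^+ 2 = 6 * x - 4 /\ D (v 2%N) = d, D (v 3%N) + D (v 4%N) = TD,
      D (v 3%N) = D (v 4%N), D (v 5%N) + D (v 6%N) = d /\ D (v 7%N) + D (v 8%N) = d
    & D (v 5%N) - D (v 6%N) - D (v 7%N) + D (v 8%N) = 2].
Proof.
move=> Dpos; have -> : base Lambda' = v 0%N by apply: val_inj; rewrite /= inordK.
move=> D0 Dsum.
have eq k : (k < 10)%N -> delta * D (v k) = \sum_(0 <= j < 10)
    if ((k, j) \in [:: (0, 1); (1, 2); (2, 3); (2, 4); (3, 5); (3, 6); (4, 7); (4, 8);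
                       (9, 5); (9, 8)]%N)
     || ((j, k) \in [:: (0, 1); (1, 2); (2, 3); (2, 4); (3, 5); (3, 6); (4, 7); (4, 8);
                       (9, 5); (9, 8)]%N)
    then D (v j) else 0.
  move=> k10; have e := simple_sum [:: (0, 1); (1, 2); (2, 3); (2, 4); (3, 5); (3, 6);
    (4, 7); (4, 8); (9, 5); (9, 8)]%N (D : 'I_10 -> C) (v k).
  by rewrite {2 3}/v inordK // in e; rewrite Dsum; exact: e.
have := (eq 0 isT, eq 1 isT, eq 2 isT, eq 3 isT, eq 4 isT, eq 5 isT, eq 6 isT, eq 7 isT,
  eq 8 isT, eq 9 isT)%N.
rewrite unlock /= D0 !add0r !addr0 mulr1 !addrA.
move=> [[[[[[[[[e0 e1] e2] e3] e4] e5] e6] e7] e8] e9].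
by apply: (Lambda'_numbers e0 e1 e2 e3 e4 e5 e6 e7 e8 e9); rewrite gt_eqF // addr_gt0.
Qed.

End Dimensions.

(** * The halves of the gap and the minimal projections below them *)

Section GapSummands.
Variables (R : realType) (P : nondegenerate R).
Let HP := nd_subfactor P.
Local Open Scope ring_scope.
Notation delta := (loop P false).
Notation d := (delta ^+ 2 - 1).
Notation E := (E P).
Variables (p q : forall s, tl P 3 s) (sigma : R[i]).
Hypothesis sd : forall s, side (p s) (q s).
Hypothesis x2 : (delta ^+ 2) ^+ 2 = 6 * delta ^+ 2 - 4.
Hypotheses (sigma_unit : sigma * sigma^* = 1) (sigma6 : sigma ^+ 6 = 1).
Hypothesis rot : forall s, rl s (p (~~ s) - q (~~ s)) = sigma *: (p s - q s).

Let l0 : delta != 0. Proof. exact: nd_loop. Qed.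
Let d0 := d_neq0_of x2.
Let D0 := D_neq0_of l0 x2.
Let LF s := level_four_boxes sd d0 D0 sigma_unit rot s.
Notation u := (su p q).
Notation v := (sv p q).
Notation G := (sgap p q).

(** For [z] equal to 1 or -1, the spectral projection of the reflection [G s * u s] for the
    eigenvalue [z]. *)
Definition gap_part (z : R[i]) s : tl P 4 s := 2^-1 *: (G s + z *: (G s * u s)).

Lemma gap_part_projection z s : z ^+ 2 = 1 -> z^* = z ->
  is_projection (gap_part z s : box P (4, s)).
Proof.
move=> zz zr; have GG := gap_gap (LF s); have uG := gap_u (LF s).
have two : (2 : R[i]) != 0 by rewrite pnatr_eq0.
split.
  change (gap_part z s * gap_part z s = gap_part z s).
  have uu : (G s * u s) * (G s * u s) = G s.
    by rewrite -mulrA (mulrA (u s)) uG -mulrA (lf_uu (LF s)) (gap_f (LF s)) GG.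
  have Gu : G s * (G s * u s) = G s * u s by rewrite mulrA GG.
  have uG' : (G s * u s) * G s = G s * u s by rewrite -mulrA uG Gu.
  have gen (g w : tl P 4 s) : g * g = g -> w * w = g -> g * w = w -> w * g = w ->
      (2^-1 *: (g + z *: w)) * (2^-1 *: (g + z *: w)) = 2^-1 *: (g + z *: w).
    move=> gg ww gw wg; rewrite -scalerAl -scalerAr mulrDl !mulrDr -!scalerAl -!scalerAr.
    rewrite gg ww gw wg (scalerA z) -expr2 zz.
    by linear_eq R[i] (tl P 4 s); rewrite /=; field; rewrite ?two.
  exact: gen.
change (tl_star (gap_part z s) = gap_part z s).
rewrite /gap_part starZ starD starZ tl_star_mul (st_gap (LF s)) (lf_st_u (LF s)) uG zr.
by rewrite fmorphV rmorph_nat.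
Qed.

Lemma tr_gap_part z s : tl_trace (gap_part z s) = d.
Proof.
rewrite /gap_part trZ trD trZ (tr_gap_u (LF s)) mulr0 addr0.
rewrite (tr_gap2 (LF s) (delta_D_of x2)) -[d *+ 2]mulr_natr mulrC mulfK //.
by rewrite pnatr_eq0.
Qed.

Lemma gap_part_fix z s (m : tl P 4 s) : z ^+ 2 = 1 -> E 4 2 s * m = 0 ->
  u s * m = z *: m -> gap_part z s * m = m.
Proof.
move=> zz Em um; have two : (2 : R[i]) != 0 by rewrite pnatr_eq0.
have fm : sf P s * m = m.
  by rewrite -[X in X * m](lf_uu (LF s)) -mulrA um -scalerAr um scalerA -expr2 zz scale1r.
have Gm : G s * m = m.
  rewrite /sgap /gap /jw /ep /rho !mulrBl fm -!scalerAl -!mulrA fm um -scalerAr Em.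
  by rewrite !scaler0 !mulr0 !scaler0 !subr0.
rewrite /gap_part -scalerAl mulrDl Gm -scalerAl -mulrA um -scalerAr Gm scalerA -expr2 zz.
by linear_eq R[i] (tl P 4 s); rewrite /=; field; rewrite ?two.
Qed.

Lemma iota_u (z : R[i]) s (r : tl P 3 s) m : (p s - q s) * r = z *: r ->
  iota_ r * m = m -> u s * m = z *: m.
Proof.
by move=> e rm; rewrite -{1}rm /su mulrA -iotaM e iotaZ -scalerAl rm.
Qed.

Section Classes.
Variables (s : bool) (Gr : pointed_graph).
Variable phi : minimal_projection P s -> vert Gr.
Hypothesis phi_eq : forall p q, phi p = phi q <-> equivalent (proj p) (proj q).
Notation cls := (cls phi).

Lemma E42_kill v2 w (r : tl P 3 s) (m : tl P 4 s) : cls (jw2 P s : box P (2, s)) v2 ->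
  cls m w -> w != v2 -> E 3 0 s * r = 0 -> iota_ r * m = m -> E 4 2 s * m = 0.
Proof.
move=> c2 cm wv Er rm; have := cls_mul0 phi_eq 1 cm (cls_cap phi_eq c2) wv.
rewrite mul1r -scalerAl => /eqP; rewrite scaler_eq0 invr_eq0 (negPf l0) /= => /eqP.
rewrite -mulrA; suff -> : iota_ (iota_ (jw2 P s)) * m = m by [].
rewrite -{1}rm mulrA -iotaM [iota_ (jw2 P s) * r](_ : _ = r) //.
by rewrite /jw2 iotaB iota1 iotaZ (@iotaE _ P 2 0 s isT) mulrBl mul1r -scalerAl Er scaler0 subr0.
Qed.

End Classes.

Lemma sym_p s : (p s - q s) * p s = 1 *: p s.
Proof.
have [[[pp _] _ _] _ _ qp _ _ _ _ _] := sd s; have := qp 1; rewrite mul1r => qp1.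
by rewrite mulrBl [p s * p s]pp qp1 subr0 scale1r.
Qed.
Lemma sym_q s : (p s - q s) * q s = (- 1) *: q s.
Proof.
have [_ [[qq _] _ _] pq _ _ _ _ _ _] := sd s; have := pq 1; rewrite mul1r => pq1.
by rewrite mulrBl [q s * q s]qq pq1 sub0r scaleN1r.
Qed.

End GapSummands.

(** * Half turns of minimal projections *)

Section HalfTurns.
Variables (R : realType) (P : nondegenerate R).
Let HP := nd_subfactor P.
Local Open Scope ring_scope.

Lemma rotate_piE n s (en : ~~ odd n) (x : box P (n, s)) : rotate_pi en x = rotpi s x.
Proof.
rewrite /rotate_pi act_run /= /rotation_word run_cat run_cups /= run_caps.
by [].
Qed.

Lemma rp4K s (x : tl P 4 s) : rp s (rp s x) = x.
Proof. exact: rotpiK. Qed.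

(** The star reverses each of the four clicks that make up the half turn, giving its inverse, which
    is the half turn itself. *)
Lemma star_rp4 s (x : tl P 4 s) : tl_star (rp s x) = rp s (tl_star x).
Proof.
have e (t w : bool) (y : tl P 4 t) : w = ~~ t -> rp t y = rr t (rr w (rr t (rr w y))).
  by move=> tw; exact: rotpi4.
have st t w (y : tl P 4 w) : w = ~~ t -> tl_star (rr t y) = rl t (tl_star y).
  by move=> tw; exact: star_rotr.
have k := @lrK' _ P 3.
have ss : s = ~~ ~~ s by rewrite negbK.
have r := e s (~~ s) (rp s (tl_star x)) erefl; rewrite rp4K in r.
rewrite (e s (~~ s)) // (st s (~~ s)) // (st (~~ s) s) // (st s (~~ s)) // (st (~~ s) s) //.
by rewrite {1}r (k (~~ s) s) // (k s (~~ s)) // (k (~~ s) s) // (k s (~~ s)).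
Qed.

Lemma rp4_minimal s (m : tl P 4 s) : is_minimal_projection (m : box P (4, s)) ->
  is_minimal_projection (rp s m : box P (4, s)).
Proof.
move=> mm; have [[pp sp] p0 _] := mm.
rewrite minimalE; apply: corner_minimal.
- exact: tl_star_mul.
- split; first by rewrite -rpM4; congr (rp s _); exact: pp.
  by rewrite star_rp4; congr (rp s _).
- by apply: contraNneq p0 => r0; rewrite -[m]rp4K r0; apply/eqP; rewrite -[0](scale0r 0) rpZ !scale0r.
- move=> x; have [c cE] := box_corner (rp s x : box P (4, s)) mm; exists c.
  rewrite -[x]rp4K -!rpM4 -mulrA -rpZ; congr (rp s _).
  by rewrite -cE.
Qed.

End HalfTurns.

(** * What each graph says about 3-boxes and 4-boxes *)

Section GraphData.
Variables (R : realType) (P : nondegenerate R).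
Let HP := nd_subfactor P.
Local Open Scope ring_scope.
Notation delta := (loop P false).
Notation d := (delta ^+ 2 - 1).
Notation E := (E P).

(** [m] and [n] both belong to the vertex of depth 4, one below [p] and one below [q]. Their common
    trace [d] is half that of the gap. *)
Lemma Lambda_data s : has_principal_graph P s Lambda ->
  (delta ^+ 2) ^+ 2 = 6 * delta ^+ 2 - 4 /\
  exists p q m n, [/\ side p q,
    is_minimal_projection (m : box P (4, s)) /\ is_minimal_projection (n : box P (4, s)),
    iota_ p * m = m /\ iota_ q * n = n, E 4 2 s * m = 0 /\ E 4 2 s * n = 0
  & tl_trace m = d /\ tl_trace n = d].
Proof.
case=> phi [phi_onto phi_eq phi_base phi_edges _].
have multfree (a b : vert Lambda) : (edges a b <= 1)%N by apply: leq_b1.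
have [D [DE Dpos D0 Dsum]] := class_dimensions phi_onto phi_eq phi_base phi_edges multfree.
have [x2 D2 D34 D3 D5] := Lambda_dimensions (nd_loop P) Dpos D0 Dsum.
pose v k : vert Lambda := inord k : 'I_8.
have edges0 a : (edges (base Lambda) a != 0%N) = (a == v 1%N).
  by rewrite -val_eqE /= inordK //; case: a => [[|[|[|[|[|[|[|[|a]]]]]]]]].
have edges1 a : (edges (v 1%N) a != 0%N) = (a == base Lambda) || (a == v 2%N).
  rewrite -!val_eqE /= /simple_edges !inordK //.
  by case: a => [[|[|[|[|[|[|[|[|a]]]]]]]]].
have edges2 a : (edges (v 2%N) a != 0%N) = [|| a == v 1%N, a == v 3%N | a == v 4%N].
  rewrite -!val_eqE /= /simple_edges !inordK //.
  by case: a => [[|[|[|[|[|[|[|[|a]]]]]]]]].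
have vu : uniq [:: base Lambda; v 1%N; v 2%N; v 3%N; v 4%N].
  by rewrite /= !inE -!val_eqE /= !inordK.
have e35 : edges (v 3%N) (v 5%N) <> 0%N by rewrite /= /simple_edges !inordK.
have e45 : edges (v 4%N) (v 5%N) <> 0%N by rewrite /= /simple_edges !inordK.
have n52 : v 5%N != v 2%N by rewrite -val_eqE /= !inordK.
have d0 := d_neq0_of x2.
have c2 := cls_jw2 phi_onto phi_eq phi_base phi_edges multfree edges0 edges1 vu DE D2.
have [p [q [sd [cp cq]]]] := side_exists phi_onto phi_eq phi_base phi_edges multfree
  edges0 edges1 edges2 vu DE D2 D34 D3 d0.
have [m [cm pm]] := above_edge phi_onto phi_eq phi_edges cp e35.
have [n [cn qn]] := above_edge phi_onto phi_eq phi_edges cq e45.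
have Ep : E 3 0 s * p = 0 by have := side_E0p sd 1; rewrite mul1r.
have Eq : E 3 0 s * q = 0 by have := side_E0q sd 1; rewrite mul1r.
split=> //; exists p, q, m, n; split=> //.
- by split; [exact: cls_minimal cm|exact: cls_minimal cn].
- by split; [exact: (E42_kill phi_eq c2 cm n52 Ep pm)|exact: (E42_kill phi_eq c2 cn n52 Eq qn)].
- by split; rewrite ?[tl_trace m](DE _ _ _ cm) ?[tl_trace n](DE _ _ _ cn).
Qed.

End GraphData.

Section GraphData'.
Variables (R : realType) (P : nondegenerate R).
Let HP := nd_subfactor P.
Local Open Scope ring_scope.
Notation delta := (loop P false).
Notation d := (delta ^+ 2 - 1).
Notation E := (E P).

Definition dual_index k : nat := if k == 6%N then 7 else if k == 7%N then 6 else k.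

(** [m k] belongs to the vertex [k] of depth 4. Duality enters as orthogonality: a half turn of
    [m k] has the dual class, so it is annihilated by the members of other classes. *)
Lemma Lambda'_data s : has_principal_graph P s Lambda' ->
  (delta ^+ 2) ^+ 2 = 6 * delta ^+ 2 - 4 /\
  exists p q (m : nat -> tl P 4 s) (K := [:: 5; 6; 7; 8]%N),
  [/\ side p q /\ forall k, k \in K ->
        is_minimal_projection (m k : box P (4, s)) /\ E 4 2 s * m k = 0,
      [/\ iota_ p * m 5%N = m 5%N, iota_ p * m 6%N = m 6%N, iota_ q * m 7%N = m 7%N
        & iota_ q * m 8%N = m 8%N],
      forall j k, j \in K -> k \in K -> j != k -> m j * m k = 0,
      forall j k, j \in K -> k \in K -> j != dual_index k -> m j * rp s (m k) = 0
    & [/\ tl_trace (m 5%N) + tl_trace (m 6%N) = d, tl_trace (m 7%N) + tl_trace (m 8%N) = d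
      & tl_trace (m 5%N) - tl_trace (m 6%N) - tl_trace (m 7%N) + tl_trace (m 8%N) = 2]].
Proof.
case=> phi [phi_onto phi_eq phi_base phi_edges phi_dual].
have multfree (a b : vert Lambda') : (edges a b <= 1)%N by apply: leq_b1.
have [D [DE Dpos D0 Dsum]] := class_dimensions phi_onto phi_eq phi_base phi_edges multfree.
have [[x2 D2] D34 D3 [D56 D78] D5678] := Lambda'_dimensions (nd_loop P) Dpos D0 Dsum.
pose v k : vert Lambda' := inord k : 'I_10.
have edges0 a : (edges (base Lambda') a != 0%N) = (a == v 1%N).
  by rewrite -val_eqE /= inordK //; case: a => [[|[|[|[|[|[|[|[|[|[|a]]]]]]]]]]].
have edges1 a : (edges (v 1%N) a != 0%N) = (a == base Lambda') || (a == v 2%N).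
  rewrite -!val_eqE /= /simple_edges !inordK //.
  by case: a => [[|[|[|[|[|[|[|[|[|[|a]]]]]]]]]]].
have edges2 a : (edges (v 2%N) a != 0%N) = [|| a == v 1%N, a == v 3%N | a == v 4%N].
  rewrite -!val_eqE /= /simple_edges !inordK //.
  by case: a => [[|[|[|[|[|[|[|[|[|[|a]]]]]]]]]]].
have vu : uniq [:: base Lambda'; v 1%N; v 2%N; v 3%N; v 4%N].
  by rewrite /= !inE -!val_eqE /= !inordK.
pose K := [:: 5; 6; 7; 8]%N.
have vK j k : j \in K -> k \in K -> j != k -> v j != v k.
  move=> jK kK jk; rewrite -val_eqE /= !inordK //.
  - by move: kK; rewrite !inE => /or4P[] /eqP->.
  - by move: jK; rewrite !inE => /or4P[] /eqP->.
have v2K k : k \in K -> v k != v 2%N.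
  by rewrite !inE => /or4P[] /eqP->; rewrite -val_eqE /= !inordK.
have d0 := d_neq0_of x2.
have c2 := cls_jw2 phi_onto phi_eq phi_base phi_edges multfree edges0 edges1 vu DE D2.
have [p [q [sd [cp cq]]]] := side_exists phi_onto phi_eq phi_base phi_edges multfree
  edges0 edges1 edges2 vu DE D2 D34 D3 d0.
have Ep : E 3 0 s * p = 0 by have := side_E0p sd 1; rewrite mul1r.
have Eq : E 3 0 s * q = 0 by have := side_E0q sd 1; rewrite mul1r.
have ed (a b : nat) : (a < 10)%N -> (b < 10)%N ->
    (((a, b) \in [:: (3, 5); (3, 6); (4, 7); (4, 8)]%N)) -> edges (v a) (v b) <> 0%N.
  move=> a10 b10; rewrite /= /simple_edges !inordK // !inE => /or4P[] /eqP[-> ->] //.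
have [m5 [c5 i5]] := above_edge phi_onto phi_eq phi_edges cp (ed 3 5 isT isT isT)%N.
have [m6 [c6 i6]] := above_edge phi_onto phi_eq phi_edges cp (ed 3 6 isT isT isT)%N.
have [m7 [c7 i7]] := above_edge phi_onto phi_eq phi_edges cq (ed 4 7 isT isT isT)%N.
have [m8 [c8 i8]] := above_edge phi_onto phi_eq phi_edges cq (ed 4 8 isT isT isT)%N.
pose m (k : nat) : tl P 4 s := nth 0 [:: m5; m6; m7; m8] (k - 5).
have cm k : k \in K -> cls phi (m k : box P (4, s)) (v k).
  by rewrite !inE => /or4P[] /eqP->.
have crp k : k \in K -> cls phi (rp s (m k) : box P (4, s)) (gdual (v k)).
  move=> kK; rewrite -[rp s _](@rotate_piE _ P 4 s isT).
  apply: (cls_dual phi_dual (cm k kK)); rewrite rotate_piE.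
  exact: (rp4_minimal (cls_minimal (cm k kK))).
have gd k : k \in K -> gdual (v k) = v (dual_index k).
  rewrite !inE => /or4P[] /eqP->; rewrite /gdual /= inordK //.
split=> //; exists p, q, m; split=> //; first split=> //.
- move=> k kK; split; first exact: cls_minimal (cm k kK).
  have [r [Er rm]] : exists r, E 3 0 s * r = 0 /\ iota_ r * m k = m k.
    by move: kK; rewrite !inE => /or4P[] /eqP->; [exists p|exists p|exists q|exists q].
  exact: (E42_kill phi_eq c2 (cm k kK) (v2K k kK) Er rm).
- move=> j k jK kK jk; have := cls_mul0 phi_eq 1 (cm k kK) (cm j jK).
  by rewrite mul1r; apply; apply: vK => //; rewrite eq_sym.
- move=> j k jK kK jk; have := cls_mul0 phi_eq 1 (crp k kK) (cm j jK).
  rewrite mul1r gd //; apply; apply: vK => //; last by rewrite eq_sym.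
  by move: kK; rewrite !inE => /or4P[] /eqP->.
- have T k : k \in K -> tl_trace (m k) = D (v k) by move=> kK; exact: (DE _ _ _ (cm k kK)).
  by rewrite !T // !inE //=.
Qed.

End GraphData'.

(** * The two contradictions *)

Section Conclusion.
Variable R : realType.
Local Open Scope ring_scope.

Lemma loop_neq0 (P : planar_star_algebra R) (HP : is_subfactor_planar_algebra P) s G v :
  has_principal_graph P s G -> edges (base G) v <> 0%N -> loop P false != 0.
Proof.
case=> phi [phi_onto phi_eq phi_base phi_edges _].
exact: (edge_loop_neq0 HP phi_onto phi_base phi_edges).
Qed.

Lemma Lambda_edge : edges (base Lambda) (inord 1 : 'I_8) <> 0%N.
Proof. by rewrite /= /simple_edges inordK. Qed.

(** In each shading both halves of the gap lie above minimal projections of the same trace. They are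
    therefore minimal, contrary to [gap_parts_not_minimal]. *)
Lemma no_Lambda_Lambda (P : nondegenerate R) : ~ has_principal_graphs P Lambda Lambda.
Proof.
case=> /Lambda_data [x2 [p0 [q0 [m0 [n0 [sd0 mn0 i0 E0 t0]]]]]].
case/Lambda_data => _ [p1 [q1 [m1 [n1 [sd1 mn1 i1 E1 t1]]]]].
pose p s : tl P 3 s := if s as b return tl P 3 b then p1 else p0.
pose q s : tl P 3 s := if s as b return tl P 3 b then q1 else q0.
have sd s : side (p s) (q s) by case: s.
have d0 := d_neq0_of x2; have D0 := D_neq0_of (nd_loop P) x2.
have x0 : loop P false ^+ 2 - 2 != 0 by move: D0; rewrite mulf_eq0 negb_or => /andP[].
have [sigma [sigma1 s6 rot]] := sigma_exists sd d0 x0.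
apply: (gap_parts_not_minimal sd x2 sigma1 s6 rot) => s.
have mE t : exists m n : tl P 4 t, [/\ is_minimal_projection (m : box P (4, t)) /\
    is_minimal_projection (n : box P (4, t)), iota_ (p t) * m = m /\ iota_ (q t) * n = n,
    E P 4 2 t * m = 0 /\ E P 4 2 t * n = 0 &
    tl_trace m = loop P false ^+ 2 - 1 /\ tl_trace n = loop P false ^+ 2 - 1].
  by case: t; [exists m1, n1|exists m0, n0].
have [m [n [[mm nm] [im jn] [Em En] [tm tn]]]] := mE s.
have part z r (e : tl P 4 s) : z ^+ 2 = 1 -> z^* = z ->
    (p s - q s) * r = z *: r -> is_minimal_projection (e : box P (4, s)) ->
    iota_ r * e = e -> E P 4 2 s * e = 0 -> tl_trace e = loop P false ^+ 2 - 1 ->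
    gap_part p q z s = e.
  move=> zz zr zp em re Ee te; apply: projection_eq.
  - exact: (gap_part_projection sd x2 sigma1 rot s zz zr).
  - by case: em.
  - exact: (gap_part_fix sd x2 sigma1 rot zz Ee (iota_u zp re)).
  - by rewrite te (tr_gap_part sd x2 sigma1 rot).
have m1c : (- 1)^* = - 1 :> R[i] by rewrite rmorphN1.
have m1s : (- 1) ^+ 2 = 1 :> R[i] by rewrite sqrrN expr1n.
have e1 := part 1 _ m (expr1n _ _) (rmorph1 _) (sym_p sd s) mm im Em tm.
have e2 := part (- 1) _ n m1s m1c (sym_q sd s) nm jn En tn.
move: e1 e2; rewrite /gap_part scale1r scaleN1r => e1 e2.
by split; [rewrite e1|rewrite e2].
Qed.

(** The trace of [G * su p q true] times its half turn is computed twice. Duality gives the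
    alternating sum of the four dimensions, which is 2; isotopy gives the left side of
    [sigma_sum_neq2]. *)
Lemma no_Lambda_Lambda' (P : nondegenerate R) : ~ has_principal_graphs P Lambda Lambda'.
Proof.
case=> /Lambda_data [x2 [p0 [q0 [_ [_ [sd0 _ _ _ _]]]]]].
case/Lambda'_data => _ [p1 [q1 [m [[sd1 mK] [i5 i6 i7 i8] mm mr [t56 t78 t2]]]]].
pose p s : tl P 3 s := if s as b return tl P 3 b then p1 else p0.
pose q s : tl P 3 s := if s as b return tl P 3 b then q1 else q0.
have sd s : side (p s) (q s) by case: s.
have d0 := d_neq0_of x2; have D0 := D_neq0_of (nd_loop P) x2.
have x0 : loop P false ^+ 2 - 2 != 0 by move: D0; rewrite mulf_eq0 negb_or => /andP[].
have [sigma [sigma1 s6 rot]] := sigma_exists sd d0 x0.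
have LF := level_four_boxes sd d0 D0 sigma1 rot true.
set G := sgap p q true.
have m1c : (- 1)^* = - 1 :> R[i] by rewrite rmorphN1.
have m1s : (- 1) ^+ 2 = 1 :> R[i] by rewrite sqrrN expr1n.
have mmk k : k \in [:: 5; 6; 7; 8]%N -> m k * m k = m k.
  by move=> /mK [[[pp _] _ _] _].
have smk k : k \in [:: 5; 6; 7; 8]%N -> tl_star (m k) = m k.
  by move=> /mK [[[_ sp] _ _] _].
have Emk k : k \in [:: 5; 6; 7; 8]%N -> E P 4 2 true * m k = 0 by move=> /mK [].
have part z r j k : j \in [:: 5; 6; 7; 8]%N -> k \in [:: 5; 6; 7; 8]%N -> j != k ->
    z ^+ 2 = 1 -> z^* = z -> (p true - q true) * r = z *: r ->
    iota_ r * m j = m j -> iota_ r * m k = m k ->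
    tl_trace (m j) + tl_trace (m k) = loop P false ^+ 2 - 1 ->
    gap_part p q z true = m j + m k.
  move=> jK kK jk zz zr zp rj rk te; apply: projection_eq.
  - exact: (gap_part_projection sd x2 sigma1 rot true zz zr).
  - split; last by rewrite -[LHS]/(tl_star (m j + m k)) starD !smk.
    change ((m j + m k) * (m j + m k) = m j + m k).
    have kj : k != j by rewrite eq_sym.
    by rewrite mulrDl !mulrDr !mmk // !mm // addr0 add0r.
  - rewrite mulrDr (gap_part_fix sd x2 sigma1 rot zz (Emk j jK) (iota_u zp rj)).
    by rewrite (gap_part_fix sd x2 sigma1 rot zz (Emk k kK) (iota_u zp rk)).
  - by rewrite trD te (tr_gap_part sd x2 sigma1 rot).
have e1 := part 1 _ 5 6 isT isT isT (expr1n _ _) (rmorph1 _) (sym_p sd true) i5 i6 t56.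
have e2 := part (- 1) _ 7 8 isT isT isT m1s m1c (sym_q sd true) i7 i8 t78.
have two : (2 : R[i]) != 0 by rewrite pnatr_eq0.
have GE : G = m 5 + m 6 + m 7 + m 8.
  rewrite -addrA -e1 -e2 /gap_part -/G.
  by linear_eq R[i] (tl P 4 true); rewrite /=; field; rewrite ?two.
have uE : G * su p q true = m 5 + m 6 - m 7 - m 8.
  rewrite -addrA -opprD -e1 -e2 /gap_part -/G.
  by linear_eq R[i] (tl P 4 true); rewrite /=; field; rewrite ?two.
have rpG : rp true G = G by exact: (rp_gap sd d0 D0 sigma1 s6 rot).
(* The half turn of [m k] lies below [G] and is orthogonal to three of its four summands; hence it
   lies below the fourth and equals it by minimality. *)
have rpm k : k \in [:: 5; 6; 7; 8]%N -> rp true (m k) = m (dual_index k).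
  move=> kK; have dK : dual_index k \in [:: 5; 6; 7; 8]%N.
    by move: kK; rewrite !inE => /or4P[] /eqP->.
  have mG : m k * G = m k.
    rewrite GE !mulrDr; move: kK; rewrite !inE => /or4P[] /eqP->;
      by rewrite mmk // !mm // !(addr0, add0r).
  have Gr : G * rp true (m k) = rp true (m k) by rewrite -{1}rpG -rpM4 mG.
  have rE : m (dual_index k) * rp true (m k) = rp true (m k).
    have z j (jK : j \in [:: 5; 6; 7; 8]%N) := mr j k jK kK.
    rewrite -[RHS]Gr GE !mulrDl; move: dK; rewrite !inE => /or4P[] /eqP dk; rewrite dk.
    - by rewrite (z 6 isT) ?dk // (z 7 isT) ?dk // (z 8 isT) ?dk // !addr0.
    - by rewrite (z 5 isT) ?dk // (z 7 isT) ?dk // (z 8 isT) ?dk // !addr0 add0r.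
    - by rewrite (z 5 isT) ?dk // (z 6 isT) ?dk // (z 8 isT) ?dk // !addr0 !add0r.
    - by rewrite (z 5 isT) ?dk // (z 6 isT) ?dk // (z 7 isT) ?dk // !add0r.
  have [rP r0 _] := rp4_minimal (proj1 (mK k kK)).
  have [_ _ hmin] := proj1 (mK _ dK).
  by have [r0'|] := hmin _ rP rE; first by rewrite r0' eqxx in r0.
have := sigma_sum_neq2 sigma1 s6; apply/negP; rewrite negbK; apply/eqP.
transitivity (tl_trace ((G * su p q true) * rp true (G * su p q true))).
  have e : rp true (G * su p q true) = sigma^* ^+ 3 *: (G * sv p q true).
    by rewrite rpM4 rpG (rp_su sd rot) -scalerAl (gap_v LF).
  rewrite e -scalerAr trZ -mulrN; congr (_ * _); rewrite -(tr_gap_uv LF); congr tl_trace.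
  by rewrite -[RHS]mulrA (mulrA (su p q true)) (gap_u LF) -!mulrA (pull (gap_gap LF)).
rewrite uE !rpB !rpD !rpm //= -t2.
rewrite !(mulrBl, mulrDl, mulrBr, mulrDr) !mmk // !mm //.
rewrite !(trB, trD) ?tr0; ring.
Qed.

End Conclusion.

Theorem theorem1p2 (R : realType) :
  (forall P : planar_star_algebra R,
     is_subfactor_planar_algebra P -> ~ has_principal_graphs P Lambda Lambda') /\
  (forall P : planar_star_algebra R,
     is_subfactor_planar_algebra P -> ~ has_principal_graphs P Lambda Lambda).
Proof.
split=> P HP hg; have l0 := loop_neq0 HP (proj1 hg) Lambda_edge.
- exact: (@no_Lambda_Lambda' R (Nondegenerate HP l0) hg).
- exact: (@no_Lambda_Lambda R (Nondegenerate HP l0) hg).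
Qed.
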